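(* Let $K$ be a pathwise connected poset. If a DR-presheaf $\mathfrak{T}$ over $K$ has an embedding $I:\mathfrak{T}\to\mathfrak{C}$ into a Hilbert presheaf $\mathfrak{C}$ over $K$, then every $\varrho\in\mathrm{obj}\,\widetilde{\mathfrak{T}}$ is liftable, i.e. its holonomy representation $\chi_\varrho:\pi_1(K)\to QG_\varrho=NG_\varrho/G_\varrho$ has a lift to $NG_\varrho$: there is a group morphism $\widetilde\chi_\varrho:\pi_1(K)\to NG_\varrho$ with $q\circ\widetilde\chi_\varrho=\chi_\varrho$, where $q:NG_\varrho\to QG_\varrho$ is the quotient map.
   Context: Posets. A 1-simplex of $K$ is a triple $b=(\partial_0b,\partial_1b;|b|)$ of elements of $K$ with $\partial_0b,\partial_1b\le|b|$; a 2-simplex is $c=(\partial_0c,\partial_1c,\partial_2c,|c|)$ with $|c|\in K$, $\partial_kc$ 1-simplices with $|\partial_kc|\le|c|$, and $\partial_0\partial_0c=\partial_0\partial_1c$, $\partial_1\partial_0c=\partial_0\partial_2c$, $\partial_1\partial_1c=\partial_1\partial_2c$. A path $\gamma:o\to o'$ is a finite sequence $(b_n,\dots,b_1)$ of 1-simplices with $\partial_0b_i=\partial_1b_{i+1}$, $\partial_1b_1=o$, $\partial_0b_n=o'$; paths compose by juxtaposition. $K$ is pathwise connected if any two elements are joined by a path. For a fixed $a\in K$, $K(a)$ is the set of paths $a\to a$ and $\pi_1(K)=K(a)/\sim$, where $\sim$ is generated by replacing an entry $\partial_1c$ by the two consecutive entries $\partial_0c,\partial_2c$ ($\partial_2c$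 run first) and vice versa, $c$ a 2-simplex. Presheaves. A presheaf of $C^*$-categories $\mathfrak{T}=(T,r)^K$ is a family of $C^*$-categories $T_o$ with $*$-functors $r_{oo'}:T_{o'}\to T_o$, $o\le o'$, injective on the sets of arrows, with $r_{oo'}\circ r_{o'o''}=r_{oo''}$. It is a presheaf bundle if all $r_{oo'}$ are isomorphisms of categories. It is a symmetric tensor presheaf with simple units if every $T_o$ is a symmetric tensor $C^*$-category with $(\iota_o,\iota_o)\simeq\mathbb{C}$ ($\iota_o$ the identity object) and all $r_{oo'}$ preserve tensor products and symmetries. The section category $\widetilde{\mathfrak{T}}$ has objects the families $\varrho=\{\varrho_o\in\mathrm{obj}\,T_o\}$ with $r_{oo'}(\varrho_{o'})=\varrho_o$, arrows the families $t=\{t_o\in(\varrho_o,\varsigma_o)\}$ with $r_{oo'}(t_{o'})=t_o$, and fibrewise operations; it is a symmetric tensor $C^*$-category. A DR-category is a symmetric tensor $C^*$-category with simple unit, conjugates (for every object $\rho$ there are an object $\overline\rho$ and $R\in(\iota,\overline\rho\rho)$, $\overline R\in(\iota,\rho\overline\rho)$ with $(\overline R^*\otimes1_\rho)\circ(1_\rho\otimes R)=1_\rho$, $(R^*\otimes1_{\overline\rho})\circ(1_{\overline\rho}\otimes\overline R)=1_{\overline\rho}$), direct sums and subobjects. A DR-presheaf is a symmetric tensor presheaf with simple units such that $\widetilde{\mathfrak{T}}$ is a DR-category. Embeddings. A Hilbert presheaf is a symmetric tensor presheaf $\mathfrak{C}=(C,R,\otimes,\vartheta)^K$ in which every $C_o$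 is a full symmetric tensor subcategory of the category $\mathbf{Hilb}$ of Hilbert spaces and bounded operators, with flip symmetry, and every $R_{oo'}$ is full (surjective on each set of arrows). An embedding $I:\mathfrak{T}\to\mathfrak{C}$ is a family of symmetric tensor $*$-functors $I_o:T_o\to C_o$, injective on each set of arrows, commuting with the restriction functors. Associated presheaf bundle ${}_\beta\mathfrak{T}$. For $\varrho,\varsigma\in\mathrm{obj}\,\widetilde{\mathfrak{T}}$ let ${}_\phi(\varrho_a,\varsigma_a)$ be the space of all $t_a$, where $\{t_o\in(\varrho_o,\varsigma_o)\}_{o\ge a}$ satisfies $r_{oo'}(t_{o'})=t_o$ for $a\le o\le o'$ (evaluations at $a$ of arrows of the section category of the restriction of $\mathfrak{T}$ to $\{o\in K:o\ge a\}$). The category ${}_\beta T_a$ has objects $\varrho^a:=(\varrho,a)$, $\varrho\in\mathrm{obj}\,\widetilde{\mathfrak{T}}$, and arrows ${}_\beta(\varrho^a,\varsigma^a):={}_\phi(\varrho_a,\varsigma_a)$. The functors ${}_\beta r_{aa'}:{}_\beta T_{a'}\to{}_\beta T_a$, $a\le a'$, send $\varrho^{a'}$ to $\varrho^a$ and $f$ to $r_{aa'}(f)$. With $\varrho^a\varsigma^a:=(\varrho\varsigma)^a$ and the tensor product and symmetry of arrows of $T_a$, ${}_\beta\mathfrak{T}$ is a symmetric tensor presheaf bundle. ${}_\beta\widehat\varrho$ is its sub-presheaf bundle whose fibre at $o$ is the full subcategory of ${}_\beta T_o$ with objects the tensor powers of $\varrho^o$ (including the 0-th power). The holonomy $\chi_\varrho$.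 For a compact group $G\subseteq\mathbb{U}(d)$ with normalizer $NG$ in $\mathbb{U}(d)$ and $QG=NG/G$, $\widehat\pi_G$ is the symmetric tensor $C^*$-category with objects the tensor powers $\pi_G^r$, $r=0,1,2,\dots$, of the defining representation on $\mathbb{C}^d$, arrows the intertwiners and flip symmetry. Any $u\in NG$ defines the symmetric tensor automorphism $\widehat u(t):=u^{\otimes s}\circ t\circ(u^{\otimes r})^*$, $t\in(\pi_G^r,\pi_G^s)$, depending only on $uG\in QG$; this gives an injective morphism $QG\to\mathbf{aut}\,\widehat\pi_G$. For a section $\varrho$ of a DR-presheaf there are $d\in\mathbb{N}$, a compact Lie group $G_\varrho\subseteq\mathbb{U}(d)$, a symmetric tensor isomorphism of the fibre of ${}_\beta\widehat\varrho$ at $a$ with $\widehat\pi_{G_\varrho}$, and a morphism $\chi_\varrho:\pi_1(K)\to QG_\varrho$, such that for all $\gamma=(b_n,\dots,b_1)\in K(a)$ the automorphism $Z_\gamma={}_\beta r_{\partial_0b_n,|b_n|}\circ{}_\beta r_{|b_n|,\partial_1b_n}\circ\cdots\circ{}_\beta r_{\partial_0b_1,|b_1|}\circ{}_\beta r_{|b_1|,\partial_1b_1}$ of the fibre at $a$ (where ${}_\beta r_{o'o}:={}_\beta r_{oo'}^{-1}$ for $o\le o'$) corresponds to the automorphism of $\widehat\pi_{G_\varrho}$ defined by $\chi_\varrho([\gamma])$. *)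

(* Defs.v *)
From HB Require Import structures.
From mathcomp Require Import all_boot all_order all_algebra generic_quotient.
From mathcomp Require Import all_classical all_reals all_analysis.
From mathcomp Require Import complex.

Set Implicit Arguments.
Unset Strict Implicit.
Unset Printing Implicit Defensive.

Import Order.TTheory GRing.Theory Num.Theory.
Import numFieldNormedType.Exports.

Local Open Scope quotient_scope.
Local Open Scope ring_scope.

Reserved Notation "g \oc f" (at level 40, left associativity).
Reserved Notation "f \ota g" (at level 40, left associativity).
Reserved Notation "x \oto y" (at level 40, left associativity).

(* Strict tensor categories: equations between objects are Leibniz equalities,
   and [aeq f g] says that two arrows, whose types are only propositionally
   equal, are the same arrow. *)
Section Arrows.
Variables (O : Type) (hom : O -> O -> Type).

Inductive aeq x y (f : hom x y) : forall x' y', hom x' y' -> Prop :=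
  aeq_refl : aeq f f.

Definition acast x y x' y' (ex : x = x') (ey : y = y') (f : hom x y) :
    hom x' y' :=
  match ex in _ = z, ey in _ = w return hom z w with
  | erefl, erefl => f
  end.

Lemma aeq_cast x y x' y' (f : hom x y) (g : hom x' y') :
  aeq f g -> exists (ex : x = x') (ey : y = y'), acast ex ey f = g.
Proof. by case; exists erefl, erefl. Qed.

Lemma acast_id x y (ex : x = x) (ey : y = y) (f : hom x y) : acast ex ey f = f.
Proof. by rewrite (Prop_irrelevance ex erefl) (Prop_irrelevance ey erefl). Qed.

Lemma aeq_eq x y (f g : hom x y) : aeq f g -> f = g.
Proof. by move=> /aeq_cast[ex [ey <-]]; rewrite acast_id. Qed.

Lemma eq_aeq x y (f g : hom x y) : f = g -> aeq f g.
Proof. by move=> ->. Qed.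

Lemma aeq_sym x y x' y' (f : hom x y) (g : hom x' y') : aeq f g -> aeq g f.
Proof. by case. Qed.

Lemma aeq_trans x y x' y' x'' y'' (f : hom x y) (g : hom x' y')
  (h : hom x'' y'') : aeq f g -> aeq g h -> aeq f h.
Proof. by move=> fg gh; case: gh. Qed.

Lemma acast_aeq x y x' y' (ex : x = x') (ey : y = y') (f : hom x y) :
  aeq (acast ex ey f) f.
Proof. by case: x' / ex; case: y' / ey. Qed.

Lemma aeq_acast x y x' y' (ex : x = x') (ey : y = y') (f : hom x y) :
  aeq f (acast ex ey f).
Proof. exact/aeq_sym/acast_aeq. Qed.

End Arrows.

Section Categories.
Variable R : realType.
Local Notation C := R[i].

Section Mixins.
Variables (O : Type) (hom : O -> O -> lmodType C).

Record starcat_mixin := StarcatMixin {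
  mcomp : forall x y z, hom y z -> hom x y -> hom x z;
  mid : forall x, hom x x;
  mstar : forall x y, hom x y -> hom y x;
  mcompA : forall x y z w (h : hom z w) (g : hom y z) (f : hom x y),
    mcomp h (mcomp g f) = mcomp (mcomp h g) f;
  mcomp1f : forall x y (f : hom x y), mcomp (mid y) f = f;
  mcompf1 : forall x y (f : hom x y), mcomp f (mid x) = f;
  mcomp_linl : forall x y z a (g g' : hom y z) (f : hom x y),
    mcomp (a *: g + g') f = a *: mcomp g f + mcomp g' f;
  mcomp_linr : forall x y z a (g : hom y z) (f f' : hom x y),
    mcomp g (a *: f + f') = a *: mcomp g f + mcomp g f';
  mstarK : forall x y (f : hom x y), mstar (mstar f) = f;
  mstar_lin : forall x y a (f g : hom x y),
    mstar (a *: f + g) = a^* *: mstar f + mstar g;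
  mstar_comp : forall x y z (g : hom y z) (f : hom x y),
    mstar (mcomp g f) = mcomp (mstar f) (mstar g)
}.

Record tensor_mixin (m : starcat_mixin) := TensorMixin {
  mot : O -> O -> O;
  mou : O;
  motA : forall x y z, mot x (mot y z) = mot (mot x y) z;
  mot1x : forall x, mot mou x = x;
  motx1 : forall x, mot x mou = x;
  mta : forall x y x' y', hom x y -> hom x' y' -> hom (mot x x') (mot y y');
  mta_linl : forall x y x' y' a (f f' : hom x y) (g : hom x' y'),
    mta (a *: f + f') g = a *: mta f g + mta f' g;
  mta_linr : forall x y x' y' a (f : hom x y) (g g' : hom x' y'),
    mta f (a *: g + g') = a *: mta f g + mta f g';
  mta_comp : forall x y z x' y' z' (g : hom y z) (f : hom x y)
      (g' : hom y' z') (f' : hom x' y'),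
    mta (mcomp m g f) (mcomp m g' f') = mcomp m (mta g g') (mta f f');
  mta_id : forall x y, mta (mid m x) (mid m y) = mid m (mot x y);
  mta_star : forall x y x' y' (f : hom x y) (g : hom x' y'),
    mstar m (mta f g) = mta (mstar m f) (mstar m g);
  mtaA : forall x y x' y' x'' y''
      (f : hom x y) (g : hom x' y') (h : hom x'' y''),
    aeq (hom := hom) (mta f (mta g h)) (mta (mta f g) h);
  mta1f : forall x y (f : hom x y), aeq (hom := hom) (mta (mid m mou) f) f;
  mtaf1 : forall x y (f : hom x y), aeq (hom := hom) (mta f (mid m mou)) f;
  msy : forall x y, hom (mot x y) (mot y x);
  msy_nat : forall x y x' y' (f : hom x y) (f' : hom x' y'),
    mcomp m (msy y y') (mta f f') = mcomp m (mta f' f) (msy x x');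
  msyK : forall x y, mcomp m (msy y x) (msy x y) = mid m (mot x y);
  msy_star : forall x y, mstar m (msy x y) = msy y x;
  msy_hex : forall x y z,
    aeq (hom := hom) (msy x (mot y z))
      (mcomp m (mta (mid m y) (msy x z))
         (acast (hom := hom) (esym (motA x y z)) (esym (motA y x z))
            (mta (msy x y) (mid m z))))
}.

End Mixins.

(* A symmetric tensor *-category: the algebraic structure underlying a
   symmetric tensor C*-category. *)
Record stcat := STCat {
  obj : Type;
  hom : obj -> obj -> lmodType C;
  starm : starcat_mixin hom;
  tensm : tensor_mixin starm
}.
Arguments hom : clear implicits.

Definition compc (T : stcat) (x y z : obj T) : hom T y z -> hom T x y -> hom T x z :=
  @mcomp _ _ (starm T) x y z.
Definition idc (T : stcat) (x : obj T) : hom T x x := mid (starm T) x.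
Definition star (T : stcat) (x y : obj T) : hom T x y -> hom T y x :=
  @mstar _ _ (starm T) x y.
Definition ot (T : stcat) : obj T -> obj T -> obj T := mot (tensm T).
Definition ou (T : stcat) : obj T := mou (tensm T).
Definition ta (T : stcat) (x y x' y' : obj T) :
    hom T x y -> hom T x' y' -> hom T (ot x x') (ot y y') :=
  @mta _ _ _ (tensm T) x y x' y'.
Definition sy (T : stcat) (x y : obj T) : hom T (ot x y) (ot y x) :=
  msy (tensm T) x y.

Local Notation "g \oc f" := (compc g f).
Local Notation "f \ota g" := (ta f g).
Local Notation "x \oto y" := (ot x y).
Local Notation "f === g" := (aeq (hom := hom _) f g) (at level 70).

Section StcatTheory.
Variable T : stcat.
Implicit Types x y z : obj T.

Definition compA x y z w (h : hom T z w) (g : hom T y z) (f : hom T x y) :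
  h \oc (g \oc f) = (h \oc g) \oc f := mcompA (starm T) h g f.
Definition comp1f x y (f : hom T x y) : idc y \oc f = f := mcomp1f (starm T) f.
Definition compf1 x y (f : hom T x y) : f \oc idc x = f := mcompf1 (starm T) f.
Definition comp_linl x y z a (g g' : hom T y z) (f : hom T x y) :
  (a *: g + g') \oc f = a *: (g \oc f) + g' \oc f :=
  mcomp_linl (starm T) a g g' f.
Definition comp_linr x y z a (g : hom T y z) (f f' : hom T x y) :
  g \oc (a *: f + f') = a *: (g \oc f) + g \oc f' :=
  mcomp_linr (starm T) a g f f'.
Definition starK x y (f : hom T x y) : star (star f) = f := mstarK (starm T) f.
Definition star_lin x y a (f g : hom T x y) :
  star (a *: f + g) = a^* *: star f + star g := mstar_lin (starm T) a f g.
Definition star_comp x y z (g : hom T y z) (f : hom T x y) :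
  star (g \oc f) = star f \oc star g := mstar_comp (starm T) g f.
Definition otA x y z : x \oto (y \oto z) = (x \oto y) \oto z :=
  motA (tensm T) x y z.
Definition ot1x x : ou T \oto x = x := mot1x (tensm T) x.
Definition otx1 x : x \oto ou T = x := motx1 (tensm T) x.
Definition ta_linl x y x' y' a (f f' : hom T x y) (g : hom T x' y') :
  (a *: f + f') \ota g = a *: (f \ota g) + f' \ota g :=
  mta_linl (tensm T) a f f' g.
Definition ta_linr x y x' y' a (f : hom T x y) (g g' : hom T x' y') :
  f \ota (a *: g + g') = a *: (f \ota g) + f \ota g' :=
  mta_linr (tensm T) a f g g'.
Definition ta_comp x y z x' y' z' (g : hom T y z) (f : hom T x y)
    (g' : hom T y' z') (f' : hom T x' y') :
  (g \oc f) \ota (g' \oc f') = (g \ota g') \oc (f \ota f') :=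
  mta_comp (tensm T) g f g' f'.
Definition ta_id x y : idc x \ota idc y = idc (x \oto y) := mta_id (tensm T) x y.
Definition ta_star x y x' y' (f : hom T x y) (g : hom T x' y') :
  star (f \ota g) = star f \ota star g := mta_star (tensm T) f g.
Definition taA x y x' y' x'' y''
    (f : hom T x y) (g : hom T x' y') (h : hom T x'' y'') :
  f \ota (g \ota h) === (f \ota g) \ota h := mtaA (tensm T) f g h.
Definition ta1f x y (f : hom T x y) : idc (ou T) \ota f === f :=
  mta1f (tensm T) f.
Definition taf1 x y (f : hom T x y) : f \ota idc (ou T) === f :=
  mtaf1 (tensm T) f.
Definition sy_nat x y x' y' (f : hom T x y) (f' : hom T x' y') :
  sy y y' \oc (f \ota f') = (f' \ota f) \oc sy x x' := msy_nat (tensm T) f f'.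
Definition syK x y : sy y x \oc sy x y = idc (x \oto y) := msyK (tensm T) x y.
Definition sy_star x y : star (sy x y) = sy y x := msy_star (tensm T) x y.
Definition sy_hex x y z :
  sy x (y \oto z) ===
    (idc y \ota sy x z) \oc
      acast (hom := hom T) (esym (otA x y z)) (esym (otA y x z))
        (sy x y \ota idc z) :=
  msy_hex (tensm T) x y z.

Lemma aeq_homE x y x' y' (f : hom T x y) (g : hom T x' y') :
  f === g ->
  exists (ex : x = x') (ey : y = y'), acast (hom := hom T) ex ey f = g.
Proof. exact: aeq_cast. Qed.

Lemma aeq_rfl x y (f : hom T x y) : f === f.
Proof. exact: aeq_refl. Qed.

Lemma aeq_comp x y z x' y' z' (g : hom T y z) (f : hom T x y)
    (g' : hom T y' z') (f' : hom T x' y') :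
  g === g' -> f === f' -> g \oc f === g' \oc f'.
Proof.
move=> /aeq_homE[ey [ez]] + /aeq_homE[ex [ey']].
by subst => <- <-; rewrite !acast_id.
Qed.

Lemma aeq_star x y x' y' (f : hom T x y) (f' : hom T x' y') :
  f === f' -> star f === star f'.
Proof. by move=> /aeq_homE[ex [ey]]; subst => <-; rewrite acast_id. Qed.

Lemma aeq_lin x y x' y' a (f g : hom T x y) (f' g' : hom T x' y') :
  f === f' -> g === g' -> a *: f + g === a *: f' + g'.
Proof.
move=> /aeq_homE[ey [ez]] + /aeq_homE[ex [ey']].
by subst => <- <-; rewrite !acast_id.
Qed.

Lemma aeq_ta x y x' y' z w z' w' (g : hom T z w) (f : hom T x y)
    (g' : hom T z' w') (f' : hom T x' y') :
  f === f' -> g === g' -> f \ota g === f' \ota g'.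
Proof.
move=> /aeq_homE[ex [ey]] + /aeq_homE[ez [ew]].
by subst => <- <-; rewrite !acast_id.
Qed.

Lemma aeq_id x x' : x = x' -> idc x === idc x'.
Proof. by move=> ->. Qed.

Lemma aeq_sy x y x' y' : x = x' -> y = y' -> sy x y === sy x' y'.
Proof. by move=> -> ->. Qed.

Lemma comp0f x y z (f : hom T x y) : (0 : hom T y z) \oc f = 0.
Proof.
by have := comp_linl (- 1) (0 : hom T y z) 0 f; rewrite scaler0 addr0 scaleN1r addNr.
Qed.

Lemma compf0 x y z (f : hom T y z) : f \oc (0 : hom T x y) = 0.
Proof.
by have := comp_linr (- 1) f (0 : hom T x y) 0; rewrite scaler0 addr0 scaleN1r addNr.
Qed.

Lemma star0 x y : star (0 : hom T x y) = 0.
Proof.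
have := star_lin (- 1) (0 : hom T x y) 0.
by rewrite scaler0 addr0 rmorphN rmorph1 scaleN1r addNr.
Qed.

Lemma star_id x : star (idc x) = idc x.
Proof. by rewrite -[LHS]compf1 -{2}(starK (idc x)) -star_comp compf1 starK. Qed.

End StcatTheory.

Fixpoint opow (T : stcat) (x : obj T) (r : nat) : obj T :=
  if r is s.+1 then x \oto opow x s else ou T.

Lemma opowD (T : stcat) (x : obj T) r s :
  opow x r \oto opow x s = opow x (r + s).
Proof. by elim: r => [|r IH] /=; rewrite ?ot1x // -otA IH. Qed.

(* Symmetric tensor *-functors; tensor products are preserved strictly. *)
Record stfun (S T : stcat) := STFun {
  fo :> obj S -> obj T;
  fa : forall x y, hom S x y -> hom T (fo x) (fo y);
  fa_lin : forall x y a (f g : hom S x y), fa (a *: f + g) = a *: fa f + fa g;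
  fa_comp : forall x y z (g : hom S y z) (f : hom S x y),
    fa (g \oc f) = fa g \oc fa f;
  fa_id : forall x, fa (idc x) = idc (fo x);
  fa_star : forall x y (f : hom S x y), fa (star f) = star (fa f);
  fo_ou : fo (ou S) = ou T;
  fo_ot : forall x y, fo (x \oto y) = fo x \oto fo y;
  fa_ta : forall x y x' y' (f : hom S x y) (g : hom S x' y'),
    fa (f \ota g) === fa f \ota fa g;
  fa_sy : forall x y, fa (sy x y) === sy (fo x) (fo y)
}.
Arguments fa [S T] s [x y].

Lemma aeq_fa (S T : stcat) (F : stfun S T) x y x' y'
  (f : hom S x y) (g : hom S x' y') : f === g -> fa F f === fa F g.
Proof. by move=> /aeq_homE[ex [ey]]; subst => <-; rewrite acast_id. Qed.

Definition faithful (S T : stcat) (F : stfun S T) : Prop :=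
  forall x y, injective (@fa _ _ F x y).

Definition full (S T : stcat) (F : stfun S T) : Prop :=
  forall x y (g : hom T (F x) (F y)), exists f : hom S x y, fa F f = g.

Definition is_stiso (S T : stcat) (F : stfun S T) : Prop :=
  bijective F /\ forall x y, bijective (@fa _ _ F x y).

(* cpos: f^* o f is a positive element of the C*-algebra (x, x). *)
Record cstcat := CSTCat {
  cobj : Type;
  chom : cobj -> cobj -> completeNormedModType C;
  cstarm : starcat_mixin (fun x y => chom x y : lmodType C);
  ctensm : tensor_mixin cstarm;
  cnorm_comp : forall x y z (g : chom y z) (f : chom x y),
    `|mcomp cstarm g f : chom x z| <= `|g| * `|f|;
  cnorm_star : forall x y (f : chom x y),
    `|mcomp cstarm (mstar cstarm f) f : chom x x| = `|f| ^+ 2;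
  cpos : forall x y (f : chom x y), exists g : chom x x,
    mcomp cstarm (mstar cstarm f) f = mcomp cstarm (mstar cstarm g) g
}.

Coercion stcat_of_cstcat (T : cstcat) : stcat := STCat (ctensm T).

Definition simple_unit (T : stcat) : Prop :=
  bijective (fun c : C => c *: idc (ou T)).

Definition has_conjugates (T : stcat) : Prop :=
  forall x : obj T, exists (xb : obj T)
    (Q : hom T (ou T) (xb \oto x)) (Qb : hom T (ou T) (x \oto xb)),
    (star Qb \ota idc x) \oc
      acast (hom := hom T) erefl (otA x xb x) (idc x \ota Q) === idc x /\
    (star Q \ota idc xb) \oc
      acast (hom := hom T) erefl (otA xb x xb) (idc xb \ota Qb) === idc xb.

Definition has_sums (T : stcat) : Prop :=
  forall x y : obj T, exists (z : obj T) (V : hom T x z) (W : hom T y z),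
    [/\ star V \oc V = idc x, star W \oc W = idc y &
        V \oc star V + W \oc star W = idc z].

Definition has_subobjects (T : stcat) : Prop :=
  forall (x : obj T) (E : hom T x x), star E = E -> E \oc E = E ->
    exists (y : obj T) (V : hom T y x), star V \oc V = idc y /\ V \oc star V = E.

Definition is_DR (T : stcat) : Prop :=
  [/\ simple_unit T, has_conjugates T, has_sums T & has_subobjects T].

(* The full tensor subcategory on objects labelled by O, i.e. with arrows
   x -> y those of T from m x to m y. *)
Section Pull.
Variables (T : stcat) (O : Type) (m : O -> obj T) (u : O) (t : O -> O -> O).
Hypotheses (tA : forall x y z, t x (t y z) = t (t x y) z)
  (t1x : forall x, t u x = x) (tx1 : forall x, t x u = x)
  (mu : ou T = m u) (mt : forall x y, m x \oto m y = m (t x y)).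

Let phom (x y : O) : lmodType C := hom T (m x) (m y).

Definition pull_starm : starcat_mixin phom :=
  @StarcatMixin O phom
    (fun x y z => @compc T (m x) (m y) (m z)) (fun x => idc (m x))
    (fun x y => @star T (m x) (m y))
    (fun x y z w h g f => compA h g f) (fun x y f => comp1f f)
    (fun x y f => compf1 f) (fun x y z a g g' f => comp_linl a g g' f)
    (fun x y z a g f f' => comp_linr a g f f') (fun x y f => starK f)
    (fun x y a f g => star_lin a f g) (fun x y z g f => star_comp g f).

Definition pull_ta (x y x' y' : O) (f : phom x y) (g : phom x' y') :
    phom (t x x') (t y y') :=
  acast (hom := hom T) (mt x x') (mt y y') (f \ota g).

Definition pull_sy (x y : O) : phom (t x y) (t y x) :=
  acast (hom := hom T) (mt x y) (mt y x) (sy (m x) (m y)).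

Lemma pull_aeq (x y x' y' : O) (f : phom x y) (g : phom x' y') :
  x = x' -> y = y' -> f === g -> aeq (hom := phom) f g.
Proof. by move=> ex ey; subst => fg; apply/eq_aeq/(aeq_eq fg). Qed.

Lemma pull_eq (x y : O) (f g : phom x y) : f === g -> f = g.
Proof. exact: aeq_eq. Qed.

Lemma aeq_pull (x y x' y' : O) (f : phom x y) (g : phom x' y') :
  aeq (hom := phom) f g -> f === g.
Proof.
move=> fg; have [ex [ey e]] := aeq_cast fg.
by subst; rewrite acast_id; apply: aeq_refl.
Qed.

Lemma pull_taE (x y x' y' : O) (f : phom x y) (g : phom x' y') :
  pull_ta f g === f \ota g.
Proof. exact: acast_aeq. Qed.

Lemma pull_syE (x y : O) : pull_sy x y === sy (m x) (m y).
Proof. exact: acast_aeq. Qed.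

Definition pull_tensm : tensor_mixin pull_starm.
Proof.
unshelve refine (@TensorMixin O phom pull_starm t u tA t1x tx1 pull_ta
  _ _ _ _ _ _ _ _ pull_sy _ _ _ _).
- move=> x y x' y' a f f' g; apply: pull_eq; apply: aeq_trans (pull_taE _ _) _.
  rewrite ta_linl; apply: aeq_lin; exact/aeq_sym/pull_taE.
- move=> x y x' y' a f f' g; apply: pull_eq; apply: aeq_trans (pull_taE _ _) _.
  rewrite ta_linr; apply: aeq_lin; exact/aeq_sym/pull_taE.
- move=> x y z x' y' z' g f g' f'; apply: pull_eq; apply: aeq_trans (pull_taE _ _) _.
  rewrite ta_comp; apply: aeq_comp; exact/aeq_sym/pull_taE.
- move=> x y; apply: pull_eq; apply: aeq_trans (pull_taE _ _) _.
  by rewrite ta_id; apply: aeq_id; rewrite mt.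
- move=> x y x' y' f g; apply: pull_eq.
  apply: (@aeq_trans _ _ _ _ _ _ _ _ _ (star (f \ota g))).
    exact/aeq_star/pull_taE.
  rewrite ta_star; exact/aeq_sym/pull_taE.
- move=> x y x' y' x'' y'' f g h; apply: pull_aeq => //.
  apply: aeq_trans (pull_taE _ _) _.
  apply: aeq_trans (aeq_ta (aeq_rfl _) (pull_taE _ _)) _.
  apply: aeq_trans (taA _ _ _) _.
  apply/aeq_sym; apply: aeq_trans (pull_taE _ _) _.
  exact: aeq_ta (pull_taE _ _) (aeq_rfl _).
- move=> x y f; apply: pull_aeq => //.
  apply: aeq_trans (pull_taE _ _) _.
  apply: aeq_trans (aeq_ta _ (aeq_rfl _)) (ta1f _).
  exact/aeq_id/esym.
- move=> x y f; apply: pull_aeq => //.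
  apply: aeq_trans (pull_taE _ _) _.
  apply: aeq_trans (aeq_ta (aeq_rfl _) _) (taf1 _).
  exact/aeq_id/esym.
- move=> x y x' y' f f'; apply: pull_eq.
  apply: aeq_trans (aeq_comp (pull_syE _ _) (pull_taE _ _)) _.
  rewrite sy_nat; apply/aeq_sym; apply: aeq_comp (pull_taE _ _) (pull_syE _ _).
- move=> x y; apply: pull_eq.
  apply: aeq_trans (aeq_comp (pull_syE _ _) (pull_syE _ _)) _.
  by rewrite syK; apply/aeq_id.
- move=> x y; apply: pull_eq.
  apply: aeq_trans (aeq_star (pull_syE _ _)) _.
  by rewrite sy_star; apply/aeq_sym/pull_syE.
- move=> x y z; apply: pull_aeq => //.
  apply: aeq_trans (pull_syE _ _) _.
  apply: aeq_trans (aeq_sy erefl (esym (mt y z))) _.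
  apply: aeq_trans (sy_hex _ _ _) _.
  apply: aeq_comp.
    apply/aeq_sym; apply: aeq_trans (pull_taE _ _) _.
    exact: aeq_ta (aeq_rfl _) (pull_syE _ _).
  apply: aeq_trans (acast_aeq _ _ _) _.
  apply/aeq_sym.
  apply: aeq_trans (aeq_pull (acast_aeq (hom := phom) _ _ _)) _.
  apply: aeq_trans (pull_taE _ _) _.
  exact: aeq_ta (pull_syE _ _) (aeq_rfl _).
Defined.

Definition pullcat : stcat := STCat pull_tensm.

End Pull.

(* The subcategory of T with the same objects and the arrows satisfying P. *)
Record wide (T : stcat) := Wide {
  wP :> forall x y, hom T x y -> Prop;
  wP0 : forall x y, wP (0 : hom T x y);
  wP_lin : forall x y a (f g : hom T x y), wP f -> wP g -> wP (a *: f + g);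
  wP_comp : forall x y z (g : hom T y z) (f : hom T x y),
    wP g -> wP f -> wP (g \oc f);
  wP_id : forall x, wP (idc x);
  wP_star : forall x y (f : hom T x y), wP f -> wP (star f);
  wP_ta : forall x y x' y' (f : hom T x y) (g : hom T x' y'),
    wP f -> wP g -> wP (f \ota g);
  wP_sy : forall x y, wP (sy x y)
}.
Arguments wP [T] w [x y].


Section Wide.
Variables (T : stcat) (P : wide T).

Section Hom.
Variables x y : obj T.

Definition wpred : {pred hom T x y} := fun f => `[< P _ _ f >].

Record whom := WHom { wval :> hom T x y; wvalP : wval \in wpred }.

HB.instance Definition _ := [isSub for wval].
HB.instance Definition _ := [Choice of whom by <:].

Lemma wpred_submod : submod_closed wpred.
Proof.
split=> [|a f g /asboolP Pf /asboolP Pg]; apply/asboolP; first exact: wP0.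
exact: wP_lin.
Qed.

HB.instance Definition _ :=
  GRing.SubChoice_isSubLmodule.Build _ _ _ whom wpred_submod.

Lemma whomP (f : whom) : P _ _ (wval f).
Proof. exact/asboolP/wvalP. Qed.

Definition whom_of (f : hom T x y) (Pf : P _ _ f) : whom := WHom (asboolT Pf).

End Hom.

Lemma wval_lin x y a (f g : whom x y) : wval (a *: f + g) = a *: wval f + wval g.
Proof. by []. Qed.

Lemma wval_inj x y : injective (@wval x y).
Proof. exact: val_inj. Qed.

Let hm (x y : obj T) : lmodType C := whom x y.

Lemma wide_aeq (x y x' y' : obj T) (f : hm x y) (g : hm x' y') :
  wval f === wval g -> aeq (hom := hm) f g.
Proof.
move=> fg; have [ex [ey e]] := aeq_homE fg.
by subst; apply: eq_aeq; apply: wval_inj; rewrite -e acast_id.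
Qed.

Lemma aeq_wide (x y x' y' : obj T) (f : hm x y) (g : hm x' y') :
  aeq (hom := hm) f g -> wval f === wval g.
Proof.
move=> fg; have [ex [ey e]] := aeq_cast fg.
by subst; rewrite acast_id; apply: aeq_rfl.
Qed.

Definition wide_starm : starcat_mixin hm.
Proof.
unshelve refine (@StarcatMixin (obj T) hm
  (fun x y z (g : whom y z) (f : whom x y) =>
     whom_of (wP_comp (whomP g) (whomP f)))
  (fun x => whom_of (wP_id P x))
  (fun x y (f : whom x y) => whom_of (wP_star (whomP f)))
  _ _ _ _ _ _ _ _).
- by move=> *; apply: wval_inj; apply: compA.
- by move=> *; apply: wval_inj; apply: comp1f.
- by move=> *; apply: wval_inj; apply: compf1.
- by move=> *; apply: wval_inj; apply: comp_linl.
- by move=> *; apply: wval_inj; apply: comp_linr.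
- by move=> *; apply: wval_inj; apply: starK.
- by move=> *; apply: wval_inj; apply: star_lin.
- by move=> *; apply: wval_inj; apply: star_comp.
Defined.

Definition wide_tensm : tensor_mixin wide_starm.
Proof.
unshelve refine (@TensorMixin (obj T) hm wide_starm
  (@ot T) (ou T) (@otA T) (@ot1x T) (@otx1 T)
  (fun x y x' y' (f : whom x y) (g : whom x' y') =>
     whom_of (wP_ta (whomP f) (whomP g)))
  _ _ _ _ _ _ _ _ (fun x y => whom_of (wP_sy P x y)) _ _ _ _).
- by move=> *; apply: wval_inj; apply: ta_linl.
- by move=> *; apply: wval_inj; apply: ta_linr.
- by move=> *; apply: wval_inj; apply: ta_comp.
- by move=> *; apply: wval_inj; apply: ta_id.
- by move=> *; apply: wval_inj; apply: ta_star.
- by move=> *; apply: wide_aeq; apply: taA.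
- by move=> *; apply: wide_aeq; apply: ta1f.
- by move=> *; apply: wide_aeq; apply: taf1.
- by move=> *; apply: wval_inj; apply: sy_nat.
- by move=> *; apply: wval_inj; apply: syK.
- by move=> *; apply: wval_inj; apply: sy_star.
- move=> x y z; apply: wide_aeq; apply: aeq_trans (sy_hex x y z) _.
  apply: aeq_comp; first exact: aeq_rfl.
  apply: aeq_trans (acast_aeq _ _ _) _; apply: aeq_sym.
  exact: aeq_wide (acast_aeq (hom := hm) _ _ _).
Defined.

Definition widecat : stcat := STCat wide_tensm.

End Wide.

Section DepProd.
Variables (I : Type) (M : I -> lmodType C).

Definition dprod := forall i, M i.

HB.instance Definition _ := gen_eqMixin dprod.
HB.instance Definition _ := gen_choiceMixin dprod.

Definition dprod0 : dprod := fun i => 0.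
Definition dprodN (f : dprod) : dprod := fun i => - f i.
Definition dprodD (f g : dprod) : dprod := fun i => f i + g i.
Definition dprodZ (a : C) (f : dprod) : dprod := fun i => a *: f i.

Lemma dprodDA : associative dprodD.
Proof. by move=> f g h; apply: functional_extensionality_dep => i; apply: addrA. Qed.
Lemma dprodDC : commutative dprodD.
Proof. by move=> f g; apply: functional_extensionality_dep => i; apply: addrC. Qed.
Lemma dprod0D : left_id dprod0 dprodD.
Proof. by move=> f; apply: functional_extensionality_dep => i; apply: add0r. Qed.
Lemma dprodND : left_inverse dprod0 dprodN dprodD.
Proof. by move=> f; apply: functional_extensionality_dep => i; apply: addNr. Qed.

HB.instance Definition _ :=
  GRing.isZmodule.Build dprod dprodDA dprodDC dprod0D dprodND.

Lemma dprodZA a b f : dprodZ a (dprodZ b f) = dprodZ (a * b) f.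
Proof. by apply: functional_extensionality_dep => i; apply: scalerA. Qed.
Lemma dprod1Z : left_id 1 dprodZ.
Proof. by move=> f; apply: functional_extensionality_dep => i; apply: scale1r. Qed.
Lemma dprodZDr : right_distributive dprodZ +%R.
Proof. by move=> a f g; apply: functional_extensionality_dep => i; apply: scalerDr. Qed.
Lemma dprodZDl f : {morph dprodZ^~ f : a b / a + b}.
Proof. by move=> a b; apply: functional_extensionality_dep => i; apply: scalerDl. Qed.

HB.instance Definition _ :=
  GRing.Zmodule_isLmodule.Build C dprod dprodZA dprod1Z dprodZDr dprodZDl.

End DepProd.

Section Prod.
Variables (I : Type) (T : I -> stcat).

Let po := forall i, obj (T i).
Let hm (x y : po) : lmodType C := dprod (fun i => hom (T i) (x i) (y i)).

Lemma prod_aeq (x y x' y' : po) (f : hm x y) (g : hm x' y') :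
  (forall i, f i === g i) -> aeq (hom := hm) f g.
Proof.
move=> fg.
have ex : x = x'.
  by apply: functional_extensionality_dep => i; have [] := aeq_homE (fg i).
have ey : y = y'.
  by apply: functional_extensionality_dep => i; have [? []] := aeq_homE (fg i).
subst; apply: eq_aeq; apply: functional_extensionality_dep => i.
exact: aeq_eq (fg i).
Qed.

Lemma aeq_prod (x y x' y' : po) (f : hm x y) (g : hm x' y') :
  aeq (hom := hm) f g -> forall i, f i === g i.
Proof.
move=> fg i; have [ex [ey e]] := aeq_cast fg.
by subst; rewrite acast_id; apply: aeq_rfl.
Qed.

Definition prod_starm : starcat_mixin hm.
Proof.
unshelve refine (@StarcatMixin po hm
  (fun x y z (g : hm y z) (f : hm x y) i => g i \oc f i)
  (fun x i => idc (x i))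
  (fun x y (f : hm x y) i => star (f i))
  _ _ _ _ _ _ _ _);
  move=> *; apply: functional_extensionality_dep => i.
- exact: compA.
- exact: comp1f.
- exact: compf1.
- exact: comp_linl.
- exact: comp_linr.
- exact: starK.
- exact: star_lin.
- exact: star_comp.
Defined.

Definition prod_tensm : tensor_mixin prod_starm.
Proof.
unshelve refine (@TensorMixin po hm prod_starm
  (fun x y i => x i \oto y i) (fun i => ou (T i)) _ _ _
  (fun x y x' y' (f : hm x y) (g : hm x' y') i => f i \ota g i)
  _ _ _ _ _ _ _ _ (fun x y i => sy (x i) (y i)) _ _ _ _).
- by move=> x y z; apply: functional_extensionality_dep => i; apply: otA.
- by move=> x; apply: functional_extensionality_dep => i; apply: ot1x.
- by move=> x; apply: functional_extensionality_dep => i; apply: otx1.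
- by move=> *; apply: functional_extensionality_dep => i; apply: ta_linl.
- by move=> *; apply: functional_extensionality_dep => i; apply: ta_linr.
- by move=> *; apply: functional_extensionality_dep => i; apply: ta_comp.
- by move=> *; apply: functional_extensionality_dep => i; apply: ta_id.
- by move=> *; apply: functional_extensionality_dep => i; apply: ta_star.
- by move=> *; apply: prod_aeq => i; apply: taA.
- by move=> *; apply: prod_aeq => i; apply: ta1f.
- by move=> *; apply: prod_aeq => i; apply: taf1.
- by move=> *; apply: functional_extensionality_dep => i; apply: sy_nat.
- by move=> *; apply: functional_extensionality_dep => i; apply: syK.
- by move=> *; apply: functional_extensionality_dep => i; apply: sy_star.
- move=> x y z; apply: prod_aeq => i; apply: aeq_trans (sy_hex _ _ _) _.
  apply: aeq_comp; first exact: aeq_rfl.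
  apply: aeq_trans (acast_aeq _ _ _) _; apply: aeq_sym.
  exact: aeq_prod (acast_aeq (hom := hm) _ _ _) i.
Defined.

Definition prodcat : stcat := STCat prod_tensm.

End Prod.


Section FunctorCompat.
Variables (S T : stcat) (F : stfun S T).

Lemma fa0 (x y : obj S) : fa F (0 : hom S x y) = 0.
Proof.
have := fa_lin F (- 1) (0 : hom S x y) 0.
by rewrite scaler0 addr0 scaleN1r addNr.
Qed.

Lemma compat0 (x y : obj S) (x' y' : obj T) :
  F x = x' -> F y = y' -> fa F (0 : hom S x y) === (0 : hom T x' y').
Proof. by move=> <- <-; rewrite fa0; apply: aeq_rfl. Qed.

Lemma compat_lin (x y : obj S) (x' y' : obj T) a (f g : hom S x y)
  (f' g' : hom T x' y') : fa F f === f' -> fa F g === g' ->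
  fa F (a *: f + g) === a *: f' + g'.
Proof. by rewrite fa_lin; apply: aeq_lin. Qed.

Lemma compat_comp (x y z : obj S) (x' y' z' : obj T) (g : hom S y z)
  (f : hom S x y) (g' : hom T y' z') (f' : hom T x' y') :
  fa F g === g' -> fa F f === f' -> fa F (g \oc f) === g' \oc f'.
Proof. by rewrite fa_comp; apply: aeq_comp. Qed.

Lemma compat_id (x : obj S) (x' : obj T) :
  F x = x' -> fa F (idc x) === idc x'.
Proof. by rewrite fa_id; apply: aeq_id. Qed.

Lemma compat_star (x y : obj S) (x' y' : obj T) (f : hom S x y)
  (f' : hom T x' y') : fa F f === f' -> fa F (star f) === star f'.
Proof. by rewrite fa_star; apply: aeq_star. Qed.

Lemma compat_ta (x y z w : obj S) (x' y' z' w' : obj T) (f : hom S x y)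
  (g : hom S z w) (f' : hom T x' y') (g' : hom T z' w') :
  fa F f === f' -> fa F g === g' -> fa F (f \ota g) === f' \ota g'.
Proof. by move=> *; apply: aeq_trans (fa_ta F f g) _; apply: aeq_ta. Qed.

Lemma compat_sy (x y : obj S) (x' y' : obj T) :
  F x = x' -> F y = y' -> fa F (sy x y) === sy x' y'.
Proof. by move=> *; apply: aeq_trans (fa_sy F x y) _; apply: aeq_sy. Qed.

End FunctorCompat.

Section Presheaves.
Variables (disp : Order.disp_t) (K : porderType disp).

Record stpresheaf := STPresheaf {
  fib :> K -> cstcat;
  res : forall o o', (o <= o')%O -> stfun (fib o') (fib o);
  res_faithful : forall o o' (h : (o <= o')%O), faithful (res h);
  res_obj : forall o o' o'' (h : (o <= o')%O) (h' : (o' <= o'')%O) (h'' : (o <= o'')%O) x,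
    res h (res h' x) = res h'' x;
  res_hom : forall o o' o'' (h : (o <= o')%O) (h' : (o' <= o'')%O) (h'' : (o <= o'')%O)
    x y (f : hom (fib o'') x y), fa (res h) (fa (res h') f) === fa (res h'') f
}.
Arguments res s [_ _] _.

Section SectionCategory.
Variable T : stpresheaf.

Record section := Section_ {
  sec :> forall o, obj (T o);
  secP : forall o o' (h : (o <= o')%O), res T h (sec o') = sec o
}.

Lemma section_eq (x y : section) : (forall o, x o = y o) -> x = y.
Proof.
case: x => x xP; case: y => y yP /= xy.
have {}xy : x = y by apply: functional_extensionality_dep.
by subst; rewrite (Prop_irrelevance xP yP).
Qed.

Program Definition sec_ou : section := @Section_ (fun o => ou (T o)) _.
Next Obligation. by move=> *; apply: fo_ou. Qed.

Program Definition sec_ot (x y : section) : section :=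
  @Section_ (fun o => x o \oto y o) _.
Next Obligation. by move=> x y o o' h /=; rewrite fo_ot !secP. Qed.

Lemma sec_otA x y z : sec_ot x (sec_ot y z) = sec_ot (sec_ot x y) z.
Proof. by apply: section_eq => o; apply: otA. Qed.

Lemma sec_ot1x x : sec_ot sec_ou x = x.
Proof. by apply: section_eq => o; apply: ot1x. Qed.

Lemma sec_otx1 x : sec_ot x sec_ou = x.
Proof. by apply: section_eq => o; apply: otx1. Qed.

Definition famcat : stcat :=
  pullcat (T := prodcat (fun o => T o)) (m := sec) (u := sec_ou) (t := sec_ot)
    sec_otA sec_ot1x sec_otx1 erefl (fun _ _ => erefl).

Definition compatible (x y : obj famcat) (t : hom famcat x y) : Prop :=
  forall o o' (h : (o <= o')%O), fa (res T h) (t o') === t o.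

Program Definition compatible_wide : wide famcat := @Wide _ compatible _ _ _ _ _ _ _.
Next Obligation. by move=> x y o o' h; apply: compat0; apply: secP. Qed.
Next Obligation. by move=> x y a f g Pf Pg o o' h; apply: compat_lin. Qed.
Next Obligation. by move=> x y z g f Pg Pf o o' h; apply: compat_comp. Qed.
Next Obligation. by move=> x o o' h; apply: compat_id; apply: secP. Qed.
Next Obligation. by move=> x y f Pf o o' h; apply: compat_star. Qed.
Next Obligation. by move=> x y x' y' f g Pf Pg o o' h; apply: compat_ta. Qed.
Next Obligation. by move=> x y o o' h; apply: compat_sy; apply: secP. Qed.

Definition seccat : stcat := widecat compatible_wide.

Definition is_DR_presheaf : Prop :=
  (forall o, simple_unit (T o)) /\ is_DR seccat.

End SectionCategory.

(* The fibre at a of the associated presheaf bundle. *)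
Section Beta.
Variable T : stpresheaf.
Variable a : K.

Definition evcat : stcat :=
  pullcat (T := T a) (m := fun x : section T => x a) (u := sec_ou T)
    (t := @sec_ot T) (@sec_otA T) (@sec_ot1x T) (@sec_otx1 T) erefl
    (fun _ _ => erefl).

Definition extendable (x y : section T) (t : hom (T a) (x a) (y a)) : Prop :=
  exists f : forall o, (a <= o)%O -> hom (T o) (x o) (y o),
    (forall o o' (h : (a <= o)%O) (h' : (a <= o')%O) (l : (o <= o')%O),
      fa (res T l) (f o' h') === f o h) /\ f a (lexx a) = t.

Program Definition extendable_wide : wide evcat := @Wide _ extendable _ _ _ _ _ _ _.
Next Obligation.
move=> x y; exists (fun _ _ => 0); split=> // *; apply: compat0; exact: secP.
Qed.
Next Obligation.
move=> x y c _ _ [f [Pf <-]] [g [Pg <-]]; exists (fun o h => c *: f o h + g o h).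
by split=> // *; apply: compat_lin.
Qed.
Next Obligation.
move=> x y z _ _ [f [Pf <-]] [g [Pg <-]]; exists (fun o h => f o h \oc g o h).
by split=> // *; apply: compat_comp.
Qed.
Next Obligation.
move=> x; exists (fun o h => idc (x o)).
by split=> // *; apply: compat_id; apply: secP.
Qed.
Next Obligation.
move=> x y _ [f [Pf <-]]; exists (fun o h => star (f o h)).
by split=> // *; apply: compat_star.
Qed.
Next Obligation.
move=> x y x' y' _ _ [f [Pf <-]] [g [Pg <-]].
exists (fun o h => f o h \ota g o h).
by split=> // *; apply: compat_ta.
Qed.
Next Obligation.
move=> x y; exists (fun o h => sy (x o) (y o)).
by split=> // *; apply: compat_sy; apply: secP.
Qed.

Definition betacat : stcat := widecat extendable_wide.

End Beta.

End Presheaves.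


(* Operators from the r-th to the s-th tensor power of C^d, given by their
   matrix entries in the basis indexed by the multi-indices 'I_r -> 'I_d. *)
Section Tensors.
Variable d : nat.

Definition midx r := {ffun 'I_r -> 'I_d}.

Definition lpart r s (i : midx (r + s)) : midx r := [ffun k => i (lshift s k)].
Definition rpart r s (i : midx (r + s)) : midx s := [ffun k => i (rshift r k)].
Definition mjoin r s (i : midx r) (j : midx s) : midx (r + s) :=
  [ffun k => match fintype.split k with inl k' => i k' | inr k' => j k' end].
Definition mcast r r' (e : r = r') (i : midx r') : midx r :=
  [ffun k => i (cast_ord e k)].

Lemma lpart_join r s (i : midx r) (j : midx s) : lpart (mjoin i j) = i.
Proof. by apply/ffunP => k; rewrite !ffunE (unsplitK (inl k)). Qed.

Lemma rpart_join r s (i : midx r) (j : midx s) : rpart (mjoin i j) = j.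
Proof. by apply/ffunP => k; rewrite !ffunE (unsplitK (inr k)). Qed.

Lemma join_part r s (i : midx (r + s)) : mjoin (lpart i) (rpart i) = i.
Proof.
by apply/ffunP => k; rewrite !ffunE; case: split_ordP => j ->; rewrite ffunE.
Qed.

Lemma mcast_id r (e : r = r) (i : midx r) : mcast e i = i.
Proof. by apply/ffunP => k; rewrite ffunE cast_ord_id. Qed.

Lemma midx0 (i j : midx 0) : (i == j) = true.
Proof. by apply/eqP/ffunP => -[]. Qed.

Lemma sum_join r s (F : midx (r + s) -> C) :
  \sum_k F k = \sum_(i : midx r) \sum_(j : midx s) F (mjoin i j).
Proof.
rewrite pair_big /= (reindex (fun p : midx r * midx s => mjoin p.1 p.2)) //.
exists (fun i => (lpart i, rpart i)) => [[i j] _|i _] /=.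
  by rewrite lpart_join rpart_join.
exact: join_part.
Qed.

Definition tens (r s : nat) : lmodType C := {ffun midx s * midx r -> C^o}.

Lemma tensP r s (f g : tens r s) : (forall j i, f (j, i) = g (j, i)) -> f = g.
Proof. by move=> fg; apply/ffunP => -[j i]. Qed.

Lemma tens_aeq r s r' s' (f : tens r s) (g : tens r' s')
    (er : r = r') (es : s = s') :
  (forall j i, f (mcast es j, mcast er i) = g (j, i)) -> aeq (hom := tens) f g.
Proof.
subst => fg; apply: eq_aeq; apply: tensP => j i.
by rewrite -fg !mcast_id.
Qed.

Definition tcomp r s t (g : tens s t) (f : tens r s) : tens r t :=
  [ffun p => \sum_k g (p.1, k) * f (k, p.2)].
Definition tid r : tens r r := [ffun p => (p.1 == p.2)%:R].
Definition tstar r s (f : tens r s) : tens s r := [ffun p => (f (p.2, p.1))^*].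
Definition ttens r s r' s' (f : tens r s) (g : tens r' s') :
    tens (r + r') (s + s') :=
  [ffun p => f (lpart p.1, lpart p.2) * g (rpart p.1, rpart p.2)].
Definition tflip r s : tens (r + s) (s + r) :=
  [ffun p => ((lpart p.1 == rpart p.2) && (rpart p.1 == lpart p.2))%:R].

Lemma sum_delta (I : finType) (i : I) (F : I -> C) :
  \sum_k (i == k)%:R * F k = F i.
Proof.
rewrite (bigD1 i) //= eqxx mul1r big1 ?addr0 // => k /negPf.
by rewrite eq_sym => ->; rewrite mul0r.
Qed.

Lemma tens_linE r s a (f g : tens r s) p : (a *: f + g) p = a * f p + g p.
Proof. by rewrite !ffunE. Qed.

Definition tens_starm : starcat_mixin tens.
Proof.
unshelve refine (@StarcatMixin nat tens tcomp tid tstar _ _ _ _ _ _ _ _).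
- move=> x y z w h g f; apply: tensP => j i; rewrite !ffunE /=.
  under eq_bigr => k _ do rewrite ffunE /= big_distrr /=.
  rewrite exchange_big /=; apply: eq_bigr => k _; rewrite ffunE /= big_distrl.
  by apply: eq_bigr => l _; rewrite mulrA.
- by move=> x y f; apply: tensP => j i; rewrite !ffunE /=;
    under eq_bigr => k _ do rewrite ffunE /=; rewrite sum_delta.
- move=> x y f; apply: tensP => j i; rewrite !ffunE /=.
  under eq_bigr => k _ do rewrite ffunE /= mulrC eq_sym.
  by rewrite sum_delta.
- move=> x y z a g g' f; apply: tensP => j i; rewrite tens_linE !ffunE /=.
  rewrite big_distrr -big_split /=; apply: eq_bigr => k _.
  by rewrite tens_linE mulrDl mulrA.
- move=> x y z a g f f'; apply: tensP => j i; rewrite tens_linE !ffunE /=.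
  rewrite big_distrr -big_split /=; apply: eq_bigr => k _.
  by rewrite tens_linE mulrDr mulrCA.
- by move=> x y f; apply: tensP => j i; rewrite !ffunE /= conjCK.
- move=> x y a f g; apply: tensP => j i; rewrite tens_linE !ffunE /=.
  by rewrite rmorphD rmorphM.
- move=> x y z g f; apply: tensP => j i; rewrite !ffunE /= rmorph_sum.
  by apply: eq_bigr => k _; rewrite !ffunE /= rmorphM mulrC.
Defined.

Lemma mcast_lpartA r s t (i : midx (r + s + t)) :
  lpart (mcast (addnA r s t) i) = lpart (lpart i).
Proof.
by apply/ffunP => k; rewrite !ffunE; congr (i _); apply: val_inj.
Qed.

Lemma mcast_lrpartA r s t (i : midx (r + s + t)) :
  lpart (rpart (mcast (addnA r s t) i)) = rpart (lpart i).
Proof.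
by apply/ffunP => k; rewrite !ffunE; congr (i _); apply: val_inj.
Qed.

Lemma mcast_rrpartA r s t (i : midx (r + s + t)) :
  rpart (rpart (mcast (addnA r s t) i)) = rpart i.
Proof.
by apply/ffunP => k; rewrite !ffunE; congr (i _); apply: val_inj; rewrite /= addnA.
Qed.

Lemma tflip_comp r s r' s' (f : tens r s) (f' : tens r' s') :
  tcomp (tflip s s') (ttens f f') = tcomp (ttens f' f) (tflip r r').
Proof.
apply: tensP => j i; rewrite !ffunE /= !sum_join.
transitivity (f (rpart j, lpart i) * f' (lpart j, rpart i)).
  rewrite -[RHS](sum_delta (rpart j) (fun k => f (k, lpart i) * f' (lpart j, rpart i))).
  apply: eq_bigr => k _.
  rewrite -[f' _](sum_delta (lpart j) (fun l => f' (l, rpart i))) !big_distrr /=.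
  apply: eq_bigr => l _; rewrite !ffunE /= lpart_join rpart_join.
  by rewrite andbC -mulnb natrM !mulrA; congr (_ * _); rewrite -!mulrA; congr (_ * _); rewrite mulrC.
apply/esym; rewrite -[RHS](sum_delta (rpart i) (fun k => f (rpart j, lpart i) * f' (lpart j, k))).
apply: eq_bigr => k _.
rewrite -[f _](sum_delta (lpart i) (fun l => f (rpart j, l))) big_distrl big_distrr /=.
apply: eq_bigr => l _; rewrite !ffunE /= lpart_join rpart_join.
rewrite ![_ == k]eq_sym ![_ == l]eq_sym -mulnb natrM mulrC -!mulrA.
by congr (_ * _); congr (_ * _); rewrite mulrC.
Qed.


Lemma mcast_lpart0 r (i : midx r) : rpart (mcast (add0n r) i) = i.
Proof. by apply/ffunP => k; rewrite !ffunE; congr (i _); apply: val_inj. Qed.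

Lemma mcast_rpart0 r (i : midx r) : lpart (mcast (addn0 r) i) = i.
Proof. by apply/ffunP => k; rewrite !ffunE; congr (i _); apply: val_inj. Qed.

Lemma part_eq r s (i j : midx (r + s)) :
  (i == j) = (lpart i == lpart j) && (rpart i == rpart j).
Proof.
apply/eqP/andP => [->|[/eqP l /eqP h]]; first by [].
by rewrite -(join_part i) l h join_part.
Qed.

Lemma tcomp_fun r s t (g : tens s t) (f : tens r s) (h : midx r -> midx s) j i :
  (forall k, f (k, i) = (k == h i)%:R) -> tcomp g f (j, i) = g (j, h i).
Proof.
move=> fE; rewrite ffunE /=.
under eq_bigr => k _ do rewrite fE mulrC eq_sym.
exact: sum_delta.
Qed.

Lemma tflipE r s j (i : midx (r + s)) :
  tflip r s (j, i) = (j == mjoin (rpart i) (lpart i))%:R.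
Proof. by rewrite ffunE part_eq lpart_join rpart_join. Qed.

Lemma tflip_hex x y z :
  aeq (hom := tens) (tflip x (y + z))
    (tcomp (ttens (tid y) (tflip x z))
       (acast (hom := tens) (esym (addnA x y z)) (esym (addnA y x z))
          (ttens (tflip x y) (tid z)))).
Proof.
have E : acast (hom := tens) (esym (addnA x y z)) (esym (addnA y x z))
          (ttens (tflip x y) (tid z)) =
    [ffun p => (p.1 == mjoin (lpart (rpart p.2))
      (mjoin (lpart p.2) (rpart (rpart p.2))))%:R].
  apply: (@aeq_eq _ tens); apply: aeq_trans (acast_aeq (hom := tens) _ _ _) _.
  apply: (tens_aeq (er := esym (addnA x y z)) (es := esym (addnA y x z))).
  move=> j i; rewrite !ffunE /=.
  set j' := mcast _ j; set i' := mcast _ i.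
  have -> : j = mcast (addnA y x z) j'.
    by apply/ffunP => k; rewrite !ffunE; congr (j _); apply: val_inj.
  have -> : i = mcast (addnA x y z) i'.
    by apply/ffunP => k; rewrite !ffunE; congr (i _); apply: val_inj.
  rewrite [in RHS]part_eq [in RHS](part_eq (rpart _)).
  rewrite !(lpart_join, rpart_join).
  rewrite !(mcast_lpartA, mcast_lrpartA, mcast_rrpartA).
  by rewrite -natrM mulnb andbA.
apply: (tens_aeq (er := erefl) (es := esym (addnA y z x))) => j i.
rewrite mcast_id; set j' := mcast _ j.
have -> : j = mcast (addnA y z x) j'.
  by apply/ffunP => k; rewrite !ffunE; congr (j _); apply: val_inj.
rewrite (@tcomp_fun _ _ _ _ _ (fun i => mjoin (lpart (rpart i))
      (mjoin (lpart i) (rpart (rpart i))))); last by move=> k; rewrite E ffunE.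
rewrite ffunE [RHS]ffunE /= !ffunE /= !(lpart_join, rpart_join).
rewrite !(mcast_lpartA, mcast_lrpartA, mcast_rrpartA).
rewrite [in LHS](part_eq (lpart j')) -natrM mulnb.
by congr (_%:R); rewrite -andbA.
Qed.

Lemma ttensE r s r' s' (f : tens r s) (g : tens r' s') j i :
  ttens f g (j, i) = f (lpart j, lpart i) * g (rpart j, rpart i).
Proof. by rewrite ffunE. Qed.

Definition tens_tensm : tensor_mixin tens_starm.
Proof.
unshelve refine (@TensorMixin nat tens tens_starm addn 0%N addnA add0n addn0
  ttens _ _ _ _ _ _ _ _ tflip _ _ _ _).
- move=> x y x' y' a f f' g; apply: tensP => j i.
  by rewrite tens_linE !ttensE tens_linE mulrDl mulrA.
- move=> x y x' y' a f g g'; apply: tensP => j i.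
  by rewrite tens_linE !ttensE tens_linE mulrDr mulrCA.
- move=> x y z x' y' z' g f g' f'; apply: tensP => j i; rewrite !ffunE /=.
  rewrite sum_join big_distrl /=; apply: eq_bigr => k _.
  rewrite big_distrr /=; apply: eq_bigr => l _.
  by rewrite !ffunE /= lpart_join rpart_join mulrACA.
- move=> x y; apply: tensP => j i; rewrite !ffunE /=.
  by rewrite part_eq -mulnb natrM.
- by move=> x y x' y' f g; apply: tensP => j i; rewrite !ffunE /= rmorphM.
- move=> x y x' y' x'' y'' f g h.
  apply: (tens_aeq (er := addnA _ _ _) (es := addnA _ _ _)) => j i.
  rewrite !ffunE /=.
  by rewrite !(mcast_lpartA, mcast_lrpartA, mcast_rrpartA) mulrA.
- move=> x y f; apply: (tens_aeq (er := add0n _) (es := add0n _)) => j i.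
  by rewrite !ffunE /= !mcast_lpart0 midx0 mul1r.
- move=> x y f; apply: (tens_aeq (er := addn0 _) (es := addn0 _)) => j i.
  by rewrite !ffunE /= !mcast_rpart0 midx0 mulr1.
- by move=> *; apply: tflip_comp.
- move=> x y; apply: tensP => j i.
  rewrite (@tcomp_fun _ _ _ _ _ (fun i => mjoin (rpart i) (lpart i))) //; last first.
    by move=> k; rewrite tflipE.
  by rewrite tflipE lpart_join rpart_join join_part ffunE.
- move=> x y; apply: tensP => j i; rewrite !ffunE /= conjC_nat.
  by rewrite ![lpart i == _]eq_sym ![rpart i == _]eq_sym andbC.
- exact: tflip_hex.
Defined.

Definition tenscat : stcat := STCat tens_tensm.

End Tensors.



Section Quotients.
Variable Gam : groupType.

Record nsubgroup := NSubgroup {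
  ns :> Gam -> Prop;
  ns1 : ns 1%g;
  nsM : forall x y, ns x -> ns y -> ns (x * y)%g;
  nsV : forall x, ns x -> ns (x^-1)%g;
  nsJ : forall x y, ns x -> ns (y^-1 * x * y)%g
}.

Variable N : nsubgroup.

Definition qrel : rel Gam := fun x y => `[< N (x^-1 * y)%g >].

Lemma qrel_refl : reflexive qrel.
Proof. by move=> x; apply/asboolP; rewrite mulVg; apply: ns1. Qed.

Lemma qrel_sym : symmetric qrel.
Proof.
have S x y : qrel x y -> qrel y x.
  by move=> /asboolP/nsV; rewrite invgM invgK => H; apply/asboolP.
by move=> x y; apply/idP/idP; apply: S.
Qed.

Lemma qrel_trans : transitive qrel.
Proof.
move=> y x z /asboolP xy /asboolP yz; apply/asboolP.
by have := nsM xy yz; rewrite -mulgA (mulgA y) mulgV mul1g.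
Qed.

Canonical qequiv := EquivRel qrel qrel_refl qrel_sym qrel_trans.

Definition qgroup := {eq_quot qequiv}.

HB.instance Definition _ := Choice.on qgroup.

Definition qproj (x : Gam) : qgroup := \pi_({eq_quot qequiv}) x.

Lemma qprojP x y : qproj x = qproj y <-> N (x^-1 * y)%g.
Proof.
split=> [/eqmodP/asboolP //|xy].
by apply/eqmodP/asboolP.
Qed.

Lemma qproj_repr (x : qgroup) : qproj (repr x) = x.
Proof. exact: reprK. Qed.

Definition qmul (x y : qgroup) : qgroup := qproj (repr x * repr y)%g.
Definition qinv (x : qgroup) : qgroup := qproj (repr x)^-1%g.

Lemma qprojM x y : qmul (qproj x) (qproj y) = qproj (x * y)%g.
Proof.
apply/qprojP.
have /qprojP := qproj_repr (qproj x); have /qprojP := qproj_repr (qproj y).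
set x' := repr (qproj x); set y' := repr (qproj y) => Ny Nx.
have := nsM (nsJ y' Nx) Ny.
by rewrite invgM -!mulgA (mulgA y') mulgV mul1g.
Qed.

Lemma qprojV x : qinv (qproj x) = qproj (x^-1)%g.
Proof.
apply/qprojP; rewrite invgK.
have /qprojP/nsV := qproj_repr (qproj x).
rewrite invgM invgK => /(nsJ x^-1%g).
by rewrite invgK !mulgA mulgV mul1g.
Qed.

Lemma qmulA : associative qmul.
Proof.
by move=> x y z; rewrite -(qproj_repr x) -(qproj_repr y) -(qproj_repr z) !qprojM mulgA.
Qed.

Lemma qmul1x : left_id (qproj 1%g) qmul.
Proof. by move=> x; rewrite -(qproj_repr x) qprojM mul1g. Qed.

Lemma qmulx1 : right_id (qproj 1%g) qmul.
Proof. by move=> x; rewrite -(qproj_repr x) qprojM mulg1. Qed.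

Lemma qmulVx : left_inverse (qproj 1%g) qinv qmul.
Proof. by move=> x; rewrite -(qproj_repr x) qprojV qprojM mulVg. Qed.

Lemma qmulxV : right_inverse (qproj 1%g) qinv qmul.
Proof. by move=> x; rewrite -(qproj_repr x) qprojV qprojM mulgV. Qed.

HB.instance Definition _ :=
  isGroup.Build qgroup qmulA qmul1x qmulx1 qmulVx qmulxV.

End Quotients.

Section Unitaries.
Variable d : nat.
Local Open Scope classical_set_scope.

Record unitary := Unitary { uval :> 'M[C]_d; uvalP : uval \is unitarymx }.

HB.instance Definition _ := [isSub for uval].
HB.instance Definition _ := [Choice of unitary by <:].

Lemma uvalVP (u : unitary) : (uval u ^t*)%sesqui \is unitarymx.
Proof. by rewrite trmxC_unitary uvalP. Qed.

Lemma unitary1P : (1%:M : 'M[C]_d) \is unitarymx.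
Proof. by apply/unitarymxP; rewrite trmx1 map_mx1 mulmx1. Qed.

Definition umul (u v : unitary) : unitary :=
  Unitary (mul_unitarymx (uvalP u) (uvalP v)).
Definition uone : unitary := Unitary unitary1P.
Definition uinv (u : unitary) : unitary := Unitary (uvalVP u).

Lemma uvalI (u v : unitary) : uval u = uval v -> u = v.
Proof. exact: val_inj. Qed.

Lemma umulA : associative umul.
Proof. by move=> u v w; apply: uvalI; apply: mulmxA. Qed.
Lemma umul1x : left_id uone umul.
Proof. by move=> u; apply: uvalI; apply: mul1mx. Qed.
Lemma umulx1 : right_id uone umul.
Proof. by move=> u; apply: uvalI; apply: mulmx1. Qed.
Lemma umulxV : right_inverse uone uinv umul.
Proof. by move=> u; apply: uvalI; apply/unitarymxP/uvalP. Qed.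
Lemma umulVx : left_inverse uone uinv umul.
Proof. by move=> u; apply: uvalI; apply/mulmx1C/unitarymxP/uvalP. Qed.

HB.instance Definition _ :=
  isGroup.Build unitary umulA umul1x umulx1 umulVx umulxV.

Record csubgroup := CSubgroup {
  cg :> unitary -> Prop;
  cg1 : cg 1%g;
  cgM : forall u v, cg u -> cg v -> cg (u * v)%g;
  cgV : forall u, cg u -> cg (u^-1)%g;
  cg_compact :
    compact ((fun u => uval u : 'M[R[i] : numFieldType]_d) @` [set u | cg u])
}.

Variable G : csubgroup.

Definition normal_pred : {pred unitary} :=
  fun u => `[< forall v, G v <-> G (u * v * u^-1)%g >].

Record normalizer := Normalizer {
  nval :> unitary;
  nvalP : nval \in normal_pred
}.

HB.instance Definition _ := [isSub for nval].
HB.instance Definition _ := [Choice of normalizer by <:].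

Lemma normal_pred_group : group_closed normal_pred.
Proof.
split=> [|u v /asboolP Nu /asboolP Nv]; apply/asboolP => w.
  by rewrite invg1 mulg1 mul1g.
rewrite invgM invgK.
have := Nv (v^-1 * w * v)%g; rewrite -!mulgA mulgV mulg1 !mulgA mulgV mul1g => E.
by rewrite -E Nu !mulgA.
Qed.

HB.instance Definition _ :=
  SubChoice_isSubGroup.Build _ _ normalizer normal_pred_group.

Lemma nval_conj (u : normalizer) v : G (nval u * v * (nval u)^-1)%g <-> G v.
Proof. by have /asboolP Nu := nvalP u; rewrite -Nu. Qed.

Program Definition innormal : nsubgroup normalizer :=
  @NSubgroup _ (fun u => G (nval u)) _ _ _ _.
Next Obligation. exact: cg1. Qed.
Next Obligation. by move=> u v; apply: cgM. Qed.
Next Obligation. by move=> u; apply: cgV. Qed.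
Next Obligation.
move=> u v Gu; apply/(nval_conj v).
have -> : nval (v^-1 * u * v)%g = ((nval v)^-1 * nval u * nval v)%g by [].
by rewrite !mulgA mulgV mul1g -mulgA mulgV mulg1.
Qed.

(* QG = NG / G. *)
Definition outer := qgroup innormal.

Definition upow (u : unitary) r : tens d r r :=
  [ffun p : midx d r * midx d r => \prod_k uval u (p.1 k) (p.2 k)].

Lemma upow1 r : upow 1%g r = tid d r.
Proof.
apply: tensP => j i; rewrite !ffunE /=.
have [->|/eqP ji] := eqVneq j i.
  by rewrite big1 // => k _; rewrite mxE eqxx.
case: (pickP (fun k => j k != i k)) => [k jk|E]; last first.
  by case: ji; apply/ffunP => k; apply/eqP; have := E k; case: eqP.
by rewrite (bigD1 k) //= mxE (negPf jk) mul0r.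
Qed.

Lemma upowM u v r : upow (u * v)%g r = tcomp (upow u r) (upow v r).
Proof.
apply: tensP => j i; rewrite !ffunE /=.
under eq_bigr => k _ do rewrite mxE.
rewrite bigA_distr_bigA /=; apply: eq_bigr => f _.
by rewrite !ffunE /= -big_split.
Qed.

Lemma upowV u r : upow (u^-1)%g r = tstar (upow u r).
Proof.
apply: tensP => j i; rewrite !ffunE /= rmorph_prod.
by apply: eq_bigr => k _; rewrite !mxE.
Qed.

Local Notation TC := (tenscat d).

Definition upowc u r : hom TC r r := upow u r.

Lemma upowc1 r : upowc 1%g r = idc (r : obj TC).
Proof. exact: upow1. Qed.
Lemma upowcM u v r : upowc (u * v)%g r = upowc u r \oc upowc v r.
Proof. exact: upowM. Qed.
Lemma upowcV u r : upowc (u^-1)%g r = star (upowc u r).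
Proof. exact: upowV. Qed.

Lemma upowcD u r s :
  upowc u (r + s) = upowc u r \ota upowc u s :> hom TC (r + s) (r + s).
Proof.
apply: tensP => j i; rewrite [RHS]ttensE !ffunE /= big_split_ord /=.
by congr (_ * _); apply: eq_bigr => k _; rewrite !ffunE.
Qed.

Lemma upowc_star u r : star (upowc u r) \oc upowc u r = idc (r : obj TC).
Proof. by rewrite -upowcV -upowcM mulVg upowc1. Qed.

Definition intertwiner (r s : obj TC) (t : hom TC r s) : Prop :=
  forall u, G u -> upowc u s \oc t = t \oc upowc u r.

Program Definition intertwiner_wide : wide TC :=
  @Wide _ intertwiner _ _ _ _ _ _ _.
Next Obligation. by move=> r s u _; rewrite compf0 comp0f. Qed.
Next Obligation.
by move=> r s a f g Pf Pg u Gu; rewrite comp_linr comp_linl Pf ?Pg.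
Qed.
Next Obligation.
by move=> r s t g f Pg Pf u Gu; rewrite compA Pg // -compA Pf // compA.
Qed.
Next Obligation. by move=> r u _; rewrite comp1f compf1. Qed.
Next Obligation.
move=> r s f Pf u Gu; have /= := congr1 (@star _ _ _) (Pf _ (cgV Gu)).
by rewrite !star_comp upowcV upowcV !starK.
Qed.
Next Obligation.
move=> r s r' s' f g Pf Pg u Gu.
by rewrite (upowcD u s s') (upowcD u r r') -!ta_comp Pf ?Pg.
Qed.
Next Obligation.
by move=> r s u Gu; rewrite (upowcD u s r) (upowcD u r s) sy_nat.
Qed.

(* The category with objects the tensor powers of the defining representation
   of G; the r-th power is the object r. *)
Definition pihat : stcat := widecat intertwiner_wide.

Lemma uhat_subproof (u : normalizer) (r s : obj TC) (t : hom TC r s) :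
  intertwiner t ->
  intertwiner (upowc u s \oc t \oc star (upowc u r)).
Proof.
move=> Pt v Gv.
pose w := ((nval u)^-1 * v * nval u)%g.
have vE : v = (nval u * w * (nval u)^-1)%g.
  by rewrite /w !mulgA mulgV mul1g -mulgA mulgV mulg1.
have Gw : G w by apply/(nval_conj u); rewrite -vE.
have vu : (v * nval u = nval u * w)%g by rewrite vE -mulgA mulVg mulg1.
have uv : ((nval u)^-1 * v = w * (nval u)^-1)%g by rewrite vE !mulgA mulVg mul1g.
rewrite -upowcV -[RHS]compA -upowcM uv upowcM !compA -upowcM vu upowcM.
by congr (_ \oc _); rewrite -!compA Pt.
Qed.

(* The action t |-> u^(s) o t o (u^(r))^* of NG on pihat G. *)
Definition uhat (u : normalizer) (r s : obj pihat) (t : hom pihat r s) :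
    hom pihat r s :=
  whom_of (P := intertwiner_wide) (uhat_subproof u (whomP t)).

End Unitaries.

Section Pi1.
Variables (disp : Order.disp_t) (K : porderType disp).

(* simp1 x y is the type of 1-simplices b with d_1 b = x and d_0 b = y. *)
Record simp1 (x y : K) := Simp1 {
  supp1 : K;
  simp1_src : (x <= supp1)%O;
  simp1_tgt : (y <= supp1)%O
}.

(* simp2 f g h: there is a 2-simplex c with d_2 c = f, d_0 c = g, d_1 c = h;
   the vertex conditions on its faces are enforced by the types. *)
Definition simp2 (x y z : K) (f : simp1 x y) (g : simp1 y z) (h : simp1 x z) :
    Prop :=
  exists c : K, [/\ (supp1 f <= c)%O, (supp1 g <= c)%O & (supp1 h <= c)%O].

(* Nonempty paths; the path (b_n, ..., b_1) is
   [sp_snoc b_n (... (sp_snoc b_2 (sp_one b_1)))]. *)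
Inductive spath : K -> K -> Type :=
| sp_one x y of simp1 x y : spath x y
| sp_snoc x y z of simp1 y z & spath x y : spath x z.

Fixpoint sp_comp x y z (q : spath y z) : spath x y -> spath x z :=
  match q in spath y z return spath x y -> spath x z with
  | sp_one _ _ b => sp_snoc b
  | sp_snoc _ _ _ b q' => fun p => sp_snoc b (sp_comp q' p)
  end.

Inductive homotopic : forall x y, spath x y -> spath x y -> Prop :=
| htp_refl x y (p : spath x y) : homotopic p p
| htp_sym x y (p q : spath x y) : homotopic p q -> homotopic q p
| htp_trans x y (p q r : spath x y) :
    homotopic p q -> homotopic q r -> homotopic p r
| htp_simp2 x y z (f : simp1 x y) (g : simp1 y z) (h : simp1 x z) :
    simp2 f g h -> homotopic (sp_one h) (sp_snoc g (sp_one f))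
| htp_comp x y z (p p' : spath x y) (q q' : spath y z) :
    homotopic p p' -> homotopic q q' -> homotopic (sp_comp q p) (sp_comp q' p').

Definition pathwise_connected : Prop := forall x y : K, inhabited (spath x y).

Lemma sp_compA x y z w (r : spath z w) (q : spath y z) (p : spath x y) :
  sp_comp r (sp_comp q p) = sp_comp (sp_comp r q) p.
Proof. by elim: r q => //= ? ? ? ? ? IH q; rewrite IH. Qed.

Definition degen x : simp1 x x := Simp1 (lexx x) (lexx x).
Definition srev x y (b : simp1 x y) : simp1 y x :=
  Simp1 (simp1_tgt b) (simp1_src b).

Fixpoint sp_rev x y (p : spath x y) : spath y x :=
  match p in spath x y return spath y x with
  | sp_one _ _ b => sp_one (srev b)
  | sp_snoc _ _ _ b p' => sp_comp (sp_rev p') (sp_one (srev b))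
  end.

Lemma degen_sp_comp x y (p : spath x y) :
  homotopic (sp_comp (sp_one (degen y)) p) p.
Proof.
have E (u v : K) (b : simp1 u v) : homotopic (sp_snoc (degen v) (sp_one b)) (sp_one b).
  apply/htp_sym/htp_simp2; exists (supp1 b); split=> //=; exact: simp1_tgt.
case: p => {x y} [x y b|x y z b p] /=; first exact: E.
exact: (htp_comp (htp_refl p) (E _ _ b)).
Qed.

Lemma sp_comp_degen x y (p : spath x y) :
  homotopic (sp_comp p (sp_one (degen x))) p.
Proof.
elim: p => {x y} [x y b|x y z b p IH] /=.
  apply/htp_sym/htp_simp2; exists (supp1 b); split=> //=; exact: simp1_src.
exact: (htp_comp IH (htp_refl (sp_one b))).
Qed.

Lemma sp_rev_comp x y (p : spath x y) :
  homotopic (sp_comp (sp_rev p) p) (sp_one (degen x)).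
Proof.
have E (u v : K) (b : simp1 u v) :
    homotopic (sp_snoc (srev b) (sp_one b)) (sp_one (degen u)).
  apply/htp_sym/htp_simp2; exists (supp1 b); split=> //=; exact: simp1_src.
elim: p => {x y} [x y b|x y z b p IH] /=; first exact: E.
rewrite -sp_compA; apply: htp_trans IH.
apply: htp_comp (htp_refl _); rewrite -[sp_snoc b p]/(sp_comp (sp_one b) p).
rewrite sp_compA; apply: htp_trans (degen_sp_comp p).
exact: htp_comp (htp_refl _) (E _ _ b).
Qed.

Lemma sp_comp_rev x y (p : spath x y) :
  homotopic (sp_comp p (sp_rev p)) (sp_one (degen y)).
Proof.
have E (u v : K) (b : simp1 u v) :
    homotopic (sp_snoc b (sp_one (srev b))) (sp_one (degen v)).
  apply/htp_sym/htp_simp2; exists (supp1 b); split=> //=; exact: simp1_tgt.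
elim: p => {x y} [x y b|x y z b p IH] /=; first exact: E.
rewrite sp_compA; apply: htp_trans (E _ _ b).
apply: (htp_comp (q := sp_one b) _ (htp_refl _)).
apply: htp_trans (degen_sp_comp _).
exact: (htp_comp (htp_refl _) IH).
Qed.

Section FundamentalGroup.
Variable a : K.

Definition loop := spath a a.

HB.instance Definition _ := gen_eqMixin loop.
HB.instance Definition _ := gen_choiceMixin loop.

Definition homotopicb : rel loop := fun p q => `[< homotopic p q >].

Lemma homotopicb_refl : reflexive homotopicb.
Proof. by move=> p; apply/asboolP/htp_refl. Qed.

Lemma homotopicb_sym : symmetric homotopicb.
Proof. by move=> p q; apply/asboolP/asboolP; apply: htp_sym. Qed.

Lemma homotopicb_trans : transitive homotopicb.
Proof.
by move=> q p r /asboolP pq /asboolP qr; apply/asboolP/(htp_trans pq).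
Qed.

Canonical homotopic_equiv :=
  EquivRel homotopicb homotopicb_refl homotopicb_sym homotopicb_trans.

Definition pi1 := {eq_quot homotopic_equiv}.

HB.instance Definition _ := Choice.on pi1.

Definition pi1_class (p : loop) : pi1 := \pi_({eq_quot homotopic_equiv}) p.

Lemma pi1_classP (p q : loop) : pi1_class p = pi1_class q <-> homotopic p q.
Proof. by split=> [/eqmodP/asboolP|pq] //; apply/eqmodP/asboolP. Qed.

Lemma pi1_repr (g : pi1) : pi1_class (repr g) = g.
Proof. exact: reprK. Qed.

Definition pi1_mul (g h : pi1) : pi1 := pi1_class (sp_comp (repr g) (repr h)).
Definition pi1_inv (g : pi1) : pi1 := pi1_class (sp_rev (repr g)).
Definition pi1_one : pi1 := pi1_class (sp_one (degen a)).

Lemma pi1_classM p q :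
  pi1_mul (pi1_class p) (pi1_class q) = pi1_class (sp_comp p q).
Proof. by apply/pi1_classP/htp_comp; apply/pi1_classP/pi1_repr. Qed.

Lemma pi1_mulA : associative pi1_mul.
Proof.
move=> g h k; rewrite -(pi1_repr g) -(pi1_repr h) -(pi1_repr k).
by rewrite !pi1_classM sp_compA.
Qed.

Lemma pi1_mul1g : left_id pi1_one pi1_mul.
Proof.
by move=> g; rewrite -(pi1_repr g) pi1_classM; apply/pi1_classP/degen_sp_comp.
Qed.

Lemma pi1_mulg1 : right_id pi1_one pi1_mul.
Proof.
by move=> g; rewrite -(pi1_repr g) pi1_classM; apply/pi1_classP/sp_comp_degen.
Qed.

Lemma pi1_mulVg : left_inverse pi1_one pi1_inv pi1_mul.
Proof.
move=> g.
have -> : pi1_mul (pi1_inv g) g =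
    pi1_class (sp_comp (sp_rev (repr g)) (repr g)).
  by rewrite -{2}(pi1_repr g) pi1_classM.
exact/pi1_classP/sp_rev_comp.
Qed.

Lemma pi1_mulgV : right_inverse pi1_one pi1_inv pi1_mul.
Proof.
move=> g.
have -> : pi1_mul g (pi1_inv g) =
    pi1_class (sp_comp (repr g) (sp_rev (repr g))).
  by rewrite -{1}(pi1_repr g) pi1_classM.
exact/pi1_classP/sp_comp_rev.
Qed.

HB.instance Definition _ :=
  isGroup.Build pi1 pi1_mulA pi1_mul1g pi1_mulg1 pi1_mulVg pi1_mulgV.

End FundamentalGroup.

End Pi1.

Section Holonomy.
Variables (disp : Order.disp_t) (K : porderType disp) (T : stpresheaf K).

(* beta_res h f t: the functor of the associated bundle from the fibre at o'
   to the fibre at o sends the arrow f to t. *)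
Definition beta_res (o o' : K) (h : (o <= o')%O) (x y : section T)
    (f : hom (betacat T o') x y) (t : hom (betacat T o) x y) : Prop :=
  fa (res T h) (wval f) === wval t.

(* The functors of the associated bundle admit inverses on arrows. *)
Lemma beta_res_surj (o o' : K) (h : (o <= o')%O) (x y : section T)
    (t : hom (betacat T o) x y) : exists f, beta_res h f t.
Proof.
have [f [Pf ft]] := whomP t.
have Pg : extendable (T := T) (a := o') (f o' h).
  exists (fun u h' => f u (le_trans h h')).
  by split=> [*|]; [apply: Pf | congr (f _ _); apply: Prop_irrelevance].
exists (whom_of (P := extendable_wide T o') Pg).
by rewrite /beta_res /= -ft; apply: Pf.
Qed.

(* transport1 b t t': t' is the image of t under the inverse of the functor
   from the fibre at |b| to the fibre at d_1 b, followed by the functor from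
   the fibre at |b| to the fibre at d_0 b. By [transport_inj], [transport p]
   is the graph of an injective partial function, the composite along p; that
   it is defined everywhere along loops is part of [hol_chiP]. *)
Definition transport1 (o o' : K) (b : simp1 o o') (x y : section T)
    (t : hom (betacat T o) x y) (t' : hom (betacat T o') x y) : Prop :=
  exists2 f : hom (betacat T (supp1 b)) x y,
    beta_res (simp1_src b) f t & beta_res (simp1_tgt b) f t'.

Fixpoint transport (o o' : K) (p : spath o o') (x y : section T) :
    hom (betacat T o) x y -> hom (betacat T o') x y -> Prop :=
  match p in spath o o'
    return hom (betacat T o) x y -> hom (betacat T o') x y -> Prop with
  | sp_one _ _ b => fun t t' => transport1 b t t'
  | sp_snoc _ _ _ b p' => fun t t' =>
      exists2 t'', transport p' t t'' & transport1 b t'' t'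
  end.

Lemma transport_inj (o o' : K) (p : spath o o') (x y : section T)
    (t1 t2 : hom (betacat T o) x y) (t1' t2' : hom (betacat T o') x y) :
  transport p t1 t1' -> transport p t2 t2' -> t1 = t2 <-> t1' = t2'.
Proof.
have beta_resP (u v : K) (h : (u <= v)%O) (f1 f2 : hom (betacat T v) x y)
    (s1 s2 : hom (betacat T u) x y) :
    beta_res h f1 s1 -> beta_res h f2 s2 -> f1 = f2 <-> s1 = s2.
  move=> E1 E2; split=> [e|e]; subst; apply: wval_inj.
    exact: (aeq_eq (aeq_trans (aeq_sym E1) E2)).
  apply: (@res_faithful _ _ T _ _ h).
  exact: (aeq_eq (aeq_trans E1 (aeq_sym E2))).
have step (u v : K) (b : simp1 u v) (s1 s2 : hom (betacat T u) x y)
    (s1' s2' : hom (betacat T v) x y) :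
    transport1 b s1 s1' -> transport1 b s2 s2' -> s1 = s2 <-> s1' = s2'.
  move=> [f1 a1 b1] [f2 a2 b2].
  exact: iff_trans (iff_sym (beta_resP _ _ _ _ _ _ _ a1 a2))
    (beta_resP _ _ _ _ _ _ _ b1 b2).
elim: p t1 t2 t1' t2' => {o o'} [u v b|u v w b p IH] t1 t2 t1' t2' /=.
  exact: step.
move=> [s1 p1 q1] [s2 p2 q2].
exact: iff_trans (IH _ _ _ _ p1 p2) (step _ _ _ _ _ _ _ q1 q2).
Qed.

(* The fibre at a of the sub-bundle generated by the tensor powers of x; the
   r-th power is the object r. *)
Definition powcat (S : stcat) (x : obj S) : stcat :=
  pullcat (m := opow x) addnA add0n addn0 erefl (opowD x).

Definition betahat (x : section T) (a : K) : stcat :=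
  powcat (x : obj (betacat T a)).

Definition loop_transport (x : section T) (a : K) (p : loop a) (r s : nat)
    (t t' : hom (betahat x a) r s) : Prop :=
  @transport a a p (opow (x : obj (betacat T a)) r)
    (opow (x : obj (betacat T a)) s) t t'.

(* The group G and the isomorphism are not determined by x; [liftable]
   quantifies over all choices. *)
Record holonomy (x : section T) (a : K) := Holonomy {
  hol_dim : nat;
  hol_grp : csubgroup hol_dim;
  hol_iso : stfun (betahat x a) (pihat hol_grp);
  hol_isoP : is_stiso hol_iso;
  hol_chi : {multiplicative pi1 a -> outer hol_grp};
  hol_chiP : forall (p : loop a) (u : normalizer hol_grp),
    qproj (innormal hol_grp) u = hol_chi (pi1_class p) ->
    forall r s (t : hom (betahat x a) r s),
      exists2 t', loop_transport p t t' & fa hol_iso t' = uhat u (fa hol_iso t)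
}.

Definition has_lift (x : section T) (a : K) (h : holonomy x a) : Prop :=
  exists chi : {multiplicative pi1 a -> normalizer (hol_grp h)},
    forall g, qproj (innormal (hol_grp h)) (chi g) = hol_chi h g.

Definition liftable (x : section T) : Prop :=
  forall (a : K) (h : holonomy x a), has_lift h.

End Holonomy.

Record hilbert := Hilbert {
  hcar :> completeNormedModType C;
  inner : hcar -> hcar -> C;
  inner_linr : forall a u v w, inner u (a *: v + w) = a * inner u v + inner u w;
  inner_conj : forall u v, inner v u = (inner u v)^*;
  inner_norm : forall u, inner u u = `|u| ^+ 2
}.

Local Open Scope classical_set_scope.

(* T is a full symmetric tensor subcategory of Hilb: its objects are Hilbert
   spaces, its arrows are all the bounded operators between them, and its
   tensor product is the Hilbert tensor product, with the flip as symmetry.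
   [pt u v] is the simple tensor of u and v. As T is strict, the associativity
   and unit isomorphisms of the Hilbert tensor product are suppressed. The norm
   of T need not be mentioned: *-isomorphisms of C*-categories are isometric. *)
Record hilb_tensor (T : cstcat) := HilbTensor {
  hil : obj T -> hilbert;
  op : forall x y, hom T x y -> {linear hil x -> hil y};
  op_cont : forall x y (f : hom T x y), continuous (op f);
  op_lin : forall x y a (f g : hom T x y) v,
    op (a *: f + g) v = a *: op f v + op g v;
  op_comp : forall x y z (g : hom T y z) (f : hom T x y) v,
    op (g \oc f) v = op g (op f v);
  op_id : forall x v, op (idc x) v = v;
  op_star : forall x y (f : hom T x y) v w,
    inner (op (star f) w) v = inner w (op f v);
  op_inj : forall x y (f g : hom T x y), op f =1 op g -> f = g;
  op_surj : forall x y (A : {linear hil x -> hil y}), continuous A ->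
    exists f : hom T x y, op f =1 A;
  vac : hil (ou T);
  vac_norm : inner vac vac = 1;
  vac_span : forall v, exists c, v = c *: vac;
  pt : forall x y, hil x -> hil y -> hil (x \oto y);
  pt_linl : forall x y a (u u' : hil x) (v : hil y),
    pt (a *: u + u') v = a *: pt u v + pt u' v;
  pt_linr : forall x y a (u : hil x) (v v' : hil y),
    pt u (a *: v + v') = a *: pt u v + pt u v';
  pt_inner : forall x y (u u' : hil x) (v v' : hil y),
    inner (pt u v) (pt u' v') = inner u u' * inner v v';
  pt_total : forall x y,
    closure (range (fun s : seq (hil x * hil y) =>
      \sum_(p <- s) pt p.1 p.2)) = [set: hil (x \oto y)];
  ptA : forall x y z (u : hil x) (v : hil y) (w : hil z),
    ecast i (hil i) (otA x y z) (pt u (pt v w)) = pt (pt u v) w;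
  pt1x : forall x (u : hil x), ecast i (hil i) (ot1x x) (pt vac u) = u;
  ptx1 : forall x (u : hil x), ecast i (hil i) (otx1 x) (pt u vac) = u;
  op_ta : forall x y x' y' (f : hom T x y) (g : hom T x' y') u v,
    op (f \ota g) (pt u v) = pt (op f u) (op g v);
  op_sy : forall x y (u : hil x) (v : hil y), op (sy x y) (pt u v) = pt v u
}.

Section Embeddings.
Variables (disp : Order.disp_t) (K : porderType disp).

Record hilbert_presheaf (P : stpresheaf K) := HilbertPresheaf {
  hp_hilb : forall o, hilb_tensor (P o);
  hp_full : forall o o' (h : (o <= o')%O), full (res P h)
}.

Record embedding (T P : stpresheaf K) := Embedding {
  emb :> forall o, stfun (T o) (P o);
  emb_faithful : forall o, faithful (emb o);
  emb_obj : forall o o' (h : (o <= o')%O) (x : obj (T o')),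
    emb o (res T h x) = res P h (emb o' x);
  emb_hom : forall o o' (h : (o <= o')%O) (x y : obj (T o')) (f : hom (T o') x y),
    fa (emb o) (fa (res T h) f) === fa (res P h) (fa (emb o') f)
}.

End Embeddings.

End Categories.

Arguments hom {R} s _ _ : rename.
Arguments fa {R S T} s [x y].
Arguments res {R disp K} s [_ _] _.
Arguments wP {R T} w [x y].

Notation "g \oc f" := (compc g f).
Notation "f \ota g" := (ta f g).
Notation "x \oto y" := (ot x y).
Notation "f === g" := (aeq (hom := hom _) f g) (at level 70).

(* Main.v *)
(* The restriction functors of the Hilbert presheaf are full and faithful, so
   that every loop p acts on the arrows over a between sections of it. This
   action is multiplicative, depends only on the homotopy class of p, and on the
   Hilbert space H of the arrows from the unit to I(x) it is a unitary U(p); the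
   embedding carries the transport of arrows along p to conjugation by U(p). It
   remains to compare H with the defining representation of G.

   First, the isomorphism of the fibre with the category of G and the embedding
   give two realizations of the intertwiners of G on tensor powers, related by a
   unitary v from C^d to H. Indeed, averaging over G followed by the embedding
   defines a linear form on polynomials in the entries of two h x d matrices w
   and y, h being the dimension of H. The polynomials that it annihilates with
   all their multiples form a proper ideal, which has a zero because C is
   uncountable. At this zero w y^T = 1 and w intertwines the two realizations.
   Hence h <= d, antisymmetric tensors give h = d, and the unitary part in the
   polar decomposition of w is v. H need not be assumed finite-dimensional: the
   argument bounds the size of any orthonormal family of vectors.

   Second, a unitary commuting with all intertwiners of G belongs to G: otherwise
   a matrix coefficient separates G from its translate, while its average over G
   is an intertwiner. Hence v^-1 U(p) v and any representative of chi([p])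
   differ by an element of G, since they act alike on the intertwiners. *)

From HB Require Import structures.
From mathcomp Require Import all_boot all_order all_algebra.
From mathcomp Require mpoly.
From mathcomp Require Import boolp ring.

Set Implicit Arguments.
Unset Strict Implicit.
Unset Printing Implicit Defensive.

(** * Common zeros over an uncountable field *)

(** If v exists, the linear form of the comparison is the integral over the coset vG of f(x, conj
    x), for a polynomial f in the entries of w = x and y = conj x. Its ideal then consists of the
    polynomials vanishing on vG, and w y^T = 1 records unitarity. The form can be written without v:
    for a matrix unit X, the integral of x X x^-1 is the image, under the correspondence of the two
    realizations, of the projection of X to the intertwiners. Its variables commute because the
    symmetry is preserved. A zero of the ideal lies only in the complexification of vG; there y need
    not be the conjugate of w, which is why a polar decomposition has to follow.

    The obstacle is that H is not known to be finite-dimensional when the form is built. Compression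
    to the span of an incomplete orthonormal family respects tensor products, but respects
    composition only with arrows such as permutations of tensor factors. The form, w y^T = 1 and h
    <= d rely on no more than this; the rest of the comparison comes after a complete family has
    been chosen. *)

Module UncountableNullstellensatz.
Import mpoly.
Import GRing.Theory.
Local Open Scope ring_scope.

Section Characters.
Variables (F : closedFieldType) (n : nat).
Hypothesis uncountable : forall f : nat -> seq F, exists c, forall k, c \notin f k.
Local Notation A := {mpoly F[n]}.

Record ideal (J : A -> Prop) : Prop := Ideal {
  ideal0 : J 0;
  idealD : forall f g, J f -> J g -> J (f + g);
  idealM : forall f g, J f -> J (g * f);
  ideal1 : ~ J 1
}.

(** [msize] exceeds the degree by one, so only monomials of degree below [N] occur; a row in the
    kernel of the coefficient matrix is a dependency. *)
Lemma dependent_of_msize (N : nat) (s : seq A) :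
  all (fun a => msize a <= N)%N s -> (#|{: 'X_{1..n < N}}| < size s)%N ->
  exists2 c : 'I_(size s) -> F, (exists k, c k != 0) &
    \sum_k c k *: s`_k = 0.
Proof.
move=> sN lt_s; set D := #|_| in lt_s.
pose M : 'M[F]_(size s, D) := \matrix_(k, m) (s`_k)@_(enum_val m : 'X_{1..n < N}).
have : kermx M != 0.
  rewrite -mxrank_eq0 mxrank_ker -lt0n subn_gt0.
  exact: leq_ltn_trans (rank_leq_col M) lt_s.
case/rowV0Pn => v /sub_kermxP vM /rV0Pn[k0 vk0].
exists (fun k => v 0 k); first by exists k0.
apply/mpolyP => m; rewrite mcoeff0 raddf_sum /=.
under eq_bigr do rewrite mcoeffZ.
have [mN|mN] := ltnP (mdeg m) N.
  have /matrixP/(_ 0 (enum_rank (BMultinom mN))) := vM.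
  rewrite !mxE => {2}<-; apply: eq_bigr => k _.
  by rewrite mxE enum_rankK.
apply: big1 => k _; rewrite [X in _ * X](_ : _ = 0) ?mulr0 //.
apply/eqP; rewrite mcoeff_eq0; apply: msize_mdeg_ge; apply: leq_trans mN.
by apply: (allP sN); apply: mem_nth.
Qed.

(* Otherwise the inverses of the x - l modulo J, for uncountably many l, would
   be linearly independent in a space of countable dimension. *)
Lemma ideal_eigen J (x : A) : ideal J ->
  exists l : F, ~ exists a, J (1 - (x - l%:MP) * a).
Proof.
move=> JI; apply: contrapT => /forallNP H.
have {H} : forall l : F, exists a, J (1 - (x - l%:MP) * a).
  by move=> l; apply: contrapT; apply: H.
case/boolp.choice => a Ja.
(* Only finitely many [l] have an inverse [a l] of size at most [N]: a list of more such [l] than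
   there are monomials available would give a linear dependency. *)
have fin N : exists s : seq F, forall l, (msize (a l) <= N)%N -> l \in s.
  apply: contrapT => /forallNP H.
  have grow k : exists s : seq F,
      [/\ uniq s, size s = k & all (fun l => msize (a l) <= N)%N s].
    elim: k => [|k [s [us sk sN]]]; first by exists [::].
    have /existsNP[l /not_implyP[lN /negP ls]] := H s.
    by exists (l :: s); rewrite /= us ls sk lN.
  have [s [us sk sN]] := grow #|{: 'X_{1..n < N}}|.+1.
  have [||c [k0 ck0] cs] := @dependent_of_msize N [seq a l | l <- s].
  - by rewrite all_map.
  - by rewrite size_map sk.
  (* Clearing denominators in the dependency, read as the vanishing of the sum of c_k / (x - s_k),
     shows that p(x) lies in J. The value of p at s_k0 is not zero. *)
  pose r k := \prod_(l < size s | l != k :> nat) ('X - (s`_l)%:P).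
  pose p : {poly F} := \sum_(k < size [seq a l | l <- s]) c k *: r k.
  have k0s : (k0 < size s)%N by rewrite -(size_map a) ltn_ord.
  have p0 : p != 0.
    apply/eqP => /(congr1 (horner^~ s`_k0)); rewrite horner0 horner_sum.
    rewrite (bigD1 k0) //= big1 => [|k kk0]; last first.
      rewrite hornerZ /r (bigD1 (Ordinal k0s)) /= 1?eq_sym //.
      by rewrite hornerM hornerXsubC subrr mul0r mulr0.
    rewrite addr0 hornerZ => /eqP; rewrite mulf_eq0 (negPf ck0) /=.
    rewrite /r horner_prod prodf_seq_eq0 => /hasP[l _ /andP[lk0]].
    rewrite hornerXsubC subr_eq0 nth_uniq // => /eqP e.
    by rewrite e eqxx in lk0.
  pose ev : {rmorphism {poly F} -> A} :=
    horner_morph (fun c : F => mulrC x (@mpolyC n F c)).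
  have evC z : ev z%:P = z%:MP by apply: horner_morphC.
  have evXC l : ev ('X - l%:P) = x - l%:MP.
    by rewrite rmorphB evC; congr (_ - _); apply: horner_morphX.
  have JB f g : J f -> J (f - g) -> J g.
    move=> Jf /(idealM JI (-1)); rewrite mulN1r opprB => Jgf.
    by rewrite -(subrK f g); apply: idealD.
  have Jsum (I : Type) (t : seq I) (f : I -> A) :
      (forall i, J (f i)) -> J (\sum_(i <- t) f i).
    move=> Jf; elim: t => [|i t IH]; rewrite ?big_nil ?big_cons.
      exact: ideal0.
    exact: idealD.
  have Jp : J (ev p).
    apply: (@JB (\sum_(k < size [seq a l | l <- s])
       c k *: ev (r k) * (1 - (x - (s`_k)%:MP) * (a s`_k)))).
      by apply: Jsum => k; apply: idealM.
    rewrite [X in J X](_ : _ = 0); first exact: ideal0.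
    transitivity (- (\prod_(l <- s) (x - l%:MP) * \sum_k c k *: [seq a l | l <- s]`_k)); last first.
      by rewrite cs mulr0 oppr0.
    rewrite /p rmorph_sum -sumrB mulr_sumr -sumrN; apply: eq_bigr => k _.
    have ks : (k < size s)%N by rewrite -(size_map a) ltn_ord.
    rewrite -mul_polyC rmorphM evC.
    rewrite (nth_map 0) // -mul_mpolyC (big_nth 0) big_mkord.
    rewrite (bigD1 (Ordinal ks)) //=.
    rewrite /r rmorph_prod (eq_bigr (fun l : 'I_(size s) => x - (s`_l)%:MP)); last by move=> l _; apply: evXC.
    set P := \prod_(l < size s | l != k :> nat) _.
    rewrite -mul_mpolyC; ring.
  (* Over a closed field p splits into linear factors. Each is invertible at x modulo J, so p(x) is
     invertible modulo J as well as in J. *)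
  have [t pE] := closed_field_poly_normal p.
  have inv : exists b, J (1 - ev (\prod_(z <- t) ('X - z%:P)) * b).
    elim: (t) => [|z t' [b Jb]].
      by exists 1; rewrite big_nil rmorph1 mulr1 subrr; apply: ideal0.
    exists (a z * b); rewrite big_cons rmorphM evXC.
    set Q := ev _; have := idealD JI (idealM JI (Q * b) (Ja z)) Jb.
    by congr J; ring.
  case: inv => b Jb; case: (ideal1 JI).
  apply: JB (idealM JI ((lead_coef p)^-1 *: b) Jp) _.
  have := idealM JI (- 1) Jb; rewrite mulN1r opprB; congr J.
  rewrite {2}pE -mul_polyC rmorphM evC -mul_mpolyC.
  rewrite [in RHS]mulrACA -mpolyCM mulVf ?lead_coef_eq0 // mpolyC1 mul1r.
  by rewrite [in RHS]mulrC.
(* The sizes N = 0, 1, ... cover F by countably many finite lists. *)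
case/boolp.choice: fin => s Hs; have [c Hc] := uncountable s.
by have /negP := Hc (msize (a c)); apply; apply: Hs.
Qed.

(** The generators X_i - w_i are adjoined one variable at a time, [ideal_eigen] supplying a w_i that
    keeps the ideal proper. Modulo the last ideal every f is congruent to the constant f(w), which
    therefore vanishes for f in J. *)
Lemma ideal_point J : ideal J -> exists w : 'I_n -> F, forall f, J f -> f.@[w] = 0.
Proof.
move=> JI.
have step k : (k <= n)%N -> exists w : 'I_n -> F, exists2 J', ideal J' &
    (forall f, J f -> J' f) /\
    forall i : 'I_n, (i < k)%N -> J' ('X_i - (w i)%:MP).
  elim: k => [|k IH] kn; first by exists (fun => 0), J.
  have [w [J' J'I [JJ' J'w]]] := IH (ltnW kn).
  have [l Hl] := ideal_eigen 'X_(Ordinal kn) J'I.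
  exists (fun i : 'I_n => if i == k :> nat then l else w i).
  exists (fun f => exists g a, J' g /\ f = g + ('X_(Ordinal kn) - l%:MP) * a).
    split=> [|f1 f2 [g1 [a1 [J1 ->]]] [g2 [a2 [J2 ->]]]|f g [g1 [a1 [J1 ->]]]|].
    - by exists 0, 0; rewrite mulr0 addr0; split=> //; apply: ideal0.
    - exists (g1 + g2), (a1 + a2); split; first exact: idealD.
      by rewrite addrACA mulrDr.
    - exists (g * g1), (g * a1); split; first exact: idealM.
      by rewrite mulrDr mulrCA.
    - move=> [g [a [Jg e]]]; apply: Hl; exists a.
      by rewrite e addrK.
  have J'0 := ideal0 J'I.
  split=> [f Jf|i]; first by exists f, 0; rewrite mulr0 addr0; split=> //; apply: JJ'.
  rewrite ltnS leq_eqVlt; case: eqP => [ik _|_ /= ik].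
    by exists 0, 1; rewrite mulr1 add0r; split=> //; congr ('X_ _ - _); apply: val_inj.
  by exists ('X_i - (w i)%:MP), 0; rewrite mulr0 addr0; split=> //; apply: J'w.
have [w [J' J'I [JJ' J'w]]] := step n (leqnn n).
exists w => f /JJ' Jf; apply: contrapT => /eqP fw; apply: (ideal1 J'I).
have J'0 := ideal0 J'I.
have JfC g : J' (g - (g.@[w])%:MP).
  elim/mpolyind: g => [|c m g _ _ IH]; first by rewrite meval0 mpolyC0 subrr.
  rewrite mevalD mpolyCD opprD addrACA; apply: idealD => //.
  rewrite mevalZ mpolyCM -mul_mpolyC -mulrBr; apply: idealM => //.
  rewrite mpolyXE_id; elim/big_ind: _ => [||i _].
  - by rewrite meval1 mpolyC1 subrr.
  - move=> g1 g2 J1 J2; rewrite mevalM mpolyCM.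
    rewrite -[g1 * g2](subrK (g1 * (g2.@[w])%:MP)) -mulrBr -addrA -mulrBl.
    by apply: idealD => //; [apply: idealM|rewrite mulrC; apply: idealM].
  rewrite rmorphXn /= mevalXU rmorphXn /= subrXX.
  by rewrite mulrC; apply: idealM => //; apply: J'w.
have := idealM J'I ((f.@[w])^-1)%:MP (idealD J'I (JfC f) (idealM J'I (-1) Jf)).
rewrite mulN1r addrAC subrr add0r => /(idealM J'I (-1)); rewrite mulrN mulN1r opprK.
by rewrite -mpolyCM mulVf // mpolyC1.
Qed.

End Characters.

(** * Symmetric functions of words as linear forms on polynomials *)

Section Words.
Variable F : closedFieldType.
Hypothesis uncountable : forall f : nat -> seq F, exists c, forall k, c \notin f k.
Variables (T : finType) (e : seq T -> F).
Hypothesis e_perm : forall s t, perm_eq s t -> e s = e t.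
Local Notation n := #|T|.
Local Notation A := {mpoly F[n]}.

(** [m2s] picks one word for each monomial; [e_perm] makes the choice harmless. *)
Let em (m : 'X_{1..n}) : F := e [seq enum_val i | i <- m2s m].
Let L (f : A) : F := \sum_(m <- msupp f) f@_m * em m.
Let word (s : seq T) : 'X_{1..n} := s2m [seq enum_rank x | x <- s].

Let LE (f : A) (s : seq 'X_{1..n}) : uniq s -> {subset msupp f <= s} ->
  L f = \sum_(m <- s) f@_m * em m.
Proof.
move=> us fs; rewrite (bigID (mem (msupp f))) /= [X in _ + X]big1 ?addr0.
  rewrite -big_filter; apply: perm_big; apply: uniq_perm.
  - exact: msupp_uniq.
  - exact: filter_uniq.
  by move=> m; rewrite mem_filter; case: (boolP (m \in msupp f)) => //= /fs.
by move=> m /memN_msupp_eq0->; rewrite mul0r.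
Qed.

Let L_lin a (f g : A) : L (a *: f + g) = a * L f + L g.
Proof.
pose s := undup (msupp (a *: f + g) ++ msupp f ++ msupp g).
have us : uniq s by apply: undup_uniq.
have ss m : (m \in s) = [|| m \in msupp (a *: f + g), m \in msupp f | m \in msupp g].
  by rewrite mem_undup !mem_cat.
rewrite !(@LE _ s) //; try by move=> m mf; rewrite ss mf ?orbT.
rewrite mulr_sumr -big_split; apply: eq_bigr => m _ /=.
by rewrite mcoeffD mcoeffZ mulrDl mulrA.
Qed.

Let L_word s : L 'X_[word s] = e s.
Proof.
rewrite /L msuppX big_seq1 mcoeffX eqxx mul1r; apply: e_perm.
apply: (@perm_trans _ [seq enum_val i | i <- [seq enum_rank x | x <- s]]); last first.
  by rewrite -map_comp map_id_in // => x _; apply: enum_rankK.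
apply/perm_map/allP => i _ /=; apply/eqP.
have /mnmP/(_ i) := s2mK (word s).
by rewrite !mnmE.
Qed.

Let word_cat s t : word (s ++ t) = (word s + word t)%MM.
Proof. by apply/mnmP => i; rewrite mnmDE !mnmE map_cat count_cat. Qed.

Let word_nil : word [::] = 0%MM.
Proof. by apply/mnmP => i; rewrite !mnmE. Qed.

Let meval_word (w : 'I_n -> F) s :
  'X_[word s].@[w] = \prod_(x <- s) w (enum_rank x).
Proof.
elim: s => [|x s IH].
  by rewrite big_nil word_nil mpolyX0 meval1.
rewrite -cat1s word_cat mpolyXD mevalM IH big_cons.
rewrite (_ : word [:: x] = U_(enum_rank x)%MM) ?mevalXU //.
by apply/mnmP => i; rewrite mnmE mnm1E /= addn0.
Qed.

(* A symmetric function of words is a linear form on commutative polynomials;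
   the polynomials that it annihilates together with all their multiples have
   a common zero. *)
Theorem symmetric_form_zero : e [::] != 0 ->
  exists w : T -> F, forall f : seq (F * seq T),
    (forall u, \sum_(p <- f) p.1 * e (p.2 ++ u) = 0) ->
    \sum_(p <- f) p.1 * \prod_(x <- p.2) w x = 0.
Proof.
move=> e0; have L0 : L 0 = 0.
  by have := L_lin (-1) 0 0; rewrite scaler0 addr0 mulN1r addNr.
have L_sum (I : Type) (s : seq I) (c : I -> F) (f : I -> A) :
    L (\sum_(i <- s) c i *: f i) = \sum_(i <- s) c i * L (f i).
  by elim: s => [|i s IH]; rewrite ?big_nil // !big_cons L_lin IH.
pose J (f : A) := forall g, L (f * g) = 0.
have JI : ideal J.
  split=> [g|f g Jf Jg h|f g Jf h|J1].
  - by rewrite mul0r.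
  - by rewrite mulrDl -[f * h]scale1r L_lin Jf Jg mulr0 addr0.
  - by rewrite -(mulrC f) -mulrA Jf.
  - by have := J1 1; rewrite mulr1 -mpolyX0 -word_nil L_word; apply/eqP.
have [w Hw] := ideal_point uncountable JI.
exists (w \o enum_rank) => f Hf.
(* Membership in [J] is tested on monomials, which span; each is [word u] for some [u], to which the
   hypothesis applies. *)
rewrite -[RHS](Hw (\sum_(p <- f) p.1 *: 'X_[word p.2])); last first.
  move=> g; rewrite [g]mpolyE mulr_sumr.
  under eq_bigr do rewrite -scalerAr.
  rewrite L_sum big1_seq // => m _; rewrite mulr_suml.
  under eq_bigr do rewrite -scalerAl -mpolyXD.
  pose u := [seq enum_val i | i <- m2s m].
  have mu : m = word u.
    by rewrite /word -map_comp map_id_in ?s2mK // => i _; apply: enum_valK.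
  rewrite L_sum (_ : \sum_(p <- f) _ = 0) ?mulr0 //; rewrite -[RHS](Hf u).
  by apply: eq_bigr => p _; rewrite mu -word_cat L_word.
rewrite raddf_sum /=; apply: eq_bigr => p _.
by rewrite mevalZ meval_word.
Qed.

End Words.
End UncountableNullstellensatz.

From mathcomp Require Import perm all_classical all_reals all_analysis complex lra.
Require Import Defs.

Import Order.TTheory GRing.Theory Num.Theory.
Import numFieldNormedType.Exports.
Local Open Scope ring_scope.

(** * Averages over a compact group *)

(* [mean f t] is the average of f over the leaves of t, a leaf at depth k
   having weight 2^-k. It replaces the integral over the group. *)
Section Trees.
Variable R : realType.
Local Notation C := R[i].

Inductive tree (A : Type) := Leaf of A | Node of tree A & tree A.

Fixpoint allt A (P : A -> Prop) (t : tree A) : Prop :=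
  match t with Leaf a => P a | Node t1 t2 => allt P t1 /\ allt P t2 end.

Fixpoint mean A (V : lmodType C) (f : A -> V) (t : tree A) : V :=
  match t with
  | Leaf a => f a
  | Node t1 t2 => 2^-1 *: (mean f t1 + mean f t2)
  end.

Fixpoint tbind A B (t : tree A) (f : A -> tree B) : tree B :=
  match t with Leaf a => f a | Node t1 t2 => Node (tbind t1 f) (tbind t2 f) end.

Lemma allt_tbind A B (P : A -> Prop) (Q : B -> Prop) t (f : A -> tree B) :
  allt P t -> (forall a, P a -> allt Q (f a)) -> allt Q (tbind t f).
Proof. by move=> + fQ; elim: t => [a /fQ|t1 IH1 t2 IH2 /= [/IH1 ? /IH2]]. Qed.

Lemma mean_tbind A B (V : lmodType C) (f : B -> V) t (g : A -> tree B) :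
  mean f (tbind t g) = mean (fun a => mean f (g a)) t.
Proof. by elim: t => //= t1 -> t2 ->. Qed.

Lemma eq_mean A (V : lmodType C) (f g : A -> V) t :
  f =1 g -> mean f t = mean g t.
Proof. by move=> fg; elim: t => //= t1 -> t2 ->. Qed.

Lemma mean_linear A (V W : lmodType C) (L : V -> W) (f : A -> V) t :
  (forall a u v, L (a *: u + v) = a *: L u + L v) ->
  mean (L \o f) t = L (mean f t).
Proof.
move=> Llin; have L0 : L 0 = 0.
  by have := Llin (-1) 0 0; rewrite scaler0 addr0 scaleN1r addNr.
have LZ a u : L (a *: u) = a *: L u by rewrite -[a *: u]addr0 Llin L0 addr0.
have LD u v : L (u + v) = L u + L v by rewrite -[u]scale1r Llin !scale1r.
by elim: t => //= t1 -> t2 ->; rewrite LZ LD.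
Qed.

End Trees.

(** * Squared norms and completeness in finite dimension *)

Section SquaredNorm.
Variable R : realType.
Local Notation C := R[i].

(** The squared modulus as an element of R, so that infima and [lra] are available. *)
Definition sqn (z : C) : R := complex.Re z ^+ 2 + complex.Im z ^+ 2.

Lemma sqnE (z : C) : ((sqn z)%:C)%C = z^* * z.
Proof. by case: z => a b; rewrite /sqn; simpc; congr (_ +i* _)%C; ring. Qed.

Lemma sqn_ge0 (z : C) : 0 <= sqn z.
Proof. by rewrite addr_ge0 ?sqr_ge0. Qed.

Lemma sqn_eq0 (z : C) : sqn z = 0 -> z = 0.
Proof.
case: z => a b /eqP; rewrite paddr_eq0 ?sqr_ge0 //= !sqrf_eq0.
by move=> /andP[/eqP-> /eqP->].
Qed.

Section Family.
Variable J : finType.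
Implicit Types f g : {ffun J -> C^o}.

(** The square of the Hilbert-Schmidt norm; [nrmD3] and [Re_ip_le] take the place of the triangle
    and Cauchy-Schwarz inequalities. *)
Definition nrm f : R := \sum_p sqn (f p).
Definition ip f g : C := \sum_p (f p)^* * g p.

Lemma nrm_ge0 f : 0 <= nrm f.
Proof. by apply: sumr_ge0 => p _; apply: sqn_ge0. Qed.

Lemma nrmE f : ((nrm f)%:C)%C = ip f f.
Proof. by rewrite raddf_sum; apply: eq_bigr => p _; rewrite /= sqnE. Qed.

Lemma nrm_eq0 f : nrm f = 0 -> f = 0.
Proof.
move=> /eqP; rewrite psumr_eq0 => [/allP f0|p _]; last exact: sqn_ge0.
by apply/ffunP => p; rewrite ffunE; apply/sqn_eq0/eqP/f0; rewrite mem_index_enum.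
Qed.

(** Stated with the midpoint, which is the value of [mean] at a [Node]: two points of almost least
    norm in a convex set are close to each other. *)
Lemma nrm_parallelogram f g :
  nrm (f - g) = 2 * nrm f + 2 * nrm g - 4 * nrm (2^-1 *: (f + g)).
Proof.
rewrite /nrm !mulr_sumr -!big_split /= -sumrB; apply: eq_bigr => p _.
rewrite !ffunE /=; case: (f p) (g p) => a b [c d].
rewrite (_ : 2^-1 *: _ = ((2^-1 * (a + c)) +i* (2^-1 * (b + d)))%C).
  by rewrite /sqn /=; field.
rewrite /GRing.scale /= (_ : (2^-1 : C) = (2^-1 : R)%:C%C).
  by simpc.
by rewrite fmorphV rmorph_nat.
Qed.

Lemma nrmD3 f g h : nrm (f + g + h) <= 3 * (nrm f + nrm g + nrm h).
Proof.
rewrite /nrm !mulrDr !mulr_sumr -!big_split; apply: ler_sum => p _.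
rewrite !ffunE /=; case: (f p) (g p) (h p) => a b [c d] [x y]; rewrite /sqn /=.
have sq3 (u v t : R) : (u + v + t) ^+ 2 <= 3 * (u ^+ 2 + v ^+ 2 + t ^+ 2).
  by have := sqr_ge0 (u - v); have := sqr_ge0 (u - t); have := sqr_ge0 (v - t); lra.
by have := sq3 a c x; have := sq3 b d y; lra.
Qed.

Lemma nrmN f : nrm (- f) = nrm f.
Proof.
by apply: eq_bigr => p _; rewrite ffunE; case: (f p) => a b; rewrite /sqn /= !sqrrN.
Qed.

(** Cauchy-Schwarz in its arithmetic-geometric form. The free weight [eps] makes the term of a fixed
    f small, at the cost of a factor on g. *)
Lemma Re_ip_le (eps : R) f g : 0 < eps ->
  `|complex.Re (ip f g)| <= eps * nrm f + eps^-1 * nrm g.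
Proof.
move=> eps0; rewrite /ip raddf_sum /nrm !mulr_sumr -big_split /=.
apply: le_trans (ler_norm_sum _ _ _) _; apply: ler_sum => p _.
case: (f p) (g p) => a b [c d]; rewrite /sqn; simpc => /=.
have e0 : eps^-1 = (Num.sqrt eps)^-1 ^+ 2 by rewrite exprVn sqr_sqrtr ?ltW.
have e1 : eps = (Num.sqrt eps) ^+ 2 by rewrite sqr_sqrtr ?ltW.
have se : Num.sqrt eps != 0 by rewrite sqrtr_eq0 -ltNge.
have -> : a * c + b * d = (Num.sqrt eps * a) * ((Num.sqrt eps)^-1 * c)
   + (Num.sqrt eps * b) * ((Num.sqrt eps)^-1 * d) by field.
have -> : eps * (a ^+ 2 + b ^+ 2) + eps^-1 * (c ^+ 2 + d ^+ 2) =
  (Num.sqrt eps * a) ^+ 2 + (Num.sqrt eps * b) ^+ 2 +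
  ((Num.sqrt eps)^-1 * c) ^+ 2 + ((Num.sqrt eps)^-1 * d) ^+ 2.
  by rewrite {1}e1 e0; ring.
move: (_ * a) (_ * b) (_ * c) (_ * d) => x y z t.
have := sqr_ge0 (x + z); have := sqr_ge0 (x - z).
have := sqr_ge0 (y + t); have := sqr_ge0 (y - t).
have := sqr_ge0 x; have := sqr_ge0 y; have := sqr_ge0 z; have := sqr_ge0 t.
by rewrite ler_norml => *; apply/andP; split; lra.
Qed.

End Family.

(** Every left end x k - a k lies below every right end x l + a l, so the supremum of the left ends
    is in all these intervals. *)
Lemma limit_of_bounds (x a : nat -> R) :
  (forall k l, `|x k - x l| <= a k + a l) -> exists y, forall k, `|x k - y| <= a k.
Proof.
move=> H; pose E := [set x k - a k | k in [set: nat]]%classic.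
have ub l : ubound E (x l + a l).
  by move=> _ [k _ <-]; have := H k l; rewrite ler_norml => /andP[_]; lra.
have E0 : (E !=set0)%classic by exists (x 0%N - a 0%N), 0%N.
exists (sup E) => k; rewrite ler_norml; apply/andP; split.
  by rewrite lerBrDr addrC lerBlDr; apply: sup_le_ub.
rewrite lerBlDr addrC -lerBlDr; apply: sup_upper_bound; last by exists k.
by split=> //; exists (x 0%N + a 0%N).
Qed.

(** Completeness with an explicit rate, obtained coordinatewise; the factor counts the real and
    imaginary parts of all entries. *)
Lemma complete_family (J : finType) (m : nat -> {ffun J -> C^o}) (a : nat -> R) :
  (forall k, 0 <= a k) -> (forall k l, nrm (m k - m l) <= a k + a l) ->
  exists z, forall k, nrm (m k - z) <= (#|J|.*2)%:R * a k.
Proof.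
move=> a0 H.
have lim (part : C -> R) : (forall z w, part (z - w) = part z - part w) ->
    (forall z, part z ^+ 2 <= sqn z) ->
    exists z : J -> R, forall p k, (part (m k p) - z p) ^+ 2 <= a k.
  move=> partB part_le.
  suff /boolp.choice[z Hz] : forall p, exists y, forall k, (part (m k p) - y) ^+ 2 <= a k.
    by exists z.
  move=> p; have [k l|y Hy] := @limit_of_bounds (fun k => part (m k p)) (fun k => Num.sqrt (a k)).
    rewrite -ler_sqr ?nnegrE ?addr_ge0 ?sqrtr_ge0 // real_normK ?num_real //.
    rewrite [X in _ <= X]sqrrD !sqr_sqrtr // -partB; apply: le_trans (part_le _) _.
    apply: (@le_trans _ _ (a k + a l)).
      apply: le_trans (H k l); rewrite /nrm (bigD1 p) //= !ffunE lerDl.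
      by apply: sumr_ge0 => *; apply: sqn_ge0.
    by rewrite addrAC lerDl pmulrn_lge0 ?mulr_ge0 ?sqrtr_ge0.
  exists y => k; rewrite -real_normK ?num_real // -(sqr_sqrtr (a0 k)).
  by rewrite ler_sqr ?nnegrE ?sqrtr_ge0.
have [|z|x Hx] := lim (@complex.Re R); first by move=> [? ?] [? ?].
  by rewrite lerDl sqr_ge0.
have [|z|y Hy] := lim (@complex.Im R); first by move=> [? ?] [? ?].
  by rewrite lerDr sqr_ge0.
exists [ffun p => (x p +i* y p)%C] => k.
have -> : (#|J|.*2)%:R * a k = \sum_(p : J) 2 * a k.
  by rewrite sumr_const -[RHS]mulr_natl mulrA -natrM muln2.
apply: ler_sum => p _; rewrite !ffunE.
have := Hx p k; have := Hy p k; rewrite /sqn; case: (m k p) => u v /=.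
by lra.
Qed.

End SquaredNorm.

(** * Averages of orbits of tensors *)

Section Averages.
Variables (R : realType) (d : nat) (G : csubgroup R d).
Local Notation C := R[i].
Local Notation U := (unitary R d).
Local Notation tens := (tens R d).

Lemma tcompA r s t q (h : tens t q) (g : tens s t) (f : tens r s) :
  tcomp h (tcomp g f) = tcomp (tcomp h g) f.
Proof. exact: (mcompA (tens_starm R d)). Qed.

Lemma tcomp1f r s (f : tens r s) : tcomp (tid R d s) f = f.
Proof. exact: (mcomp1f (tens_starm R d)). Qed.

Lemma tcompf1 r s (f : tens r s) : tcomp f (tid R d r) = f.
Proof. exact: (mcompf1 (tens_starm R d)). Qed.

Lemma tcomp_linl r s t a (g g' : tens s t) (f : tens r s) :
  tcomp (a *: g + g') f = a *: tcomp g f + tcomp g' f.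
Proof. exact: (mcomp_linl (tens_starm R d)). Qed.

Lemma tcomp_linr r s t a (g : tens s t) (f f' : tens r s) :
  tcomp g (a *: f + f') = a *: tcomp g f + tcomp g f'.
Proof. exact: (mcomp_linr (tens_starm R d)). Qed.

Lemma tstar_comp r s t (g : tens s t) (f : tens r s) :
  tstar (tcomp g f) = tcomp (tstar f) (tstar g).
Proof. exact: (mstar_comp (tens_starm R d)). Qed.

Lemma tstarK r s (f : tens r s) : tstar (tstar f) = f.
Proof. exact: (mstarK (tens_starm R d)). Qed.

Lemma upowD u r s : upow u (r + s) = ttens (upow u r) (upow u s) :> tens _ _.
Proof. exact: upowcD. Qed.

Lemma tcomp_ttens r s t r' s' t' (g : tens s t) (f : tens r s)
    (g' : tens s' t') (f' : tens r' s') :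
  tcomp (ttens g g') (ttens f f') = ttens (tcomp g f) (tcomp g' f').
Proof. exact/esym/(mta_comp (tens_tensm R d)). Qed.

Lemma ttens_linr r s r' s' a (f : tens r s) (g g' : tens r' s') :
  ttens f (a *: g + g') = a *: ttens f g + ttens f g'.
Proof. exact: (mta_linr (tens_tensm R d)). Qed.

Lemma tstar_ttens r s r' s' (f : tens r s) (g : tens r' s') :
  tstar (ttens f g) = ttens (tstar f) (tstar g).
Proof. exact: (mta_star (tens_tensm R d)). Qed.

Lemma ip_sums r s (X Y : tens r s) :
  ip X Y = \sum_j \sum_i (X (j, i))^* * Y (j, i).
Proof. by rewrite pair_bigA; apply: eq_bigr => -[]. Qed.

Lemma ip_compl r s t (A : tens r s) (X : tens t r) (Y : tens t s) :
  ip (tcomp A X) Y = ip X (tcomp (tstar A) Y).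
Proof.
rewrite !ip_sums.
under eq_bigr => j _ do under eq_bigr => i _ do
  rewrite ffunE /= rmorph_sum mulr_suml.
under [RHS]eq_bigr => j _ do under eq_bigr => i _ do
  rewrite ffunE /= mulr_sumr.
rewrite exchange_big [RHS]exchange_big; apply: eq_bigr => i _ /=.
rewrite exchange_big; apply: eq_bigr => j _; apply: eq_bigr => k _ /=.
by rewrite ffunE rmorphM /= mulrCA mulrA.
Qed.

Lemma ip_compr r s t (A : tens t r) (X : tens r s) (Y : tens t s) :
  ip (tcomp X A) Y = ip X (tcomp Y (tstar A)).
Proof.
rewrite !ip_sums.
apply: eq_bigr => j _.
under eq_bigr => i _ do rewrite ffunE /= rmorph_sum mulr_suml.
under [RHS]eq_bigr => i _ do rewrite ffunE /= mulr_sumr.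
rewrite exchange_big; apply: eq_bigr => i _; apply: eq_bigr => k _ /=.
by rewrite ffunE rmorphM /= mulrAC mulrA.
Qed.

Definition act r s (u : U) (X : tens r s) : tens r s :=
  tcomp (tcomp (upow u s) X) (tstar (upow u r)).

Lemma actM r s u v (X : tens r s) : act (u * v)%g X = act u (act v X).
Proof.
by rewrite /act -!upowV invgM !upowM -!tcompA.
Qed.

Lemma act_lin r s u a (X Y : tens r s) :
  act u (a *: X + Y) = a *: act u X + act u Y.
Proof. by rewrite /act tcomp_linr tcomp_linl. Qed.

Lemma act0 r s u : act u (0 : tens r s) = 0.
Proof.
by have := act_lin u (-1) (0 : tens r s) 0; rewrite scaler0 addr0 scaleN1r addNr.
Qed.

Lemma actZ r s u a (X : tens r s) : act u (a *: X) = a *: act u X.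
Proof. by rewrite -[a *: X]addr0 act_lin act0 addr0. Qed.

Lemma act_tid r u : act u (tid R d r) = tid R d r.
Proof. by rewrite /act tcompf1 -upowV -upowM mulgV upow1. Qed.

Lemma actB r s u (X Y : tens r s) : act u (X - Y) = act u X - act u Y.
Proof. by rewrite addrC -scaleN1r act_lin scaleN1r addrC. Qed.

Lemma nrm_act r s u (X : tens r s) : nrm (act u X) = nrm X.
Proof.
apply: complexI; rewrite !nrmE /act ip_compr ip_compl -!upowV invgK.
rewrite -!tcompA -(upowM u^-1%g u r) mulVg upow1.
by rewrite tcompf1 tcompA -upowM mulVg upow1 tcomp1f.
Qed.

Lemma act_fixed r s u (X : tens r s) :
  act u X = X <-> tcomp (upow u s) X = tcomp X (upow u r).
Proof.
rewrite /act -upowV; split=> [e|->].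
  by rewrite -{2}e -!tcompA -upowM mulVg upow1 tcompf1.
by rewrite -tcompA -upowM mulgV upow1 tcompf1.
Qed.

Lemma act1 r s (X : tens r s) : act 1%g X = X.
Proof. by rewrite act_fixed !upow1 tcomp1f tcompf1. Qed.

Lemma act_tcomp r s u (X Y : tens r s) :
  tcomp (upow u s) X = tcomp Y (upow u r) -> act u X = Y.
Proof.
by rewrite /act -upowV => ->; rewrite -tcompA -upowM mulgV upow1 tcompf1.
Qed.

Lemma mean_act r s (X : tens r s) g S :
  mean (fun h => act (g * h)%g X) S = act g (mean (fun h => act h X) S).
Proof.
rewrite -(@mean_linear _ _ _ _ (act (r := r) (s := s) g)) => [|a x y].
  by apply: eq_mean => h; rewrite actM.
exact: act_lin.
Qed.

Local Notation avg X S := (mean (fun g => act g X) S).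

(* The point of least norm in the closed convex hull of the orbit of X under G
   is fixed by G. *)
Lemma average_intertwiner r s (X : tens r s) :
  exists2 z : tens r s, intertwiner G z &
    forall eps : R, 0 < eps -> exists2 S, allt G S & nrm (avg X S - z) <= eps.
Proof.
pose E := [set y | exists2 S, allt G S & y = nrm (avg X S)]%classic.
have E0 : has_inf E.
  split; first by exists (nrm (avg X (Leaf 1%g))), (Leaf 1%g) => //; apply: cg1.
  by exists 0 => _ [S _ ->]; apply: nrm_ge0.
pose del := inf E.
have delP S : allt G S -> del <= nrm (avg X S).
  by move=> GS; apply: ge_inf; [case: E0 | exists S].
have close S1 S2 e1 e2 : allt G S1 -> allt G S2 -> nrm (avg X S1) <= del + e1 ->
    nrm (avg X S2) <= del + e2 -> nrm (avg X S1 - avg X S2) <= 2 * e1 + 2 * e2.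
  move=> G1 G2 H1 H2; rewrite nrm_parallelogram.
  by have := @delP (Node S1 S2) (conj G1 G2) => /=; lra.
pose a k : R := k.+1%:R^-1.
have a0 k : 0 < a k by rewrite invr_gt0 ltr0n.
have /boolp.choice[S HS] : forall k, exists S, allt G S /\ nrm (avg X S) <= del + a k.
  move=> k; have [_ [S GS ->] lt] := inf_adherent (a0 k) E0.
  by exists S; split=> //; apply: ltW.
have [k|k l|z Hz] := @complete_family _ _ (fun k => avg X (S k)) (fun k => 2 * a k).
- by rewrite mulr_ge0 ?ltW.
- by case: (HS k) (HS l) => [? ?] [? ?]; apply: close.
set N := (_%:R : R) in Hz.
have N0 : 0 <= N by rewrite ler0n.
have small (x K : R) : 0 <= K -> (forall k, x <= K * a k) -> x <= 0.
  move=> K0 xK; rewrite leNgt; apply/negP => x0.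
  have [k kP] : exists k : nat, K / x < k.+1%:R.
    exists (Num.truncn (K / x)); apply: truncnS_gt.
  have := xK k; rewrite leNgt => /negP; apply.
  by rewrite /a ltr_pdivrMr ?ltr0n // mulrC -ltr_pdivrMr.
have zG : intertwiner G z.
  move=> g Gg; apply/act_fixed/eqP; rewrite -subr_eq0; apply/eqP/nrm_eq0/eqP.
  (* The constant adds up three terms: z - m counted twice, each with [nrm] at most 2 N a_k, and g m
     - m with at most 4 a_k. The factor 3 is that of [nrmD3]. *)
  rewrite eq_le nrm_ge0 andbT; apply: (@small _ (3 * (4 * N + 4))).
    by lra.
  move=> k; have [GS Sk] := HS k; set m := avg X (S k) in Sk.
  have -> : act g z - z = act g (z - m) + (act g m - m) + (m - z).
    by rewrite actB !addrA !addrNK.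
  apply: le_trans (nrmD3 _ _ _) _.
  rewrite nrm_act -nrmN opprB; have := Hz k; rewrite -/m.
  have : nrm (act g m - m) <= 2 * a k + 2 * a k.
    (* The translate by g is again an average over a tree in G and has the same norm, so it is also
       almost minimal and hence close to m. *)
    have -> : act g m = avg X (tbind (Leaf g) (fun g => tbind (S k) (fun h => Leaf (g * h)%g))).
      by rewrite /= mean_tbind /= mean_act.
    apply: close => //.
      by apply: (@allt_tbind _ _ G G (S k)) => // h Gh; apply: cgM.
    by rewrite /= mean_tbind /= mean_act nrm_act.
  by lra.
exists z => // eps eps0.
have [k kP] : exists k : nat, N * 2 / eps < k.+1%:R.
  by exists (Num.truncn (N * 2 / eps)); apply: truncnS_gt.
exists (S k); first by case: (HS k).
apply: le_trans (Hz k) _.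
by rewrite mulrA /a ler_pdivrMr ?ltr0n // ltW // [ltRHS]mulrC -ltr_pdivrMr.
Qed.

End Averages.

(** * Intertwiners determine a closed subgroup *)

Section Coefficients.
Variables (R : realType) (d : nat).
Local Notation C := R[i].
Local Notation U := (unitary R d).
Local Notation tens := (tens R d).

(** Matrix coefficients of the actions on tensors. They form an algebra closed under conjugation:
    products come from tensor products, conjugates from adjoints, and constants from r = s = 0. *)
Inductive coef : (U -> C) -> Prop :=
| coef_one r s (X Y : tens r s) : coef (fun x => ip Y (act x X))
| coef_add f g : coef f -> coef g -> coef (fun x => f x + g x).

Lemma ip_ttens r s r' s' (X Y : tens r s) (X' Y' : tens r' s') :
  ip (ttens X X') (ttens Y Y') = ip X Y * ip X' Y'.
Proof.
rewrite !ip_sums sum_join mulr_suml; apply: eq_bigr => j _.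
rewrite mulr_sumr; apply: eq_bigr => j' _.
rewrite sum_join mulr_suml; apply: eq_bigr => i _.
rewrite mulr_sumr; apply: eq_bigr => i' _.
by rewrite !ttensE !lpart_join !rpart_join rmorphM mulrACA.
Qed.

Lemma act_ttens r s r' s' u (X : tens r s) (X' : tens r' s') :
  act u (ttens X X') = ttens (act u X) (act u X').
Proof.
by rewrite /act !upowD tstar_ttens !tcomp_ttens.
Qed.

Lemma coef_eq f g : f =1 g -> coef f -> coef g.
Proof. by move=> /funext->. Qed.

Lemma coef_mul f g : coef f -> coef g -> coef (fun x => f x * g x).
Proof.
move=> + cg; elim=> [r s X Y|f1 f2 _ c1 _ c2]; last first.
  by apply: coef_eq (coef_add c1 c2) => x; rewrite mulrDl.
elim: cg => [r' s' X' Y'|g1 g2 _ c1 _ c2]; last first.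
  by apply: coef_eq (coef_add c1 c2) => x; rewrite mulrDr.
apply: coef_eq (coef_one (ttens X X') (ttens Y Y')) => x.
by rewrite act_ttens ip_ttens.
Qed.

Lemma ip_tens0 (X Y : tens 0 0) z : ip X Y = (X (z, z))^* * Y (z, z).
Proof.
have Z i : i = z :> midx d 0 by apply/eqP/midx0.
rewrite ip_sums (big_pred1 z) => [|i]; last by rewrite /= (Z i) eqxx.
by rewrite (big_pred1 z) // => i; rewrite /= (Z i) eqxx.
Qed.

Lemma coef_const c : coef (fun=> c).
Proof.
have z : midx d 0 by apply: finfun => -[].
apply: coef_eq (coef_one (c *: tid R d 0) (tid R d 0)) => x.
rewrite actZ act_tid (ip_tens0 _ _ z) !ffunE /= eqxx.
by rewrite conjC1 mul1r; apply: mulr1.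
Qed.

Lemma coef_scale c f : coef f -> coef (fun x => c * f x).
Proof. exact/coef_mul/coef_const. Qed.

Lemma coef_sum (I : Type) (s : seq I) (P : pred I) (f : I -> U -> C) :
  (forall i, coef (f i)) -> coef (fun x => \sum_(i <- s | P i) f i x).
Proof.
move=> cf; elim: s => [|i s IH].
  by apply: coef_eq (coef_const 0) => x; rewrite big_nil.
case Pi: (P i); last by apply: coef_eq IH => x; rewrite big_cons Pi.
by apply: coef_eq (coef_add (cf i) IH) => x; rewrite big_cons Pi.
Qed.

Lemma coef_pow f n : coef f -> coef (fun x => f x ^+ n).
Proof.
move=> cf; elim: n => [|n IH]; first exact: coef_const.
by apply: coef_eq (coef_mul cf IH) => x; rewrite exprS.
Qed.

Lemma tstar_ip r s (X Y : tens r s) : ip (tstar X) (tstar Y) = (ip X Y)^*.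
Proof.
rewrite !ip_sums exchange_big rmorph_sum; apply: eq_bigr => j _ /=.
rewrite rmorph_sum; apply: eq_bigr => i _ /=.
by rewrite !ffunE rmorphM.
Qed.

Lemma coef_conj f : coef f -> coef (fun x => (f x)^*).
Proof.
elim=> [r s X Y|f1 f2 _ c1 _ c2]; last first.
  by apply: coef_eq (coef_add c1 c2) => x; rewrite rmorphD.
apply: coef_eq (coef_one (tstar X) (tstar Y)) => x.
rewrite -tstar_ip; congr ip; rewrite /act.
by rewrite !tstar_comp !tstarK -tcompA.
Qed.

(** [tens 0 1] is C^d with the defining action, so an entry is a coefficient between two basis
    vectors. *)
Lemma coef_entry i j : coef (fun x => uval x i j).
Proof.
have z : midx d 0 by apply: finfun => -[].
pose e (k : 'I_d) : midx d 1 := [ffun=> k].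
have eE (i' : midx d 1) : i' = e (i' ord0).
  by apply/ffunP => k; rewrite ffunE ord1.
pose X k : tens 0 1 := [ffun p => (p.1 == e k)%:R].
apply: coef_eq (coef_one (X j) (X i)) => x.
rewrite ip_sums (bigD1 (e i)) //= [X in _ + X]big1 ?addr0 => [|k ki]; last first.
  by apply: big1 => l _; rewrite ffunE (negPf ki) conjC0 mul0r.
rewrite (big_pred1 z) => [|k]; last by rewrite /= (midx0 k z).
rewrite !ffunE /= eqxx conjC1 mul1r (big_pred1 z) => [|k]; last by rewrite /= (midx0 k z).
rewrite !ffunE /= big_ord0 conjC1 mulr1 (bigD1 (e j)) //= big1 ?addr0 => [|k kj].
  by rewrite !ffunE /= eqxx mulr1 big_ord1 !ffunE.
by rewrite !ffunE /= (negPf kj) mulr0.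
Qed.

End Coefficients.

(** * Distances between unitary matrices *)

Section Distance.
Variables (R : realType) (d : nat).
Local Notation C := R[i].
Local Notation U := (unitary R d).

Definition hs (A B : 'M[C]_d) : R := \sum_i \sum_j sqn (A i j - B i j).

Lemma hs_ge0 A B : 0 <= hs A B.
Proof. by apply: sumr_ge0 => i _; apply: sumr_ge0 => j _; apply: sqn_ge0. Qed.

Lemma hs_eq0 A B : hs A B = 0 -> A = B.
Proof.
move=> /eqP; rewrite psumr_eq0 => [/allP H|i _]; last first.
  by apply: sumr_ge0 => j _; apply: sqn_ge0.
apply/matrixP => i j; have := H i; rewrite mem_index_enum => /(_ isT).
rewrite psumr_eq0 => [/allP/(_ j)|k _]; last exact: sqn_ge0.
rewrite mem_index_enum => /(_ isT) /= /eqP /sqn_eq0/eqP.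
by rewrite subr_eq0 => /eqP.
Qed.

Lemma hsE A B : ((hs A B)%:C)%C = \tr ((A - B) *m ((A - B)^t*)%sesqui).
Proof.
rewrite /hs raddf_sum; apply: eq_bigr => i _ /=; rewrite raddf_sum mxE.
by apply: eq_bigr => j _; rewrite /= sqnE !mxE mulrC.
Qed.

Lemma hs_sym A B : hs A B = hs B A.
Proof.
apply: eq_bigr => i _; apply: eq_bigr => j _.
by rewrite -opprB /sqn; case: (_ - _) => a b /=; rewrite !sqrrN.
Qed.

Lemma hs_triangle A B D : hs A D <= 2 * hs A B + 2 * hs B D.
Proof.
rewrite /hs !mulr_sumr -big_split; apply: ler_sum => i _ /=.
rewrite !mulr_sumr -big_split; apply: ler_sum => j _ /=.
case: (A i j) (B i j) (D i j) => a b [a' b'] [a'' b'']; rewrite /sqn /=.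
have sq2 (x y z : R) : (x - z) ^+ 2 <= 2 * (x - y) ^+ 2 + 2 * (y - z) ^+ 2.
  by have := sqr_ge0 (x - y - (y - z)); lra.
by have := sq2 a a' a''; have := sq2 b b' b''; lra.
Qed.

Lemma hs_mulr (u : U) A B : hs (A *m u) (B *m u) = hs A B.
Proof.
apply: complexI; rewrite !hsE -mulmxBl trmx_mul map_mxM mulmxA.
by rewrite mulmxtVK // uvalP.
Qed.

Lemma hs_le4 (u v : U) : hs u v <= 4 * d%:R.
Proof.
have hs0 (w : U) : hs w 0 = d%:R.
  apply: complexI; rewrite hsE subr0 (unitarymxP _) ?uvalP // mxtrace1.
  by rewrite rmorph_nat.
apply: le_trans (hs_triangle _ 0 _) _.
by rewrite [hs 0 _]hs_sym !hs0; lra.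
Qed.

(** A peak function at [g]: by [hs_le4] it takes values between 0 and 1 on unitaries and, for d > 0,
    equals 1 only at [g]. It is polynomial in the entries and their conjugates. *)
Definition kern (g x : U) : R := 1 - hs x g / (4 * d%:R).

Lemma coef_kern g : coef (fun x => ((kern g x)%:C)%C).
Proof.
have ch : coef (fun x => ((hs x g)%:C)%C).
  have: coef (fun x => \sum_i \sum_j
      ((uval x i j + (- 1) * g i j)^* * (uval x i j + (- 1) * g i j))).
    apply: coef_sum => i; apply: coef_sum => j.
    have c : coef (fun x => uval x i j + (- 1) * g i j).
      exact: coef_add (coef_entry R i j) (coef_const d (- 1 * g i j)).
    exact: coef_mul (coef_conj c) c.
  apply: coef_eq => x; rewrite /hs raddf_sum; apply: eq_bigr => i _ /=.
  by rewrite raddf_sum; apply: eq_bigr => j _ /=; rewrite sqnE mulN1r.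
have := coef_add (coef_const d 1) (coef_scale (- ((4 * d%:R)^-1)%:C)%C ch).
by apply: coef_eq => x; rewrite /kern rmorphB rmorphM rmorph1 mulNr mulrC.
Qed.

End Distance.

(** * Separating a compact group from a translate *)

Section Tannaka.
Variables (R : realType) (d : nat) (G : csubgroup R d).
Local Notation C := R[i].
Local Notation U := (unitary R d).

(** Compactness, applied to the interiors of balls whose radius may depend on their centre. *)
Lemma hs_net (rho : U -> R) : (forall g, G g -> 0 < rho g) ->
  exists s : seq U, (forall g, g \in s -> G g) /\
    forall x, G x -> exists2 g, g \in s & hs x g < rho g.
Proof.
move=> rho0; have := @cg_compact _ _ G; rewrite compact_cover => cov.
pose V (g : U) : set 'M[C : numFieldType]_d :=
  interior [set x : 'M[C : numFieldType]_d | hs x g < rho g]%classic.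
have [|x [g Gg <-]|s sG sV] := cov U (fun g => G g) V.
- by move=> g _; apply: open_interior.
- exists g => //; apply/nbhs_ballP => /=; have rg := rho0 g Gg.
  (* If all entries differ by less than e then [hs] is at most d^2 e^2. The minimum with 1 gives e^2
     <= e, and the successor of d^2 makes the final inequality strict. *)
  pose e := Num.min 1 (rho g / (d * d).+1%:R).
  have e0 : 0 < e by rewrite lt_min ltr01 divr_gt0 ?ltr0n.
  exists (e%:C)%C; first by rewrite /= ltcR.
  move=> y [_ /= yg]; apply: (@le_lt_trans _ _ ((d * d)%:R * e)).
    have -> : (d * d)%:R * e = \sum_(i < d) \sum_(j < d) e.
      by rewrite !sumr_const !card_ord -mulrnA mulr_natl.
    apply: ler_sum => i _; apply: ler_sum => j _.
    have := yg i j; rewrite /ball /= -normrN opprB => H.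
    have : `|y i j - g i j| ^+ 2 < (e%:C)%C ^+ 2.
      by rewrite ltr_pXn2r ?nnegrE ?normr_ge0 // lecR ltW.
    rewrite normCK mulrC -sqnE -rmorphXn ltcR => /ltW/le_trans; apply.
    by rewrite expr2 ger_pMl // ge_min lexx.
  apply: (@lt_le_trans _ _ ((d * d).+1%:R * e)).
    by rewrite ltr_pM2r // ltr_nat.
  by rewrite mulrC -ler_pdivlMr ?ltr0n // ge_min lexx orbT.
- exists (finmap.enum_fset s); split=> [g /sG|x Gx]; first by rewrite in_setE.
  have [|g gs xg] := sV (uval x); first by exists x.
  exists g => //; exact: (interior_subset xg).
Qed.

(** The convolution of the averaging measures given by two trees. *)
Definition tmul (S T : tree U) : tree U :=
  tbind S (fun g => tbind T (fun h => Leaf (g * h)%g)).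

Lemma allt_tmul S T : allt G S -> allt G T -> allt G (tmul S T).
Proof.
move=> GS GT; apply: allt_tbind GS _ => g Gg; apply: allt_tbind GT _ => h Gh.
exact: cgM.
Qed.

Lemma mean_tmul (V : lmodType C) (f : U -> V) S T :
  mean f (tmul S T) = mean (fun g => mean (fun h => f (g * h)%g) T) S.
Proof.
by rewrite mean_tbind; apply: eq_mean => g; rewrite mean_tbind.
Qed.

Lemma mean_act_tmul r s (X : tens R d r s) S T :
  mean (fun g => act g X) (tmul S T) =
  mean (fun g => act g (mean (fun h => act h X) T)) S.
Proof. by rewrite mean_tmul; apply: eq_mean => g; rewrite mean_act. Qed.

Lemma ip_linr r s (Y Z W : tens R d r s) a :
  ip Y (a *: Z + W) = a * ip Y Z + ip Y W.
Proof.
rewrite /ip mulr_sumr -big_split; apply: eq_bigr => p _ /=.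
by rewrite !ffunE mulrDr mulrCA.
Qed.

Lemma mean_ip r s (Y : tens R d r s) (f : U -> tens R d r s) S :
  mean (fun x => ip Y (f x) : C^o) S = ip Y (mean f S).
Proof.
rewrite -(@mean_linear _ _ _ C^o (ip Y)) // => a Z W.
exact: ip_linr.
Qed.

(** The action is isometric and fixes z, and balls around z are convex. *)
Lemma nrm_mean_act r s (w z : tens R d r s) S : intertwiner G z -> allt G S ->
  nrm (mean (fun g => act g w) S - z) <= nrm (w - z).
Proof.
move=> zG; elim: S => [g Gg|t1 IH1 t2 IH2] /=.
  by rewrite -{1}(iffRL (act_fixed _ _) (zG g Gg)) -actB nrm_act.
move=> [/IH1 + /IH2]; set a := mean _ t1; set b := mean _ t2 => Ha Hb.
have -> : 2^-1 *: (a + b) - z = 2^-1 *: ((a - z) + (b - z)).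
  rewrite addrACA -opprD scalerBr; congr (_ - _).
  by rewrite -mulr2n -scalerMnr -scaler_nat scalerA divff ?scale1r // pnatr_eq0.
have := nrm_parallelogram (a - z) (b - z); have := nrm_ge0 ((a - z) - (b - z)).
by lra.
Qed.

(* The averages of f over suitable trees in G become invariant under left
   translation by u, and further averaging does not spoil this. *)
Definition averageable (u : U) (f : U -> C) := forall eps : R, 0 < eps ->
  forall S0, allt G S0 -> exists2 S1, allt G S1 & forall S2, allt G S2 ->
    let S := tmul S2 (tmul S1 S0) in
    `|complex.Re (mean (fun x => f (u * x)%g : C^o) S) -
      complex.Re (mean (f : U -> C^o) S)| <= eps.

Lemma tmulA S1 S2 S3 : tmul S1 (tmul S2 S3) = tmul (tmul S1 S2) S3.
Proof.
rewrite /tmul; elim: S1 => [g|t1 IH1 t2 IH2] /=; last by rewrite IH1 IH2.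
elim: S2 => [h|t1 IH1 t2 IH2] /=; last by rewrite IH1 IH2.
by elim: S3 => [k|t1 IH1 t2 IH2] /=; rewrite ?mulgA // IH1 IH2.
Qed.

Lemma mean_add (f g : U -> C) S :
  mean (fun x => f x + g x : C^o) S = mean (f : U -> C^o) S + mean (g : U -> C^o) S.
Proof. by elim: S => //= t1 -> t2 ->; rewrite -scalerDr addrACA. Qed.

(** For a single coefficient the averages of X approach an intertwiner z. As u fixes z, translation
    by u hardly changes them. For a sum, the tree for the second function is built on top of that
    for the first; the quantifiers over [S0] and [S2] in [averageable] allow this. *)
Lemma coef_averageable (u : U) :
  (forall r s (t : tens R d r s), intertwiner G t -> act u t = t) ->
  forall f, coef f -> averageable u f.
Proof.
move=> ufix f; elim=> [r s X Y|f1 f2 _ IH1 _ IH2] eps eps0 S0 GS0; last first.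
  have e2 : 0 < eps / 2 by rewrite divr_gt0.
  have [S1 GS1 H1] := IH1 _ e2 _ GS0.
  have [S2 GS2 H2] := IH2 _ e2 _ (allt_tmul GS1 GS0).
  exists (tmul S2 S1); first exact: allt_tmul.
  move=> S3 GS3 /=; rewrite -tmulA.
  rewrite [X in _ - complex.Re X](mean_add f1 f2).
  rewrite [X in complex.Re X - _](mean_add (fun x => f1 (u * x)%g) (fun x => f2 (u * x)%g)).
  rewrite !raddfD /=.
  have := H2 S3 GS3; have := H1 (tmul S3 S2) (allt_tmul GS3 GS2).
  rewrite -!tmulA /= !ler_norml => /andP[a b] /andP[a' b'].
  by apply/andP; split; lra.
(* The weight makes del * nrm Y at most eps / 2. The bound eps * del / 12 below, taken twice and
   multiplied by the 3 of [nrmD3], makes the other term at most eps / 2; the third summand there is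
   0. *)
pose del := eps / 2 / (1 + nrm Y).
have Y1 : 0 < 1 + nrm Y by rewrite ltr_pwDl ?nrm_ge0.
have del0 : 0 < del by rewrite !divr_gt0.
have [z zG /(_ (eps * del / 12))[|S1 GS1 zS]] :=
    @average_intertwiner _ _ G _ _ (mean (fun x => act x X) S0).
  by apply: divr_gt0 => //; apply: mulr_gt0.
exists S1 => // S2 GS2 /=; rewrite -raddfB !mean_ip mean_act !mean_act_tmul /=.
set w := mean _ S1 in zS *; set A := mean _ S2.
have zA := nrm_mean_act w zG GS2; rewrite -/A in zA.
have -> : ip Y (act u A) - ip Y A = ip Y (act u (A - z) + (z - A) + 0).
  by rewrite addr0 actB (ufix _ _ z) // addrA addrNK addrC -scaleN1r ip_linr mulN1r addrC.
apply: le_trans (Re_ip_le _ _ del0) _.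
have := nrmD3 (act u (A - z)) (z - A) 0.
rewrite nrm_act -[z - A]opprB nrmN opprB.
have -> : nrm (0 : tens R d r s) = 0.
  by rewrite /nrm big1 // => p _; rewrite ffunE /sqn /= expr0n /= addr0.
set W := nrm (_ + 0) => H.
have WP : W <= eps * del / 2 by lra.
have : del^-1 * W <= eps / 2.
  by rewrite mulrC ler_pdivrMr // mulrAC.
have : del * nrm Y <= eps / 2.
  rewrite /del mulrAC ler_pdivrMr // ler_pM2l ?divr_gt0 //.
  by rewrite lerDr.
by lra.
Qed.

Lemma Re_mean_ge (f : U -> C) a S :
  (forall g, G g -> a <= complex.Re (f g)) -> allt G S ->
  a <= complex.Re (mean (f : U -> C^o) S).
Proof.
move=> fa; elim: S => [g /fa //|t1 IH1 t2 IH2] /= [/IH1 + /IH2].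
set x := mean _ t1; set y := mean _ t2 => xa ya.
have -> : complex.Re (2^-1 *: (x + y) : C^o) = 2^-1 * (complex.Re x + complex.Re y).
  have -> : 2^-1 *: (x + y) = ((2^-1 : R)%:C)%C * (x + y).
    by rewrite fmorphV rmorph_nat.
  by case: (x) (y) => a1 b1 [a2 b2]; simpc.
by lra.
Qed.

Lemma geometric_dominates (n : nat) (a b : R) : 0 <= a -> a < b ->
  exists N, n%:R * a ^+ N < b ^+ N.
Proof.
move=> a0 ab; have b0 : 0 < b by apply: le_lt_trans ab.
have ab_ge0 : 0 <= a / b by apply: divr_ge0 => //; apply: ltW.
have ab1 : `|a / b| < 1 by rewrite ger0_norm // ltr_pdivrMr // mul1r.
have e0 : (0 : R) < n.+1%:R^-1 by rewrite invr_gt0 ltr0n.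
have /cvgrPdist_lt/(_ _ e0)[N _ /(_ N (leqnn _))] := cvg_expr ab1.
rewrite /= sub0r normrN ger0_norm ?exprn_ge0 // => H.
exists N; rewrite -[ltRHS]mul1r -ltr_pdivrMr ?exprn_gt0 // -mulrA -expr_div_n.
apply: (@le_lt_trans _ _ (n.+1%:R * (a / b) ^+ N)).
  by rewrite ler_wpM2r ?exprn_ge0 // ler_nat.
by rewrite mulrC -ltr_pdivlMr ?ltr0n // mul1r.
Qed.

(* If u is not in G, a sum of powers of the kernels [kern g], g in a fine net
   of G, separates G from uG, which no average over G can then equalize. *)
Theorem intertwiners_determine u :
  (forall r s (t : tens R d r s), intertwiner G t ->
    tcomp (upow u s) t = tcomp t (upow u r)) -> G u.
Proof.
(* For d = 0 the only unitary is 1; the kernels below need d > 0 for their normalization by 4 d. *)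
move=> ut; have [d0|d0] := posnP d.
  suff -> : u = 1%g by apply: cg1.
  by apply/uvalI/matrixP => i; have := ltn_ord i; rewrite [X in (_ < X)%N]d0.
apply: contrapT => Gu.
have u_pos g : G g -> 0 < hs u g.
  move=> Gg; rewrite lt_neqAle hs_ge0 andbT eq_sym; apply/eqP => /hs_eq0/uvalI e.
  by apply: Gu; rewrite e.
(* The points of G are at a distance from u bounded below by some D: radii proportional to [hs u g]
   let a finite net control all of G through [hs_triangle]. *)
have [s [sG sP]] : exists s : seq U, (forall g, g \in s -> G g) /\
    forall x, G x -> exists2 g, g \in s & hs x g < hs u g / 16.
  by apply: hs_net => g /u_pos H; rewrite divr_gt0.
have [D D0 DP] : exists2 D, 0 < D & forall g, g \in s -> D <= hs u g / 4.
  elim: s sG {sP} => [|g s IH] sG; first by exists 1.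
  have [|D D0 DP] := IH; first by move=> h hs; apply: sG; rewrite inE hs orbT.
  exists (Num.min D (hs u g / 4)).
    by rewrite lt_min D0 divr_gt0 //; apply/u_pos/sG/mem_head.
  move=> h; rewrite inE ge_min => /predU1P[->|/DP->] //.
  by rewrite lexx orbT.
have DG x : G x -> D <= hs u x.
  move=> /sP[g gs xg]; have := DP g gs; have := hs_triangle u x g.
  by have := hs_ge0 u g; lra.
have [|s2 [s2G s2P]] := @hs_net (fun=> D / 4); first by move=> _ _; lra.
have d4 : (0 : R) < 4 * d%:R by rewrite mulr_gt0 ?ltr0n.
(* [q1] bounds from below the kernel at a net point within D / 4, and [q2] bounds from above any
   kernel at distance at least D. Raising to the power [N] beats the number of net points. *)
pose q1 := 1 - D / 4 / (4 * d%:R); pose q2 := 1 - D / (4 * d%:R).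
have q2_ge0 : 0 <= q2.
  by rewrite subr_ge0 ler_pdivrMr // mul1r (le_trans (DG _ (cg1 G))) // hs_le4.
have q12 : q2 < q1.
  rewrite ltrD2l ltrN2 ltr_pM2r ?invr_gt0 //; lra.
have [N HN] := geometric_dominates (size s2) q2_ge0 q12.
pose f (x : U) : C := \sum_(g <- s2) ((kern g x)%:C)%C ^+ N.
have fE x : f x = ((\sum_(g <- s2) kern g x ^+ N)%:C)%C.
  by rewrite raddf_sum; apply: eq_bigr => g _; rewrite /= rmorphXn.
have kern_ge0 (g x : U) : 0 <= kern g x.
  by rewrite /kern subr_ge0 ler_pdivrMr // mul1r hs_le4.
have f_ge x : G x -> q1 ^+ N <= complex.Re (f x).
  move=> /s2P[g gs xg]; rewrite fE /= (big_rem g) //=.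
  rewrite -[X in X <= _]addr0; apply: lerD; last first.
    by apply: sumr_ge0 => h _; apply: exprn_ge0.
  apply: lerXn2r; rewrite ?nnegrE //; first by apply: le_trans (ltW q12).
  by rewrite lerD2l lerN2 ler_pM2r ?invr_gt0 // ltW.
have fu_le x : G x -> complex.Re (f (u * x)%g) <= (size s2)%:R * q2 ^+ N.
  move=> Gx; rewrite fE /=.
  have -> : (size s2)%:R * q2 ^+ N = \sum_(g <- s2) q2 ^+ N.
    by rewrite big_const_seq count_predT iter_addr_0 mulr_natl.
  rewrite !big_seq; apply: ler_sum => g gs; apply: lerXn2r; rewrite ?nnegrE //.
  rewrite lerD2l lerN2 ler_pM2r ?invr_gt0 //.
  (* By right invariance this is the distance from u to g x^-1, an element of G. *)
  have -> : hs (u * x)%g g = hs (u * x)%g ((g * x^-1) * x)%g by rewrite -mulgA mulVg mulg1.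
  by rewrite hs_mulr DG //; apply: cgM; [apply: s2G | apply: cgV].
have cf : coef f by apply: coef_sum => g; apply/coef_pow/coef_kern.
have uact r s' (t : tens R d r s') : intertwiner G t -> act u t = t.
  by move=> /ut H; apply/act_fixed.
pose eps := (q1 ^+ N - (size s2)%:R * q2 ^+ N) / 2.
have eps0 : 0 < eps by rewrite divr_gt0 // subr_gt0.
have [|S1 GS1] := coef_averageable uact cf eps0 (S0 := Leaf 1%g); first exact: cg1.
move=> /(_ (Leaf 1%g) (cg1 _)) /=; set S := tmul _ _ => H.
have GS : allt G S.
  by apply: allt_tmul; [exact: cg1 | apply: allt_tmul => //; exact: cg1].
have := Re_mean_ge f_ge GS.
have : - ((size s2)%:R * q2 ^+ N) <=
    complex.Re (mean (fun x => - f (u * x)%g : C^o) S).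
  by apply: Re_mean_ge GS => g Gg; rewrite raddfN lerN2 fu_le.
rewrite (@mean_linear _ _ C^o C^o (fun x => - x) (fun x => f (u * x)%g)); last first.
  by move=> a x y; rewrite opprD scalerN.
rewrite raddfN /= lerN2; move: H; rewrite ler_norml => /andP[].
by rewrite /eps; lra.
Qed.

End Tannaka.

(** * Uniqueness of the embedding *)

Section Orthogonal.
Variables (R : realType) (d : nat) (G : csubgroup R d).
Local Notation C := R[i].
Local Notation tens := (tens R d).

(** The kernel of the average over G. [negligible_orth] and [orth_negligible] identify it with the
    tensors having arbitrarily small tree averages. *)
Definition orth r s (W : tens r s) := forall z : tens r s, intertwiner G z -> ip z W = 0.

Lemma ip0r r s (z : tens r s) : ip z 0 = 0.
Proof. by rewrite /ip big1 // => p _; rewrite ffunE mulr0. Qed.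

Lemma orth_lin r s a (W W' : tens r s) : orth W -> orth W' -> orth (a *: W + W').
Proof. by move=> oW oW' z zG; rewrite ip_linr oW ?oW' // mulr0 addr0. Qed.

Lemma orth_intertwiner r s (z : tens r s) : intertwiner G z -> orth z -> z = 0.
Proof. by move=> zG /(_ z zG) z0; apply/nrm_eq0/complexI; rewrite nrmE z0. Qed.

Lemma ip_avg r s (z W : tens r s) S : intertwiner G z -> allt G S ->
  ip z (mean (fun g => act g W) S) = ip z W.
Proof.
move=> zG; elim: S => [g Gg|t1 IH1 t2 IH2] /=.
  rewrite -{1}(iffRL (act_fixed _ _) (zG g Gg)) /act -!upowV.
  rewrite ip_compr ip_compl -!upowV !tcompA invgK -upowM -!tcompA -upowM !mulVg !upow1.
  by rewrite tcompf1 tcomp1f.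
move=> [/IH1 + /IH2]; set x := mean _ t1; set y := mean _ t2 => xW yW.
rewrite -[_ *: _]addr0 ip_linr ip0r addr0 -[x]scale1r ip_linr mul1r xW yW.
by field.
Qed.

Lemma negligible_orth r s (W : tens r s) :
  (forall eps : R, 0 < eps -> exists2 S, allt G S &
     nrm (mean (fun g => act g W) S) <= eps) -> orth W.
Proof.
move=> small z zG; apply/sqn_eq0/eqP; rewrite eq_le sqn_ge0 andbT leNgt.
set c := ip z W; apply/negP => c0.
(* Rescaling z by c turns the pairing with W into the real number |c|^2, unchanged by averaging W;
   the weight [del] bounds it by |c|^2 / 4 + |c|^2 / 4. *)
have zcG : intertwiner G (c *: z).
  rewrite -[c *: z]addr0; exact: (@wP_lin _ _ (intertwiner_wide G)) zG (wP0 _ _ _).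
pose del := sqn c / 4 / (1 + nrm (c *: z)).
have Y1 : 0 < 1 + nrm (c *: z) by rewrite ltr_pwDl ?nrm_ge0.
have del0 : 0 < del by rewrite !divr_gt0.
have [|S GS HS] := small (sqn c / 4 * del); first by rewrite mulr_gt0 ?divr_gt0.
have := Re_ip_le (c *: z) (mean (fun g => act g W) S) del0.
rewrite ip_avg // (_ : ip (c *: z) W = ((sqn c)%:C)%C); last first.
  rewrite sqnE {3}/c /ip mulr_sumr; apply: eq_bigr => p _.
  by rewrite ffunE rmorphM mulrA.
rewrite /= ger0_norm ?sqn_ge0 // => H.
have : del^-1 * nrm (mean (fun g => act g W) S) <= sqn c / 4.
  by rewrite mulrC ler_pdivrMr.
have : del * nrm (c *: z) <= sqn c / 4.
  by rewrite /del mulrAC ler_pdivrMr // ler_pM2l ?divr_gt0 // lerDr.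
by lra.
Qed.

Lemma orth_projection r s (X : tens r s) :
  exists2 z, intertwiner G z & orth (X - z) /\
    forall eps : R, 0 < eps -> exists2 S, allt G S &
      nrm (mean (fun g => act g X) S - z) <= eps.
Proof.
have [z zG Hz] := @average_intertwiner _ _ G _ _ X.
exists z => //; split=> //; apply: negligible_orth => eps eps0.
have [S GS HS] := Hz _ eps0; exists S => //.
suff -> : mean (fun g => act g (X - z)) S = mean (fun g => act g X) S - z by [].
elim: S GS {HS} => [g Gg|t1 IH1 t2 IH2] /=.
  by rewrite actB (iffRL (act_fixed _ _) (zG g Gg)).
move=> [/IH1-> /IH2->]; rewrite addrACA -opprD scalerBr; congr (_ - _).
by rewrite -mulr2n -scalerMnr -scaler_nat scalerA divff ?scale1r // pnatr_eq0.
Qed.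

Lemma orth_negligible r s (W : tens r s) : orth W ->
  forall eps : R, 0 < eps -> exists2 S, allt G S &
     nrm (mean (fun g => act g W) S) <= eps.
Proof.
move=> oW eps eps0; have [z zG [oWz Hz]] := orth_projection W.
suff z0 : z = 0.
  by have [S GS] := Hz _ eps0; rewrite z0 subr0; exists S.
apply: orth_intertwiner zG _; rewrite -[z](subKr W) -scaleN1r addrC.
exact: orth_lin.
Qed.

Lemma nrm_ttens r s r' s' (X : tens r s) (Y : tens r' s') :
  nrm (ttens X Y) = nrm X * nrm Y.
Proof. by apply: complexI; rewrite nrmE ip_ttens -!nrmE rmorphM. Qed.

(** Clear from small averages, since averaging commutes with the tensor product with an identity. It
    is not visible in the definition: not every intertwiner between the larger powers is such a
    product. *)
Lemma orth_ttens t r s (W : tens r s) : orth W -> orth (ttens (tid R d t) W).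
Proof.
move=> oW; apply: negligible_orth => eps eps0.
pose K := 1 + nrm (tid R d t).
have K0 : 0 < K by rewrite ltr_pwDl ?nrm_ge0.
have [|S GS HS] := orth_negligible oW (eps := eps / K); first by rewrite divr_gt0.
exists S => //.
have -> : mean (fun g => act g (ttens (tid R d t) W)) S =
    ttens (tid R d t) (mean (fun g => act g W) S).
  rewrite -(@mean_linear _ _ _ _ (ttens (tid R d t))) => [|a X Y].
    by apply: eq_mean => g; rewrite act_ttens act_tid.
  exact: ttens_linr.
rewrite nrm_ttens; move: HS; rewrite ler_pdivlMr // mulrC; apply: le_trans.
by apply: ler_wpM2r; rewrite ?nrm_ge0 // lerDr.
Qed.

Lemma orth_compl r s t (z : tens s t) (W : tens r s) :
  intertwiner G z -> orth W -> orth (tcomp z W).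
Proof.
move=> zG oW y yG; rewrite -[z]tstarK -ip_compl; apply: oW.
exact: (@wP_comp _ _ (intertwiner_wide G)) ((@wP_star _ _ (intertwiner_wide G)) _ _ _ zG) yG.
Qed.

Lemma orth_compr r s t (z : tens t r) (W : tens r s) :
  intertwiner G z -> orth W -> orth (tcomp W z).
Proof.
move=> zG oW y yG; rewrite -[z]tstarK -ip_compr; apply: oW.
exact: (@wP_comp _ _ (intertwiner_wide G)) yG ((@wP_star _ _ (intertwiner_wide G)) _ _ _ zG).
Qed.

End Orthogonal.

(** * Multi-indices, matrix units and transpositions of factors *)

Section Indices.
Variable R : realType.
Local Notation C := R[i].

(** Induction on length for all [f] at once: moving a letter to the front and fixing it leaves a
    function of shorter words of the same kind. *)
Lemma eq_perm_of_swaps (T : eqType) (V : Type) (f : seq T -> V) :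
  (forall s a b t, f (s ++ a :: b :: t) = f (s ++ b :: a :: t)) ->
  forall s t, perm_eq s t -> f s = f t.
Proof.
move=> fswap s t; have [n] := ubnP (size s).
elim: n f fswap s t => // n IH f fswap [|x s] t ns st.
  by have /perm_nilP -> : perm_eq t [::] by rewrite perm_sym.
have front t1 t2 : f (t1 ++ x :: t2) = f (x :: t1 ++ t2).
  elim/last_ind: t1 t2 => //= t1 y IHt t2.
  by rewrite cat_rcons fswap IHt cat_rcons.
have xt : x \in t by rewrite -(perm_mem st) mem_head.
case/splitPr: xt st => t1 t2 st; rewrite front.
apply: (IH (fun u => f (x :: u))) => [u a b v||]; last 1 first.
- by rewrite -(perm_cons x) (perm_trans st) // -cat1s perm_catCA.
- exact: (fswap (x :: u)).
- by rewrite -ltnS.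
Qed.

Definition midx_of n (x0 : 'I_n) r (a : seq 'I_n) : midx n r := [ffun k : 'I_r => nth x0 a k].

Lemma midx_of_cat n (x0 : 'I_n) r s a b : size a = r ->
  midx_of x0 (r + s) (a ++ b) = mjoin (midx_of x0 r a) (midx_of x0 s b).
Proof.
move=> ar; apply/ffunP => k; rewrite !ffunE nth_cat ar.
by case: split_ordP => j ->; rewrite ffunE //= addKn.
Qed.

Lemma midx_of_cons n (x0 x : 'I_n) r a :
  midx_of x0 (1 + r) (x :: a) = mjoin [ffun _ : 'I_1 => x] (midx_of x0 r a).
Proof.
rewrite -cat1s midx_of_cat //; congr mjoin.
by apply/ffunP => k; rewrite !ffunE (ord1 k).
Qed.

Lemma midx_of_enum n (x0 : 'I_n) r (i : midx n r) : midx_of x0 r [seq i k | k <- enum 'I_r] = i.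
Proof.
apply/ffunP => k; rewrite ffunE (nth_map k) ?size_enum_ord //.
by rewrite nth_ord_enum.
Qed.

Definition unitt n r s (i : midx n s) (k : midx n r) : tens R n r s :=
  [ffun p => ((p.1 == i) && (p.2 == k))%:R].

Lemma unittE n r s (i j : midx n s) (k l : midx n r) :
  unitt i k (j, l) = ((j == i) && (l == k))%:R.
Proof. by rewrite ffunE. Qed.

Definition tswap n a b : tens R n (a + (1 + 1 + b)) (a + (1 + 1 + b)) :=
  ttens (tid R n a) (ttens (tflip R n 1 1) (tid R n b)).

Definition swapidx n a b (i : midx n (a + (1 + 1 + b))) : midx n (a + (1 + 1 + b)) :=
  mjoin (lpart i) (mjoin (mjoin (rpart (lpart (rpart i))) (lpart (lpart (rpart i))))
    (rpart (rpart i))).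

Lemma swapidxK n a b : involutive (@swapidx n a b).
Proof.
by move=> i; rewrite /swapidx !(lpart_join, rpart_join) !join_part.
Qed.

Lemma tswapE n a b j (i : midx n (a + (1 + 1 + b))) :
  tswap n a b (j, i) = (j == swapidx i)%:R.
Proof.
rewrite !ttensE !ffunE /= -!natrM !mulnb /swapidx.
by rewrite [in RHS]part_eq [in RHS](part_eq (rpart j)) [in RHS](part_eq (lpart _))
  !(lpart_join, rpart_join) !andbA.
Qed.

Lemma tcomp_tswapl n a b r (f : tens R n r (a + (1 + 1 + b))) j k :
  tcomp (tswap n a b) f (j, k) = f (swapidx j, k).
Proof.
rewrite ffunE /= (bigD1 (swapidx j)) //= big1 => [|i ij].
  by rewrite tswapE swapidxK eqxx mul1r addr0.
rewrite tswapE [_ == _](_ : _ = false) ?mul0r //.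
by apply/eqP => e; rewrite e swapidxK eqxx in ij.
Qed.

Lemma tcomp_tswapr n a b s (f : tens R n (a + (1 + 1 + b)) s) j k :
  tcomp f (tswap n a b) (j, k) = f (j, swapidx k).
Proof.
rewrite ffunE /= (bigD1 (swapidx k)) //= big1 => [|i ik].
  by rewrite tswapE eqxx mulr1 addr0.
by rewrite tswapE (negPf ik) mulr0.
Qed.

Lemma midx_of_swap n (x0 : 'I_n) s a b t :
  midx_of x0 (size s + (1 + 1 + size t)) (s ++ a :: b :: t) =
  swapidx (midx_of x0 (size s + (1 + 1 + size t)) (s ++ b :: a :: t)).
Proof.
rewrite /swapidx !midx_of_cat // !(lpart_join, rpart_join).
rewrite -[a :: b :: t]/([:: a; b] ++ t) -[b :: a :: t]/([:: b; a] ++ t).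
rewrite ![midx_of _ _ ([:: _; _] ++ t)]midx_of_cat // !(lpart_join, rpart_join).
congr (mjoin _ (mjoin _ _)).
rewrite -[[:: a; b]]/([:: a] ++ [:: b]) -[[:: b; a]]/([:: b] ++ [:: a]).
by rewrite !midx_of_cat // !(lpart_join, rpart_join).
Qed.

Lemma unitt_swapl n a b r (i : midx n (a + (1 + 1 + b))) (k : midx n r) :
  unitt (swapidx i) k = tcomp (tswap n a b) (unitt i k).
Proof.
apply: tensP => j l; rewrite tcomp_tswapl !ffunE /=; congr (_ && _)%:R.
by rewrite -(inj_eq (can_inj (@swapidxK n a b))) swapidxK.
Qed.

Lemma unitt_swapr n a b s (i : midx n s) (k : midx n (a + (1 + 1 + b))) :
  unitt i (swapidx k) = tcomp (unitt i k) (tswap n a b).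
Proof.
apply: tensP => j l; rewrite tcomp_tswapr !ffunE /=; congr (_ && _)%:R.
by rewrite -(inj_eq (can_inj (@swapidxK n a b))) swapidxK.
Qed.

Lemma tswap_intertwiner n (G : csubgroup R n) a b : intertwiner G (tswap n a b).
Proof.
have id r := wP_id (intertwiner_wide G) r.
exact: (wP_ta (id a) (wP_ta (wP_sy (intertwiner_wide G) 1%N 1%N) (id b))).
Qed.

(** Otherwise the real parts would show that R is countable, hence a null set for Lebesgue
    measure. *)
Lemma uncountable_complex (f : nat -> seq C) : exists c, forall k, c \notin f k.
Proof.
apply: contrapT => /forallNP H.
have : countable [set: R]%classic.
  pose g k := [set` [seq complex.Re c | c <- f k]]%classic.
  have -> : [set: R]%classic = (\bigcup_k g k)%classic.
    apply/seteqP; split=> // x _; have /existsNP[k /negP/negPn xk] := H (x%:C)%C.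
    exists k => //=; apply/mapP; exists (x%:C)%C => //.
  apply: bigcup_countable => // k _; apply: finite_set_countable.
  by apply/finite_seqP; eexists.
move=> /countable_lebesgue_measure0; rewrite -set_itvNyy lebesgue_measure_itv.
by [].
Qed.

End Indices.

Import UncountableNullstellensatz.

(** * A common point of the two realizations *)

Section Correspondence.
Variables (R : realType) (d : nat) (G : csubgroup R d) (h : nat).
Local Notation C := R[i].

(* The graph of a linear map from the intertwiners of G to operators between
   the tensor powers of an h-dimensional space that is compatible with the
   symmetry and with the left tensor product with the identity. *)
Record corr (Rel : forall r s, tens R d r s -> tens R h r s -> Prop) : Prop := Corr {
  corr_lin : forall r s a (p p' : tens R d r s) q q',
    Rel r s p q -> Rel r s p' q' -> Rel r s (a *: p + p') (a *: q + q');
  corr_ex : forall r s (p : tens R d r s), intertwiner G p -> exists q, Rel r s p q;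
  corr_int : forall r s p q, Rel r s p q -> intertwiner G p;
  corr_fun : forall r s q, Rel r s 0 q -> q = 0;
  corr_unit : Rel 0 0 (tid R d 0) (tid R h 0);
  corr_tid : forall r s p q, Rel r s p q ->
    Rel (1 + r)%N (1 + s)%N (ttens (tid R d 1) p) (ttens (tid R h 1) q);
  corr_swapl : forall r a b p q, Rel r (a + (1 + 1 + b))%N p q ->
    Rel _ _ (tcomp (tswap R d a b) p) (tcomp (tswap R h a b) q);
  corr_swapr : forall s a b p q, Rel (a + (1 + 1 + b))%N s p q ->
    Rel _ _ (tcomp p (tswap R d a b)) (tcomp q (tswap R h a b))
}.

(** An entry of the r-th tensor power of [w]. *)
Definition wpow (w : 'M[C]_(h, d)) r (j : midx h r) (i : midx d r) : C :=
  \prod_k w (j k) (i k).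

Section Functional.
Variables (Rel : forall r s, tens R d r s -> tens R h r s -> Prop) (Rc : corr Rel).
Arguments Rel {r s}.

Lemma Efun_ex r s (X : tens R d r s) :
  exists q, exists2 p, Rel p q & orth G (X - p).
Proof.
have [p pG [oXp _]] := orth_projection G X.
by have [q pq] := corr_ex Rc pG; exists q, p.
Qed.

(* The orthogonal projection to the intertwiners, followed by the map with
   graph Rel. *)
Definition Efun r s (X : tens R d r s) : tens R h r s := projT1 (cid (Efun_ex X)).

(** Two candidates p differ by an intertwiner orthogonal to all intertwiners, hence by 0; [corr_fun]
    then identifies their images. *)
Lemma EfunP r s (X : tens R d r s) q :
  (exists2 p, Rel p q & orth G (X - p)) -> Efun X = q.
Proof.
rewrite /Efun; case: cid => q' [p' pq' o'] [p pq o] /=.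
have pp : p' - p = 0.
  apply: (@orth_intertwiner _ _ G).
    by rewrite addrC -scaleN1r; exact: (corr_int Rc (corr_lin Rc (-1) pq pq')).
  rewrite (_ : _ - _ = (-1) *: (X - p') + (X - p)).
    exact: orth_lin.
  by rewrite scaleN1r opprB addrA addrNK.
have := corr_lin Rc (-1) pq pq'; rewrite !scaleN1r ![- _ + _]addrC pp.
by move=> /(corr_fun Rc)/eqP; rewrite subr_eq0 => /eqP.
Qed.

Lemma Efun_spec r s (X : tens R d r s) : exists2 p, Rel p (Efun X) & orth G (X - p).
Proof. by rewrite /Efun; case: cid. Qed.

Lemma Efun_lin r s a (X Y : tens R d r s) : Efun (a *: X + Y) = a *: Efun X + Efun Y.
Proof.
have [p pX oX] := Efun_spec X; have [q qY oY] := Efun_spec Y.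
apply: EfunP; exists (a *: p + q); first exact: corr_lin.
rewrite (_ : _ - _ = a *: (X - p) + (Y - q)); first exact: orth_lin.
by rewrite scalerBr opprD addrACA.
Qed.

Lemma Efun0 r s : Efun (0 : tens R d r s) = 0.
Proof. by have := Efun_lin (-1) (0 : tens R d r s) 0; rewrite scaler0 addr0 scaleN1r addNr. Qed.

Lemma Efun_sum r s (I : Type) (t : seq I) (a : I -> C) (X : I -> tens R d r s) :
  Efun (\sum_(i <- t) a i *: X i) = \sum_(i <- t) a i *: Efun (X i).
Proof.
elim: t => [|i t IH]; rewrite ?big_nil ?Efun0 // !big_cons.
by rewrite Efun_lin IH.
Qed.

Lemma tcompB r s t (f : tens R d s t) (g g' : tens R d r s) :
  tcomp f (g - g') = tcomp f g - tcomp f g'.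
Proof. by rewrite addrC -scaleN1r tcomp_linr scaleN1r addrC. Qed.

Lemma tcompBl r s t (f f' : tens R d s t) (g : tens R d r s) :
  tcomp (f - f') g = tcomp f g - tcomp f' g.
Proof. by rewrite addrC -scaleN1r tcomp_linl scaleN1r addrC. Qed.

Lemma Efun_compl r s t (p : tens R d s t) (q : tens R h s t) (X : tens R d r s) :
  intertwiner G p ->
  (forall p' q', @Rel r s p' q' -> Rel (tcomp p p') (tcomp q q')) ->
  Efun (tcomp p X) = tcomp q (Efun X).
Proof.
move=> pG pq; have [p' p'X oX] := Efun_spec X.
by apply: EfunP; exists (tcomp p p'); [apply: pq | rewrite -tcompB; apply: orth_compl].
Qed.

Lemma Efun_compr r s t (p : tens R d t r) (q : tens R h t r) (X : tens R d r s) :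
  intertwiner G p ->
  (forall p' q', @Rel r s p' q' -> Rel (tcomp p' p) (tcomp q' q)) ->
  Efun (tcomp X p) = tcomp (Efun X) q.
Proof.
move=> pG pq; have [p' p'X oX] := Efun_spec X.
by apply: EfunP; exists (tcomp p' p); [apply: pq | rewrite -tcompBl; apply: orth_compr].
Qed.

Lemma Efun_tid r s (X : tens R d r s) :
  Efun (ttens (tid R d 1) X) = ttens (tid R h 1) (Efun X).
Proof.
have [p pX oX] := Efun_spec X; apply: EfunP; exists (ttens (tid R d 1) p).
  exact: corr_tid.
rewrite (_ : _ - _ = ttens (tid R d 1) (X - p)); first exact: orth_ttens.
by rewrite [X - p]addrC -[- p]scaleN1r ttens_linr scaleN1r addrC.
Qed.

Variables (j0 : 'I_h) (i0 : 'I_d).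
Local Notation L := ('I_h * 'I_d)%type.

(** In the heuristic picture, the integral over x in vG of the product of the x_ji for (j, i) in [a]
    and of the conjugates of the x_ji for (j, i) in [b]. *)
Definition word_entry s r (a b : seq L) : C :=
  Efun (unitt R (midx_of i0 s (unzip2 a)) (midx_of i0 r (unzip2 b)))
    (midx_of j0 s (unzip1 a), midx_of j0 r (unzip1 b)).

(** A transposition of factors is an intertwiner that [Rel] carries to the same transposition in
    dimension h, so permuting upper and lower indices together changes nothing. *)
Lemma word_entry_swapl s x y t r b :
  word_entry (size s + (1 + 1 + size t)) r (s ++ x :: y :: t) b =
  word_entry (size s + (1 + 1 + size t)) r (s ++ y :: x :: t) b.
Proof.
rewrite /word_entry /unzip1 /unzip2 !map_cat !map_cons.
have := midx_of_swap i0 [seq k.2 | k <- s] x.2 y.2 [seq k.2 | k <- t].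
have := midx_of_swap j0 [seq k.1 | k <- s] x.1 y.1 [seq k.1 | k <- t].
rewrite !size_map => -> ->; rewrite unitt_swapl (@Efun_compl _ _ _ _ (tswap R h (size s) (size t))).
- by rewrite tcomp_tswapl swapidxK.
- exact: tswap_intertwiner.
- exact: corr_swapl.
Qed.

Lemma word_entry_swapr s x y t r b :
  word_entry r (size s + (1 + 1 + size t)) b (s ++ x :: y :: t) =
  word_entry r (size s + (1 + 1 + size t)) b (s ++ y :: x :: t).
Proof.
rewrite /word_entry /unzip1 /unzip2 !map_cat !map_cons.
have := midx_of_swap i0 [seq k.2 | k <- s] x.2 y.2 [seq k.2 | k <- t].
have := midx_of_swap j0 [seq k.1 | k <- s] x.1 y.1 [seq k.1 | k <- t].
rewrite !size_map => -> ->; rewrite unitt_swapr (@Efun_compr _ _ _ _ (tswap R h (size s) (size t))).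
- by rewrite tcomp_tswapr swapidxK.
- exact: tswap_intertwiner.
- exact: corr_swapr.
Qed.

(* The letters (true, (j, i)) and (false, (j, i)) stand for the entries w_ji and
   y_ji of the matrices of [corr_point_of]. *)
Local Notation T := (bool * L)%type.
Definition letters (c : bool) (w : seq T) : seq L := [seq x.2 | x <- w & x.1 == c].
Definition word_form (w : seq T) : C :=
  word_entry (size (letters true w)) (size (letters false w)) (letters true w) (letters false w).

Lemma word_form_perm s t : perm_eq s t -> word_form s = word_form t.
Proof.
apply: eq_perm_of_swaps => {}s [b x] [c y] {}t.
rewrite /word_form /letters !filter_cat !map_cat /=.
(* Letters of different kinds are already separated by [letters]; equal kinds are left to the two
   swap lemmas. *)
case: b c => -[] //=; rewrite !size_cat /=.
  exact: word_entry_swapl.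
exact: word_entry_swapr.
Qed.

Lemma letters_cat c u v : letters c (u ++ v) = letters c u ++ letters c v.
Proof. by rewrite /letters filter_cat map_cat. Qed.

Lemma Efun_unit : Efun (tid R d 0) = tid R h 0.
Proof.
apply: EfunP; exists (tid R d 0); first exact: corr_unit.
by rewrite subrr => z _; apply: ip0r.
Qed.

Lemma word_form_nil : word_form [::] != 0.
Proof.
rewrite /word_form /word_entry /= (_ : unitt _ _ _ = tid R d 0); last first.
  by apply: tensP => j i; rewrite !ffunE /= !midx0.
by rewrite Efun_unit ffunE /= midx0 oner_eq0.
Qed.

(** With [Efun_tid], this is the source of w y^T = 1. *)
Lemma sum_unitt_tid r s (I : midx d s) (K : midx d r) :
  \sum_(i < d) 1 *: unitt R (mjoin [ffun _ : 'I_1 => i] I) (mjoin [ffun _ : 'I_1 => i] K) =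
  ttens (tid R d 1) (unitt R I K).
Proof.
have one (a : midx d 1) i : (a == [ffun=> i]) = (a ord0 == i).
  apply/eqP/eqP => [->|e]; first by rewrite ffunE.
  by apply/ffunP => k; rewrite ffunE (ord1 k).
apply: tensP => j k; rewrite sum_ffunE ttensE.
under eq_bigr => i _ do rewrite scale1r ffunE /= part_eq [k == _]part_eq
  !lpart_join !rpart_join !one.
rewrite (bigD1 (lpart k ord0)) //= big1 => [|i /negPf ik]; last first.
  by rewrite [_ == i in X in _ && X]eq_sym ik andbF.
rewrite addr0 eqxx /= !ffunE /= -natrM mulnb; congr (_%:R).
rewrite -andbA; congr (_ && _).
apply/eqP/eqP => [e|/(congr1 (fun a : midx d 1 => a ord0))]; last by rewrite !ffunE.
by apply/ffunP => t; rewrite (ord1 t) !ffunE.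
Qed.

Lemma sum_unitt_tens r s t m (p : tens R d r s) (i : midx d r) (I : midx d m) (K : midx d t) :
  \sum_k p (k, i) *: unitt R (mjoin k I) K =
  tcomp (ttens p (tid R d m)) (unitt R (mjoin i I) K).
Proof.
apply: tensP => j l; rewrite sum_ffunE ffunE /=.
rewrite (bigD1 (mjoin i I)) //= [X in _ = _ + X]big1 ?addr0; last first.
  by move=> k /negPf ki; rewrite unittE ki mulr0.
rewrite ttensE unittE lpart_join rpart_join eqxx /= [tid _ _ _ _]ffunE /=.
rewrite (bigD1 (lpart j)) //= [X in _ + X]big1 ?addr0; last first.
  move=> k /negPf kj; rewrite ffunE unittE part_eq lpart_join eq_sym kj /=.
  exact: mulr0.
rewrite ffunE unittE part_eq lpart_join rpart_join eqxx /= -mulrA -natrM mulnb.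
by [].
Qed.

(** Both conclusions are polynomial identities, read off at a zero of the ideal. Compatibility with
    composition is asked for one pair p, q at a time, as [corr] alone does not provide it; w y^T = 1
    holds without it. *)
Lemma corr_point_of : exists w y : 'M[C]_(h, d), w *m y^T = 1%:M /\
  forall r s p q, Rel p q ->
    (forall m t p' q', @Rel t (r + m)%N p' q' ->
      Rel (tcomp (ttens p (tid R d m)) p') (tcomp (ttens q (tid R h m)) q')) ->
    forall (j : midx h s) (i : midx d r),
      \sum_k wpow w j k * p (k, i) = \sum_l q (j, l) * wpow w l i.
Proof.
have [wf wfP] := symmetric_form_zero (@uncountable_complex R) word_form_perm word_form_nil.
exists (\matrix_(j, i) wf (true, (j, i))), (\matrix_(j, i) wf (false, (j, i))).
split=> [|r s p q pq H j i].
  apply/matrixP => j l; rewrite !mxE.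
  (* The polynomial sum_i w_ji y_li - delta_jl. Its product with a word is sent to an entry of the
     difference of the two sides of [Efun_tid]. *)
  pose f := [seq (1 : C, [:: (true, (j, i)); (false, (l, i))]) | i <- enum 'I_d] ++
    [:: (- (j == l)%:R, [::])].
  have := wfP f; rewrite big_cat /= big_seq1 big_map big_enum /= big_nil mulr1.
  move=> H; apply/eqP; rewrite -subr_eq0; apply/eqP.
  rewrite -[RHS]H; last first.
    move=> u; rewrite big_cat /= big_seq1 big_map big_enum /=.
    have lE i : word_form [:: (true, (j, i)), (false, (l, i)) & u] =
        word_entry (1 + size (letters true u)) (1 + size (letters false u))
          ((j, i) :: letters true u) ((l, i) :: letters false u) by [].
    under eq_bigr => i _ do
      rewrite lE /word_entry [unzip1 _]/= [unzip1 (_ :: _)]/= [unzip2 _]/= [unzip2 (_ :: _)]/= !midx_of_cons.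
    rewrite -/(word_form u) /word_form; set a := letters true u; set b := letters false u.
    set I := midx_of i0 _ (unzip2 a); set K := midx_of i0 _ (unzip2 b).
    set J := midx_of j0 _ (unzip1 a); set N := midx_of j0 _ (unzip1 b).
    transitivity ((\sum_(i < d) 1 *: Efun (unitt R (mjoin [ffun _ : 'I_1 => i] I)
        (mjoin [ffun _ : 'I_1 => i] K))) (mjoin [ffun _ : 'I_1 => j] J,
        mjoin [ffun _ : 'I_1 => l] N) - (j == l)%:R * Efun (unitt R I K) (J, N)).
      rewrite sum_ffunE mulNr; congr (_ - _); apply: eq_bigr => i _.
      by rewrite scale1r mul1r.
    rewrite -Efun_sum sum_unitt_tid Efun_tid ttensE ffunE /= !lpart_join !rpart_join.
    rewrite (_ : (_ == _) = (j == l)) ?subrr //.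
    apply/eqP/eqP => [/(congr1 (fun a : midx h 1 => a ord0))|->//].
    by rewrite !ffunE.
  by congr (_ - _); apply: eq_bigr => i _; rewrite !mxE big_cons big_seq1 mul1r.
pose wd t n (a : midx h t) (b : midx n t) := [seq (a k, b k) | k <- enum 'I_t].
have wd1 t n (a : midx h t) (b : midx n t) : unzip1 (wd _ _ a b) = [seq a k | k <- enum 'I_t].
  by rewrite /unzip1 -map_comp.
have wd2 t n (a : midx h t) (b : midx n t) : unzip2 (wd _ _ a b) = [seq b k | k <- enum 'I_t].
  by rewrite /unzip2 -map_comp.
pose word t (a : midx h t) (b : midx d t) : seq T := [seq (true, x) | x <- wd _ _ a b].
have lett t (a : midx h t) (b : midx d t) c : letters c (word _ a b) =
    if c then wd _ _ a b else [::].
  rewrite /letters /word; case: c; elim: (wd _ _ a b) => //= x u IH; by rewrite ?IH.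
have word_formE t (a : midx h t) (b : midx d t) u : word_form (word _ a b ++ u) =
    Efun (unitt R (mjoin b (midx_of i0 (size (letters true u)) (unzip2 (letters true u))))
         (midx_of i0 (size (letters false u)) (unzip2 (letters false u))))
      (mjoin a (midx_of j0 (size (letters true u)) (unzip1 (letters true u))),
         midx_of j0 (size (letters false u)) (unzip1 (letters false u))).
  rewrite /word_form !letters_cat !lett /= size_cat size_map size_enum_ord /word_entry.
  rewrite /unzip1 /unzip2 !map_cat -!/(unzip1 _) -!/(unzip2 _) wd1 wd2.
  by rewrite !midx_of_cat ?midx_of_enum // size_map -cardE card_ord.
have prodE t (a : midx h t) (b : midx d t) :
    \prod_(x <- word _ a b) wf x = wpow (\matrix_(j, i) wf (true, (j, i))) a b.
  by rewrite 2!big_map big_enum; apply: eq_bigr => k _; rewrite mxE.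
(* The difference of the two sides of the goal as a polynomial in w. Its multiples are annihilated
   because composing with p tensor 1 before [Efun] amounts to composing with q tensor 1 after it. *)
pose f := [seq (p (k, i), word _ j k) | k <- enum {: midx d s}] ++
  [seq (- q (j, l), word _ l i) | l <- enum {: midx h r}].
have := wfP f; rewrite big_cat /= [X in X + _]big_map [X in _ + X]big_map 2!big_enum /= => Hf.
apply/eqP; rewrite -subr_eq0; apply/eqP; rewrite -[RHS]Hf.
  rewrite -sumrN; congr (_ + _); apply: eq_bigr => k _; rewrite prodE ?mulNr //.
  by rewrite mulrC.
move=> u; rewrite big_cat /= [X in X + _]big_map [X in _ + X]big_map 2!big_enum /=.
pose I := midx_of i0 (size (letters true u)) (unzip2 (letters true u)).
pose K := midx_of i0 (size (letters false u)) (unzip2 (letters false u)).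
pose J := midx_of j0 (size (letters true u)) (unzip1 (letters true u)).
pose N := midx_of j0 (size (letters false u)) (unzip1 (letters false u)).
transitivity ((\sum_k p (k, i) *: Efun (unitt R (mjoin k I) K)) (mjoin j J, N) -
    \sum_l q (j, l) * Efun (unitt R (mjoin i I) K) (mjoin l J, N)).
  rewrite sum_ffunE -sumrN; congr (_ + _); apply: eq_bigr => k _; rewrite word_formE.
    by rewrite ffunE.
  by rewrite mulNr.
rewrite -Efun_sum sum_unitt_tens (@Efun_compl _ _ _ _ (ttens q (tid R h _))); last 2 first.
- exact: (wP_ta (w := intertwiner_wide G) (corr_int Rc pq) (wP_id (intertwiner_wide G) _)).
- by move=> *; apply: H.
apply/eqP; rewrite subr_eq0; apply/eqP; rewrite ffunE sum_join; apply: eq_bigr => l _.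
rewrite (bigD1 J) //= [X in _ + X]big1 ?addr0; last first.
  move=> k /negPf kJ; rewrite ttensE !lpart_join !rpart_join ffunE /=.
  by rewrite eq_sym kJ mulr0 mul0r.
by rewrite ttensE !lpart_join !rpart_join ffunE /= eqxx mulr1.
Qed.

End Functional.

End Correspondence.

(** * Equality of dimensions by antisymmetric tensors *)

Section Dimension.
Variable R : realType.
Local Notation C := R[i].

(** The unnormalized antisymmetrizer, the sum of all permutations of n factors with their signs. *)
Definition asym m n : tens R m n n :=
  [ffun x : midx m n * midx m n => \det (\matrix_(a < n, b < n) (x.1 a == x.2 b)%:R)].

Lemma prod_eq m n (k l : midx m n) : \prod_(a < n) (k a == l a)%:R = (k == l)%:R :> C.
Proof.
have [->|/eqP kl] := eqVneq k l; first by rewrite big1 // => a _; rewrite eqxx.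
case: (pickP (fun a => k a != l a)) => [a ka|E].
  by rewrite (bigD1 a) //= (negPf ka) mul0r.
by case: kl; apply/ffunP => a; apply/eqP; have := E a; case: eqP.
Qed.

(** Contraction with the antisymmetrizer produces the minors of [u]. The same minors arise from the
    other side in [asym_wpow], so antisymmetrizers commute with tensor powers. *)
Lemma wpow_asym m1 m2 (u : 'M[C]_(m1, m2)) n (j : midx m1 n) (i : midx m2 n) :
  \sum_k wpow u j k * asym m2 n (k, i) = \det (\matrix_(a < n, b < n) u (j a) (i b)).
Proof.
rewrite /determinant; under eq_bigr => k _ do rewrite ffunE /determinant mulr_sumr.
rewrite exchange_big; apply: eq_bigr => sg _ /=.
under eq_bigr => k _ do rewrite mulrCA.
rewrite -mulr_sumr; congr (_ * _).
pose m : midx m2 n := [ffun a => i ((sg : {perm _}) a)].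
rewrite (bigD1 m) //= [X in _ + X]big1 ?addr0 => [|k /negPf km]; last first.
  rewrite [X in _ * X](_ : _ = (k == m)%:R); first by rewrite km mulr0.
  by rewrite -prod_eq; apply: eq_bigr => a _; rewrite !mxE ffunE.
rewrite [X in _ * X]big1 ?mulr1 => [|a _]; last by rewrite !mxE ffunE eqxx.
by apply: eq_bigr => a _; rewrite mxE ffunE.
Qed.

Lemma asym_wpow m1 m2 (u : 'M[C]_(m1, m2)) n (j : midx m1 n) (i : midx m2 n) :
  \sum_k asym m1 n (j, k) * wpow u k i = \det (\matrix_(a < n, b < n) u (j a) (i b)).
Proof.
transitivity (\sum_k wpow u^T i k * asym m1 n (k, j)).
  apply: eq_bigr => k _; rewrite mulrC !ffunE -[in RHS]det_tr; congr (_ * _).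
    by apply: eq_bigr => a _; rewrite mxE.
  by congr (\det _); apply/matrixP => a b; rewrite !mxE eq_sym.
rewrite wpow_asym -det_tr; congr (\det _); apply/matrixP => a b.
by rewrite !mxE.
Qed.

Lemma asym_intertwiner m (G : csubgroup R m) n : intertwiner G (asym m n).
Proof.
move=> u _; have uE j k : upow u n (j, k) = wpow (uval u) j k by rewrite ffunE.
apply: tensP => j i; rewrite !ffunE /=.
under eq_bigr => k _ do rewrite uE; under [RHS]eq_bigr => k _ do rewrite uE.
by rewrite wpow_asym asym_wpow.
Qed.

Lemma wpow_mul m1 m2 m3 (u : 'M[C]_(m1, m2)) (v : 'M[C]_(m2, m3)) n
    (j : midx m1 n) (i : midx m3 n) :
  wpow (u *m v) j i = \sum_k wpow u j k * wpow v k i.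
Proof.
rewrite /wpow; under eq_bigr => k _ do rewrite mxE.
by rewrite bigA_distr_bigA /=; apply: eq_bigr => f _; rewrite big_split.
Qed.

Lemma wpow1 m n (j i : midx m n) : wpow (1%:M : 'M[C]_m) j i = (j == i)%:R.
Proof. by rewrite -prod_eq; apply: eq_bigr => a _; rewrite mxE. Qed.

Variables (d : nat) (G : csubgroup R d) (h : nat).
Variable Rel : forall r s, tens R d r s -> tens R h r s -> Prop.
Arguments Rel {r s}.
Hypothesis Rc : corr G (@Rel).

(** w y^T = 1 forces rank h on a matrix with d columns. Only [corr] is assumed, so this applies to
    incomplete orthonormal families. *)
Lemma corr_dim_le : (0 < h)%N -> (0 < d)%N -> (h <= d)%N.
Proof.
move=> h0 d0; have [w [y [wy _]]] := corr_point_of Rc (Ordinal h0) (Ordinal d0).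
rewrite -[h](mxrank1 C) -wy; apply: leq_trans (mxrankM_maxl _ _) _.
exact: rank_leq_col.
Qed.

Hypothesis Rcomp : forall r s t p q p' q', @Rel s t p q -> @Rel r s p' q' ->
  Rel (tcomp p p') (tcomp q q').
Hypothesis Rid : forall r, Rel (tid R d r) (tid R h r).
Hypothesis Rta : forall r s r' s' p q p' q', @Rel r s p q -> @Rel r' s' p' q' ->
  Rel (ttens p p') (ttens q q').
Hypothesis Rfaithful : forall r s p, @Rel r s p 0 -> p = 0.

(* The antisymmetrizer on h+1 factors vanishes in dimension h, but not in
   dimension d if h < d. *)
Lemma corr_point : (0 < h)%N -> (0 < d)%N ->
  h = d /\ exists w y : 'M[C]_(h, d), w *m y^T = 1%:M /\
  forall r s p q, @Rel r s p q -> forall (j : midx h s) (i : midx d r),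
      \sum_k wpow w j k * p (k, i) = \sum_l q (j, l) * wpow w l i.
Proof.
move=> h0 d0; have [w [y [wy H]]] := corr_point_of Rc (Ordinal h0) (Ordinal d0).
have {}H r s p q : @Rel r s p q -> forall (j : midx h s) (i : midx d r),
      \sum_k wpow w j k * p (k, i) = \sum_l q (j, l) * wpow w l i.
  by move=> pq; apply: H => // m t p' q' pq'; apply: Rcomp => //; apply: Rta.
split; last by exists w, y.
apply/eqP; rewrite eqn_leq corr_dim_le //= leqNgt; apply/negP => hd.
have [q pq] := corr_ex Rc (@asym_intertwiner d G h.+1).
(* By the intertwining relation, the entries of q times a tensor power of w are minors of w on h+1
   rows, two of which coincide. *)
have q0 : q = 0.
  apply: tensP => j l; rewrite [RHS]ffunE.
  have qw i : \sum_l q (j, l) * wpow w l i = 0.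
    rewrite -(H _ _ _ _ pq) wpow_asym.
    have [a [b [ab jab]]] : exists a b : 'I_h.+1, a != b /\ j a = j b.
      apply: contrapT => nj; have : injective j.
        move=> a b jab; apply: contrapT => /eqP ab; apply: nj; by exists a, b.
      by move=> /leq_card; rewrite !card_ord ltnn.
    by apply: (determinant_alternate ab) => c; rewrite !mxE jab.
  (* The tensor power of w is cancelled on the right by that of y^T. *)
  have : \sum_i (\sum_l q (j, l) * wpow w l i) * wpow y l i = 0.
    by rewrite big1 // => i _; rewrite qw mul0r.
  under eq_bigr => i _ do rewrite mulr_suml.
  rewrite exchange_big (bigD1 l) //= [X in _ + X]big1 ?addr0 => [|k kl].
    under eq_bigr => i _ do rewrite -mulrA.
    rewrite -mulr_sumr (_ : \sum_i _ = 1) ?mulr1 //.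
    transitivity (wpow (w *m y^T) l l); last by rewrite wy wpow1 eqxx.
    rewrite wpow_mul; apply: eq_bigr => i _; congr (_ * _).
    by apply: eq_bigr => a _; rewrite mxE.
  under eq_bigr => i _ do rewrite -mulrA.
  rewrite -mulr_sumr (_ : \sum_i _ = 0) ?mulr0 //.
  transitivity (wpow (w *m y^T) k l); last by rewrite wy wpow1 (negPf kl).
  rewrite wpow_mul; apply: eq_bigr => i _; congr (_ * _).
  by apply: eq_bigr => a _; rewrite mxE.
rewrite q0 in pq; have /ffunP := Rfaithful pq.
(* h+1 distinct indices below d, at which the diagonal entry of the antisymmetrizer is 1. *)
pose i : midx d h.+1 := [ffun a => widen_ord hd a].
move=> /(_ (i, i)); rewrite !ffunE /= (_ : \matrix_(a, b) _ = 1%:M) ?det1.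
  by move/eqP; rewrite oner_eq0.
apply/matrixP => a b; rewrite !mxE !ffunE -(inj_eq val_inj) /=.
by rewrite (inj_eq val_inj).
Qed.

End Dimension.

(** * Polar decomposition of an intertwining matrix *)

Section Polar.
Variables (R : realType) (d : nat).
Local Notation C := R[i].
Local Notation tens := (tens R d).
Local Open Scope sesquilinear_scope.

Definition mpow (A : 'M[C]_d) r : tens r r := [ffun x : midx d r * midx d r => wpow A x.1 x.2].

Lemma mpowM A B r : mpow (A *m B) r = tcomp (mpow A r) (mpow B r).
Proof.
apply: tensP => j i; rewrite !ffunE /= wpow_mul.
by apply: eq_bigr => k _; rewrite !ffunE.
Qed.

Lemma mpow1 r : mpow 1%:M r = tid R d r.
Proof. by apply: tensP => j i; rewrite !ffunE wpow1. Qed.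

Lemma mpow_star A r : mpow (A^t*) r = tstar (mpow A r).
Proof.
apply: tensP => j i; rewrite !ffunE rmorph_prod.
by apply: eq_bigr => k _; rewrite !mxE.
Qed.

Lemma mpow_upow (u : unitary R d) r : mpow (uval u) r = upow u r.
Proof. by apply: tensP => j i; rewrite !ffunE. Qed.

Lemma mpow_diag (a : 'rV[C]_d) r j i : mpow (diag_mx a) r (j, i) = (j == i)%:R * \prod_k a 0 (i k).
Proof.
rewrite ffunE /= -prod_eq -big_split; apply: eq_bigr => k _ /=.
by rewrite mxE mulrC; case: eqP => [->|_]; rewrite ?mulr1 ?mulr0.
Qed.

(** Commutation with diagonal matrices says that p vanishes wherever the products of eigenvalues
    differ. Nonnegative products agree as soon as their squares do. *)
Lemma sqrt_diag_intertwines (a : 'rV[C]_d) r s (p : tens r s) :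
  (forall k, 0 <= a 0 k) ->
  tcomp (mpow (diag_mx a) s) p = tcomp p (mpow (diag_mx a) r) ->
  tcomp (mpow (diag_mx (map_mx sqrtC a)) s) p =
  tcomp p (mpow (diag_mx (map_mx sqrtC a)) r).
Proof.
have entl b j i : tcomp (mpow (diag_mx b) s) p (j, i) = (\prod_k b 0 (j k)) * p (j, i).
  rewrite ffunE /= (bigD1 j) //= [X in _ + X]big1 ?addr0 => [|k /negPf kj].
    by rewrite mpow_diag eqxx mul1r.
  by rewrite mpow_diag eq_sym kj !mul0r.
have entr b j i : tcomp p (mpow (diag_mx b) r) (j, i) = p (j, i) * \prod_k b 0 (i k).
  rewrite ffunE /= (bigD1 i) //= [X in _ + X]big1 ?addr0 => [|k /negPf ki].
    by rewrite mpow_diag eqxx mul1r.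
  by rewrite mpow_diag ki mul0r mulr0.
move=> a0 /ffunP e; apply: tensP => j i; rewrite entl entr.
have {}e := e (j, i); rewrite entl entr [RHS]mulrC in e; rewrite [RHS]mulrC.
have [->|p0] := eqVneq (p (j, i)) 0; first by rewrite !mulr0.
congr (_ * _); move/(mulIf p0): e => e.
have sq n (m : midx d n) : (\prod_k (map_mx sqrtC a) 0 (m k)) ^+ 2 = \prod_k a 0 (m k).
  by rewrite -prodrXl; apply: eq_bigr => k _; rewrite mxE sqrtCK.
have ge n (m : midx d n) : 0 <= \prod_k (map_mx sqrtC a) 0 (m k).
  by apply: prodr_ge0 => k _; rewrite mxE sqrtC_ge0.
by apply/eqP; rewrite -(eqrXn2 (n := 2)) // !sq e.
Qed.

Variable Rel : forall r s, tens r s -> tens r s -> Prop.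
Arguments Rel {r s}.
Hypothesis Rstar : forall r s p q, @Rel r s p q -> Rel (tstar p) (tstar q).
Variable w y : 'M[C]_d.
Hypothesis wy : w *m y^T = 1%:M.
Hypothesis Hw : forall r s p q, @Rel r s p q -> forall (j : midx d s) (i : midx d r),
  \sum_k wpow w j k * p (k, i) = \sum_l q (j, l) * wpow w l i.

(* The unitary part of the polar decomposition of w intertwines as well. *)
Lemma polar_point : exists v : unitary R d, forall r s p q, @Rel r s p q ->
  tcomp (upow v s) p = tcomp q (upow v r).
Proof.
have HW r s p q : @Rel r s p q -> tcomp (mpow w s) p = tcomp q (mpow w r).
  move=> pq; apply: tensP => j i; rewrite !ffunE /=.
  under eq_bigr => k _ do rewrite ffunE /=.
  by rewrite (Hw pq); apply: eq_bigr => k _; rewrite ffunE.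
(* As [Rel] is closed under adjoints, w and its adjoint intertwine in opposite directions, so A
   commutes with every p. *)
pose A := w^t* *m w.
have AP r s p q : @Rel r s p q -> tcomp (mpow A s) p = tcomp p (mpow A r).
  move=> pq; rewrite !mpowM -tcompA (HW _ _ _ _ pq) !tcompA; congr tcomp.
  have := congr1 (@tstar _ _ _ _) (HW _ _ _ _ (Rstar pq)).
  by rewrite !tstar_comp !tstarK !mpow_star => ->.
have Aherm : A^t* = A by rewrite /A trmx_mul map_mxM /= trmxCK.
have Anormal : A \is normalmx by apply/normalmxP; rewrite Aherm.
pose V := spectralmx A; pose a := spectral_diag A.
have VU : V \is unitarymx := spectral_unitarymx A.
have VV : V *m V^t* = 1%:M by apply/unitarymxP.
have VV' : V^t* *m V = 1%:M by apply: mulmx1C.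
have AE : A = V^t* *m diag_mx a *m V.
  by have /orthomx_spectralP := Anormal; rewrite invmx_unitary.
have aE : diag_mx a = V *m A *m V^t*.
  by rewrite AE !mulmxA VV mul1mx -mulmxA VV mulmx1.
have wu : w \in unitmx by have [] := mulmx1_unit wy.
(* The eigenvalue is the squared length of the image under w of an eigenvector, and w is
   invertible. *)
have a_gt0 k : 0 < a 0 k.
  have -> : a 0 k = \sum_l `|(w *m V^t*) l k| ^+ 2.
    transitivity (((w *m V^t*)^t* *m (w *m V^t*)) k k).
      rewrite trmx_mul map_mxM /= trmxCK mulmxA -[V *m _ *m _]mulmxA -/A -aE.
      by rewrite mxE eqxx.
    rewrite mxE; apply: eq_bigr => l _; rewrite normCK mulrC.
    by congr (_ * _); rewrite mxE [in LHS]mxE.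
  rewrite lt_def; apply/andP; split; last by apply: sumr_ge0 => l _; apply: exprn_ge0.
  apply/eqP => /eqP; rewrite psumr_eq0 => [/allP H|l _]; last exact: exprn_ge0.
  have : col k (w *m V^t*) = 0.
    apply/colP => l; have := H l; rewrite mem_index_enum !mxE => /(_ isT).
    by rewrite expf_eq0 /= normr_eq0 => /eqP.
  rewrite colE => /(congr1 (mulmx (V *m invmx w))).
  rewrite mulmx0 !mulmxA -[V *m _ *m w]mulmxA mulVmx // mulmx1.
  rewrite VV mul1mx => /matrixP/(_ k 0).
  by rewrite !mxE !eqxx => /eqP; rewrite oner_eq0.
pose s := map_mx sqrtC a.
have s_neq0 k : s 0 k != 0 by rewrite mxE sqrtC_eq0 gt_eqF.
pose S := V^t* *m diag_mx s *m V.
pose S' := V^t* *m diag_mx (map_mx GRing.inv s) *m V.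
have SS' : S *m S' = 1%:M.
  rewrite /S /S' !mulmxA -[_ *m V *m V^t*]mulmxA VV mulmx1 -[_ *m _ *m diag_mx _]mulmxA.
  rewrite mulmx_diag (_ : diag_mx _ = 1%:M) ?mulmx1 //.
  apply/matrixP => i j; rewrite !mxE; case: eqP => [->|_]; rewrite ?mulr0n // !mulr1n.
  by have := s_neq0 j; rewrite mxE => sj; rewrite divff.
have S'S : S' *m S = 1%:M by apply: mulmx1C.
have SS : S *m S = A.
  rewrite /S !mulmxA -[_ *m V *m V^t*]mulmxA VV mulmx1 -[_ *m _ *m diag_mx _]mulmxA.
  rewrite mulmx_diag AE (_ : \row_k _ = a) //.
  by apply/rowP => k; rewrite !mxE -expr2 sqrtCK.
have S_herm : S^t* = S.
  rewrite /S !trmx_mul !map_mxM /= trmxCK mulmxA tr_diag_mx map_diag_mx.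
  rewrite (_ : map_mx _ s = s) //; apply/rowP => k; rewrite [LHS]mxE mxE.
  by apply/CrealP; rewrite realE sqrtC_ge0 ltW.
(* Conjugation by V makes A diagonal, so that [sqrt_diag_intertwines] applies to p'; conjugating
   back gives the claim for S, the square root of A. *)
have SP r t p q : @Rel r t p q -> tcomp (mpow S t) p = tcomp p (mpow S r).
  move=> pq; pose p' := tcomp (tcomp (mpow V t) p) (mpow (V^t*) r).
  have : tcomp (mpow (diag_mx a) t) p' = tcomp p' (mpow (diag_mx a) r).
    rewrite aE /p' !(mpowM (V *m A)) !(mpowM V A) !tcompA.
    rewrite -[tcomp (tcomp _ (mpow (V^t*) t)) (mpow V t)]tcompA -(mpowM (V^t*) V) VV' mpow1 tcompf1.
    rewrite -[tcomp (tcomp _ (mpow (V^t*) r)) (mpow V r)]tcompA -(mpowM (V^t*) V) VV' mpow1 tcompf1.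
    by congr tcomp; rewrite -!tcompA (AP _ _ _ _ pq).
  move=> /sqrt_diag_intertwines => /(_ (fun k => ltW (a_gt0 k))); rewrite -/s => H.
  have pE : p = tcomp (tcomp (mpow (V^t*) t) p') (mpow V r).
    rewrite /p' !tcompA -(mpowM (V^t*) V) VV' mpow1 tcomp1f -tcompA -(mpowM (V^t*) V) VV' mpow1.
    by rewrite tcompf1.
  clearbody p'; rewrite [in LHS]pE [in RHS]pE /S !mpowM !tcompA.
  rewrite -[tcomp (tcomp _ (mpow V t)) (mpow (V^t*) t)]tcompA -(mpowM V (V^t*)) VV mpow1 tcompf1.
  rewrite -[tcomp (tcomp _ (mpow V r)) (mpow (V^t*) r)]tcompA -(mpowM V (V^t*)) VV mpow1 tcompf1.
  by rewrite -[tcomp (tcomp (mpow (V^t*) t) _) p']tcompA H !tcompA.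
clearbody S S'.
have S'P r t p q : @Rel r t p q -> tcomp (mpow S' t) p = tcomp p (mpow S' r).
  move=> /SP e; rewrite -[LHS]tcompf1 -mpow1 -SS' (mpowM S S') tcompA.
  by rewrite -[tcomp (tcomp _ p) _]tcompA -e tcompA -(mpowM S' S) S'S mpow1 tcomp1f.
have vU : w *m S' \is unitarymx.
  rewrite -trmxC_unitary; apply/unitarymxP; rewrite trmxCK.
  have S'_herm : S'^t* = S'.
    have : (S *m S')^t* = 1%:M by rewrite SS' trmx1 map_mx1.
    rewrite trmx_mul map_mxM /= S_herm => e.
    by rewrite -[LHS]mulmx1 -SS' mulmxA e mul1mx.
  have -> : (w *m S')^t* = S' *m w^t*.
    by rewrite trmx_mul map_mxM /= S'_herm.
  by rewrite !mulmxA -[S' *m _ *m w]mulmxA -/A -SS mulmxA S'S mul1mx SS'.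
exists (Unitary vU) => r t p q pq; rewrite -!mpow_upow /= !mpowM.
by rewrite -tcompA (S'P _ _ _ _ pq) tcompA (HW _ _ _ _ pq) tcompA.
Qed.

End Polar.

(** * Arrows from the unit *)

Section Points.
Variables (R : realType) (E : stcat R).
Local Notation C := R[i].
Local Notation one := (ou E).

(* The arrows from the unit to x behave like the vectors of a Hilbert space on
   which the arrows out of x act faithfully. *)
Record pointed : Prop := Pointed {
  pt_scalar : forall f : hom E one one, exists c, f = c *: idc one;
  pt_unit : idc one != 0;
  pt_pos : forall x (f : hom E one x) c, star f \oc f = c *: idc one -> 0 <= c;
  pt_def : forall x (f : hom E one x), star f \oc f = 0 -> f = 0;
  pt_gen : forall x y (f : hom E x y), (forall g : hom E one x, f \oc g = 0) -> f = 0;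
  pt_sy : sy one one = idc (one \oto one)
}.

Lemma hom_eq x y (f g : hom E x y) : f === g -> f = g.
Proof. exact: aeq_eq. Qed.

Lemma hom_aeq x y (f g : hom E x y) : f = g -> f === g.
Proof. exact: eq_aeq. Qed.

Lemma compDl x y z (g g' : hom E y z) (f : hom E x y) :
  (g + g') \oc f = g \oc f + g' \oc f.
Proof. by have := comp_linl 1 g g' f; rewrite !scale1r. Qed.

Lemma compDr x y z (g : hom E y z) (f f' : hom E x y) :
  g \oc (f + f') = g \oc f + g \oc f'.
Proof. by have := comp_linr 1 g f f'; rewrite !scale1r. Qed.

Lemma compZl x y z a (g : hom E y z) (f : hom E x y) : (a *: g) \oc f = a *: (g \oc f).
Proof. by have := comp_linl a g 0 f; rewrite comp0f !addr0. Qed.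

Lemma compZr x y z a (g : hom E y z) (f : hom E x y) : g \oc (a *: f) = a *: (g \oc f).
Proof. by have := comp_linr a g f 0; rewrite compf0 !addr0. Qed.

Lemma comp_suml x y z (I : Type) (s : seq I) (g : I -> hom E y z) (f : hom E x y) :
  (\sum_(i <- s) g i) \oc f = \sum_(i <- s) g i \oc f.
Proof. by elim: s => [|i s IH]; rewrite ?big_nil ?comp0f // !big_cons compDl IH. Qed.

Lemma comp_sumr x y z (I : Type) (s : seq I) (g : hom E y z) (f : I -> hom E x y) :
  g \oc (\sum_(i <- s) f i) = \sum_(i <- s) g \oc f i.
Proof. by elim: s => [|i s IH]; rewrite ?big_nil ?compf0 // !big_cons compDr IH. Qed.

Lemma starZ x y a (f : hom E x y) : star (a *: f) = a^* *: star f.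
Proof. by have := star_lin a f 0; rewrite star0 !addr0. Qed.

Lemma ta0l x y x' y' (g : hom E x' y') : (0 : hom E x y) \ota g = 0.
Proof. by have := ta_linl (-1) (0 : hom E x y) 0 g; rewrite scaler0 addr0 scaleN1r addNr. Qed.

Lemma ta0r x y x' y' (f : hom E x y) : f \ota (0 : hom E x' y') = 0.
Proof. by have := ta_linr (-1) f (0 : hom E x' y') 0; rewrite scaler0 addr0 scaleN1r addNr. Qed.

Lemma taZl x y x' y' a (f : hom E x y) (g : hom E x' y') : (a *: f) \ota g = a *: (f \ota g).
Proof. by have := ta_linl a f 0 g; rewrite ta0l !addr0. Qed.

Lemma taZr x y x' y' a (f : hom E x y) (g : hom E x' y') : f \ota (a *: g) = a *: (f \ota g).
Proof. by have := ta_linr a f g 0; rewrite ta0r !addr0. Qed.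

Lemma ta_suml x y x' y' (I : Type) (s : seq I) (f : I -> hom E x y) (g : hom E x' y') :
  (\sum_(i <- s) f i) \ota g = \sum_(i <- s) f i \ota g.
Proof.
elim: s => [|i s IH]; rewrite ?big_nil ?ta0l // !big_cons -IH.
by have := ta_linl 1 (f i) (\sum_(j <- s) f j) g; rewrite !scale1r.
Qed.

Lemma ta_sumr x y x' y' (I : Type) (s : seq I) (f : hom E x y) (g : I -> hom E x' y') :
  f \ota (\sum_(i <- s) g i) = \sum_(i <- s) f \ota g i.
Proof.
elim: s => [|i s IH]; rewrite ?big_nil ?ta0r // !big_cons -IH.
by have := ta_linr 1 f (g i) (\sum_(j <- s) g j); rewrite !scale1r.
Qed.

Lemma aeq_scale x y x' y' a (f : hom E x y) (g : hom E x' y') :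
  f === g -> a *: f === a *: g.
Proof. by case; apply: aeq_refl. Qed.

Hypothesis Pt : pointed.

Definition sc (f : hom E one one) : C := projT1 (cid (pt_scalar Pt f)).

Lemma scE f : f = sc f *: idc one.
Proof. by rewrite /sc; case: cid. Qed.

Lemma scZ c : sc (c *: idc one) = c.
Proof.
have /eqP := scE (c *: idc one).
rewrite -subr_eq0 -scalerBl scaler_eq0 (negPf (pt_unit Pt)) orbF subr_eq0.
by move=> /eqP.
Qed.

Lemma sc_lin a f g : sc (a *: f + g) = a * sc f + sc g.
Proof. by rewrite {1}[f]scE {1}[g]scE scalerA -scalerDl scZ. Qed.

Lemma sc_id : sc (idc one) = 1.
Proof. by rewrite -[idc one]scale1r scZ. Qed.

Lemma sc0 : sc 0 = 0.
Proof. by rewrite -(scale0r (idc one)) scZ. Qed.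

Lemma sc_scale a f : sc (a *: f) = a * sc f.
Proof. by rewrite -[a *: f]addr0 sc_lin sc0 addr0. Qed.

Lemma sc_sum (I : Type) (s : seq I) (f : I -> hom E one one) :
  sc (\sum_(i <- s) f i) = \sum_(i <- s) sc (f i).
Proof.
elim: s => [|i s IH]; rewrite ?big_nil ?sc0 // !big_cons -IH.
by rewrite -[f i]scale1r sc_lin mul1r scale1r.
Qed.

Lemma sc_comp f g : sc (f \oc g) = sc f * sc g.
Proof. by rewrite {1}[f]scE compZl comp1f sc_scale. Qed.

Lemma sc_star f : sc (star f) = (sc f)^*.
Proof. by rewrite {1}[f]scE starZ star_id scZ. Qed.

Lemma sc_aeq f (f' : hom E one one) : f === f' -> sc f = sc f'.
Proof. by move=> ff; rewrite (hom_eq ff). Qed.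

Definition pta x y (f : hom E one x) (g : hom E one y) : hom E one (x \oto y) :=
  acast (hom := hom E) (ot1x one) erefl (f \ota g).

Lemma ptaE x y (f : hom E one x) (g : hom E one y) : pta f g === f \ota g.
Proof. exact: acast_aeq. Qed.

Lemma aeq_pta x y x' y' (f : hom E one x) (g : hom E one y)
    (f' : hom E one x') (g' : hom E one y') :
  f === f' -> g === g' -> pta f g === pta f' g'.
Proof.
move=> ff gg; apply: aeq_trans (ptaE _ _) _; apply: aeq_trans (aeq_ta ff gg) _.
exact/aeq_sym/ptaE.
Qed.

Lemma ptaA x y z (f : hom E one x) (g : hom E one y) (k : hom E one z) :
  pta f (pta g k) === pta (pta f g) k.
Proof.
apply: aeq_trans (ptaE _ _) _; apply: aeq_trans (aeq_ta (aeq_rfl _) (ptaE _ _)) _.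
apply: aeq_trans (taA _ _ _) _; apply/aeq_sym.
apply: aeq_trans (ptaE _ _) _; exact: aeq_ta (ptaE _ _) (aeq_rfl _).
Qed.

Lemma pta_comp x y x' y' (f : hom E x x') (g : hom E y y') (u : hom E one x) (v : hom E one y) :
  (f \ota g) \oc pta u v = pta (f \oc u) (g \oc v).
Proof.
apply: hom_eq; apply: aeq_trans (aeq_comp (aeq_rfl _) (ptaE _ _)) _.
by rewrite -ta_comp; apply/aeq_sym/ptaE.
Qed.

Lemma sc_pta x y (f f' : hom E one x) (g g' : hom E one y) :
  sc (star (pta f g) \oc pta f' g') = sc (star f \oc f') * sc (star g \oc g').
Proof.
rewrite -[RHS]scZ; apply: sc_aeq.
apply: aeq_trans (aeq_comp (aeq_star (ptaE _ _)) (ptaE _ _)) _.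
rewrite ta_star -ta_comp [star f \oc f']scE [star g \oc g']scE !scZ.
rewrite taZl taZr scalerA ta_id; apply: aeq_scale; apply: aeq_id; exact: ot1x.
Qed.

Lemma pta_sy x y (u : hom E one x) (v : hom E one y) :
  sy x y \oc pta u v = pta v u.
Proof.
apply: hom_eq; apply: aeq_trans (aeq_comp (aeq_rfl _) (ptaE _ _)) _.
by rewrite sy_nat (pt_sy Pt) compf1; apply/aeq_sym/ptaE.
Qed.

(** * Orthonormal families and matrices of arrows *)

Section Family.
Variables (X : obj E) (h : nat) (e : 'I_h -> hom E one X).
Hypothesis e_orth : forall i j, sc (star (e i) \oc e j) = (i == j)%:R.

Fixpoint epow r : midx h r -> hom E one (opow X r) :=
  if r is s.+1 then fun j : midx h s.+1 =>
    pta (e (j ord0)) (epow (rpart (r := 1) (s := s) j))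
  else fun=> idc one.

Lemma epow_orth r (i j : midx h r) : sc (star (epow i) \oc epow j) = (i == j)%:R.
Proof.
elim: r i j => [|r IH] i j /=; first by rewrite star_id comp1f sc_id midx0.
rewrite sc_pta e_orth IH -natrM mulnb (@part_eq _ 1 r i); congr (_ && _)%:R.
apply/eqP/eqP => [ij|/(congr1 (fun k : midx h 1 => k ord0))].
  by apply/ffunP => k; rewrite (ord1 k) !ffunE (_ : lshift r ord0 = ord0) //; apply: val_inj.
by rewrite !ffunE (_ : lshift r ord0 = ord0) //; apply: val_inj.
Qed.

Lemma epow_cat r s (j : midx h (r + s)) :
  epow j === pta (epow (lpart j)) (epow (rpart j)).
Proof.
elim: r j => [|r IH] j.
  apply/aeq_sym; apply: aeq_trans (ptaE _ _) _; apply: aeq_trans (ta1f _) _.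
  apply: hom_aeq; congr epow; apply/ffunP => k; rewrite ffunE; congr (j _).
  exact: val_inj.
rewrite [X in X === _]/=.
apply: aeq_trans (aeq_pta (aeq_rfl _) (IH _)) _.
apply: aeq_trans (ptaA _ _ _) _; apply: aeq_pta.
  rewrite /= ffunE; apply: aeq_pta; apply: eq_aeq.
    by congr (e (j _)); apply: val_inj.
  by congr epow; apply/ffunP => k; rewrite !ffunE; congr (j _); apply: val_inj.
apply: hom_aeq; congr epow; apply/ffunP => k; rewrite !ffunE; congr (j _).
exact: val_inj.
Qed.

Lemma epow_mjoin r s (i : midx h r) (j : midx h s) :
  epow (mjoin i j) === pta (epow i) (epow j).
Proof. by have := epow_cat (mjoin i j); rewrite lpart_join rpart_join. Qed.

(** The compression of f to the span of the [epow e j]. It is multiplicative if one factor (on the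
    left, its adjoint) maps basis vectors to basis vectors, as in [mat_compr] and [mat_compl], or if
    [e] is complete, as in [mat_comp]. *)
Definition mat r s (f : hom E (opow X r) (opow X s)) : tens R h r s :=
  [ffun p : midx h s * midx h r => sc (star (epow p.1) \oc (f \oc epow p.2))].

Lemma matE r s (f : hom E (opow X r) (opow X s)) j i :
  mat f (j, i) = sc (star (epow j) \oc (f \oc epow i)).
Proof. by rewrite ffunE. Qed.

Lemma mat_lin r s a (f g : hom E (opow X r) (opow X s)) :
  mat (a *: f + g) = a *: mat f + mat g.
Proof.
by apply: tensP => j i; rewrite tens_linE !matE comp_linl comp_linr sc_lin.
Qed.

Lemma mat_id r : mat (idc (opow X r)) = tid R h r.
Proof. by apply: tensP => j i; rewrite matE comp1f epow_orth ffunE. Qed.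

Lemma mat_star r s (f : hom E (opow X r) (opow X s)) : mat (star f) = tstar (mat f).
Proof.
apply: tensP => j i; rewrite matE ffunE matE -sc_star !star_comp starK.
by rewrite compA.
Qed.

Lemma mat_ta r s r' s' (f : hom E (opow X r) (opow X s)) (g : hom E (opow X r') (opow X s'))
    (F : hom E (opow X (r + r')) (opow X (s + s'))) :
  F === f \ota g -> mat F = ttens (mat f) (mat g).
Proof.
move=> FE; apply: tensP => j i; rewrite ttensE !matE -sc_pta -pta_comp.
apply: sc_aeq; apply: aeq_comp (aeq_star (epow_cat _)) _.
exact: aeq_comp FE (epow_cat _).
Qed.

Lemma mat_fun r s (F : hom E (opow X r) (opow X s)) (u : midx h r -> midx h s) :
  (forall i, F \oc epow i = epow (u i)) -> forall j i, mat F (j, i) = (j == u i)%:R.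
Proof. by move=> FE j i; rewrite matE FE epow_orth. Qed.

Lemma mat_sy r s (F : hom E (opow X (r + s)) (opow X (s + r))) :
  F === sy (opow X r) (opow X s) -> mat F = tflip R h r s.
Proof.
move=> FE; apply: tensP => j i.
rewrite (@mat_fun _ _ _ (fun i => mjoin (rpart i) (lpart i))) ?tflipE // => {}i.
apply: hom_eq; apply: aeq_trans (aeq_comp FE (epow_cat _)) _.
by rewrite pta_sy; apply/aeq_sym/epow_mjoin.
Qed.

Lemma mat_compr r s t (g : hom E (opow X s) (opow X t)) (f : hom E (opow X r) (opow X s))
    (u : midx h r -> midx h s) :
  (forall i, f \oc epow i = epow (u i)) -> mat (g \oc f) = tcomp (mat g) (mat f).
Proof.
move=> fE; apply: tensP => j i.
rewrite (@tcomp_fun _ _ _ _ _ (mat g) (mat f) u) => [|k]; last exact: mat_fun.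
by rewrite !matE -compA fE.
Qed.

Lemma mat_compl r s t (g : hom E (opow X s) (opow X t)) (f : hom E (opow X r) (opow X s))
    (u : midx h t -> midx h s) :
  (forall i, star g \oc epow i = epow (u i)) -> mat (g \oc f) = tcomp (mat g) (mat f).
Proof.
move=> gE; rewrite -[LHS]tstarK -mat_star star_comp (mat_compr _ gE).
by rewrite !mat_star tstar_comp !tstarK.
Qed.

Lemma mjoin_head r (a : midx h 1) (b : midx h r) :
  (mjoin a b : midx h r.+1) ord0 = a ord0.
Proof.
transitivity (lpart (mjoin a b) ord0); last by rewrite lpart_join.
by rewrite [RHS]ffunE; congr (mjoin a b _); apply: val_inj.
Qed.

Section Complete.
Hypothesis e_full : \sum_i e i \oc star (e i) = idc X.

Lemma epow_full r : \sum_j epow j \oc star (epow j) = idc (opow X r).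
Proof.
elim: r => [|r IH].
  have z : midx h 0 by apply: finfun => -[].
  rewrite (big_pred1 z) => [|j]; last by rewrite /= (midx0 j z).
  by rewrite /= star_id comp1f.
pose cons (p : 'I_h * midx h r) : midx h r.+1 :=
  mjoin (r := 1) (s := r) [ffun=> p.1] p.2.
have consE p : epow (cons p) = pta (e p.1) (epow p.2).
  rewrite /= /cons (rpart_join (r := 1)) -[_ ord0]/((mjoin (r := 1) (s := r) _ _) ord0).
  by rewrite mjoin_head ffunE.
rewrite (reindex cons) /=; last first.
  exists (fun j : midx h r.+1 => (j ord0, rpart (r := 1) (s := r) j)) => [[i k] _|j _].
    congr pair; last exact: (rpart_join (r := 1)).
    by rewrite /cons mjoin_head ffunE.
  apply/eqP; rewrite (@part_eq _ 1 r) lpart_join rpart_join eqxx andbT; apply/eqP.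
  by apply/ffunP => k; rewrite !ffunE (ord1 k); congr (j _); apply: val_inj.
transitivity (\sum_i \sum_(k : midx h r) (e i \oc star (e i)) \ota (epow k \oc star (epow k))).
  rewrite pair_bigA; apply: eq_bigr => p _.
  rewrite [pta (e (cons p ord0)) _](consE p); apply: hom_eq.
  apply: aeq_trans (aeq_comp (ptaE _ _) (aeq_star (ptaE _ _))) _.
  by rewrite ta_star -ta_comp; apply: aeq_rfl.
rewrite -[RHS]ta_id -e_full -IH ta_suml; apply: eq_bigr => i _.
by rewrite ta_sumr.
Qed.

Lemma mat_comp r s t (g : hom E (opow X s) (opow X t)) (f : hom E (opow X r) (opow X s)) :
  mat (g \oc f) = tcomp (mat g) (mat f).
Proof.
apply: tensP => j i; rewrite matE ffunE /=.
rewrite -{1}[f]comp1f -epow_full !comp_suml comp_sumr comp_suml comp_sumr sc_sum.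
apply: eq_bigr => k _; rewrite !matE -sc_comp; congr sc.
by rewrite !compA.
Qed.

Lemma mat_eq0 r s (f : hom E (opow X r) (opow X s)) : mat f = 0 -> f = 0.
Proof.
move=> f0; rewrite -[f]compf1 -[X in X \oc _]comp1f -!epow_full.
rewrite comp_suml comp_suml big1 // => j _; rewrite comp_sumr big1 // => i _.
have -> : epow j \oc star (epow j) \oc f \oc (epow i \oc star (epow i)) =
    epow j \oc (star (epow j) \oc (f \oc epow i)) \oc star (epow i).
  by rewrite !compA.
rewrite [star (epow j) \oc _]scE -matE f0 [X in X *: _]ffunE scale0r.
by rewrite compf0 comp0f.
Qed.

Lemma epow_span r (v : hom E one (opow X r)) :
  v = \sum_j sc (star (epow j) \oc v) *: epow j.
Proof.
rewrite -[LHS]comp1f -epow_full comp_suml; apply: eq_bigr => j _.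
by rewrite -compA [star _ \oc v]scE compZr compf1 scZ.
Qed.

End Complete.
End Family.

Definition orthonormal (X : obj E) h (e : 'I_h -> hom E one X) :=
  forall i j, sc (star (e i) \oc e j) = (i == j)%:R.

(** A family of maximal size is complete: if the complementary projection D were nonzero, [pt_gen]
    would give a nonzero arrow D o g, which could be normalized and appended. *)
Lemma orthonormal_complete (X : obj E) (n : nat) :
  (forall h (e : 'I_h -> hom E one X), orthonormal e -> (h <= n)%N) ->
  exists h (e : 'I_h -> hom E one X), orthonormal e /\
    \sum_i e i \oc star (e i) = idc X.
Proof.
move=> bound.
pose Q h := `[< exists e : 'I_h -> hom E one X, orthonormal e >].
have Q0 : exists h, Q h.
  have e0 : 'I_0 -> hom E one X by case.
  by exists 0%N; apply/asboolP; exists e0 => -[].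
have Qn h : Q h -> (h <= n)%N by move=> /asboolP[e]; apply: bound.
case: (ex_maxnP Q0 Qn) => h /asboolP[e oe] hmax.
exists h, e; split=> //; apply/eqP; rewrite eq_sym -subr_eq0; apply/eqP.
set D := _ - _; apply: (pt_gen Pt) => g; apply: contrapT => v0.
set v := D \oc g in v0.
have ev i : star (e i) \oc v = 0.
  rewrite /v compA (_ : star (e i) \oc D = 0) ?comp0f //.
  rewrite /D -scaleN1r compDr compZr compf1 comp_sumr (bigD1 i) //= big1 => [|j ji].
    by rewrite compA [star (e i) \oc e i]scE oe eqxx scale1r comp1f addr0 scaleN1r subrr.
  by rewrite compA [star (e i) \oc e j]scE oe eq_sym (negPf ji) scale0r comp0f.
have ve i : star v \oc e i = 0 by rewrite -[LHS]starK star_comp starK ev star0.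
have [c vc] := pt_scalar Pt (star v \oc v).
have c0 : 0 < c.
  rewrite lt_def (pt_pos Pt vc) andbT; apply/eqP => c0; apply: v0.
  by apply: (pt_def Pt); rewrite vc c0 scale0r.
have rc : (sqrtC c)^-1^* = (sqrtC c)^-1.
  by apply/CrealP; rewrite realE invr_ge0 sqrtC_ge0 ltW.
pose e' (i : 'I_h.+1) := oapp e ((sqrtC c)^-1 *: v) (unlift ord_max i).
suff : Q h.+1 by move=> /hmax; rewrite ltnn.
apply/asboolP; exists e' => i j; rewrite /e'.
case: unliftP => [i'|] ->; case: unliftP => [j'|] -> /=.
- by rewrite oe (inj_eq lift_inj).
- by rewrite compZr ev scaler0 sc0 eq_sym (negPf (neq_lift _ _)).
- by rewrite starZ compZl ve scaler0 sc0 (negPf (neq_lift _ _)).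
rewrite starZ compZl compZr vc eqxx !scalerA scZ rc -invfM -expr2 sqrtCK.
by rewrite mulVf // gt_eqF.
Qed.

End Points.

(** * Vectors of a Hilbert space as arrows from the unit *)

Section HilbertPoints.
Variables (R : realType) (T : cstcat R) (H : hilb_tensor T).
Local Notation C := R[i].
Local Notation one := (ou T).

Lemma op0 x y v : op H (0 : hom T x y) v = 0.
Proof. by have := @op_lin _ _ H _ _ (-1) (0 : hom T x y) 0 v; rewrite scaler0 addr0 scaleN1r addNr. Qed.

Lemma opZ x y a (f : hom T x y) v : op H (a *: f) v = a *: op H f v.
Proof. by have := @op_lin _ _ H _ _ a f 0 v; rewrite op0 !addr0. Qed.

Lemma op_vac x (f g : hom T one x) : op H f (vac H) = op H g (vac H) -> f = g.
Proof.
move=> fg; apply: (op_inj (h := H)) => v; have [c ->] := vac_span v.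
by rewrite !linearZ /= fg.
Qed.

Lemma inner0 (V : hilbert R) (u : V) : inner u 0 = 0.
Proof. by have := inner_linr (-1) u 0 0; rewrite scaler0 addr0 mulN1r addNr. Qed.

Lemma innerZ (V : hilbert R) a (u v : V) : inner u (a *: v) = a * inner u v.
Proof. by rewrite -[a *: v]addr0 inner_linr inner0 addr0. Qed.

Lemma inner_eq0 (V : hilbert R) (u : V) : inner u u = 0 -> u = 0.
Proof. by rewrite inner_norm => /eqP; rewrite expf_eq0 /= normr_eq0 => /eqP. Qed.

Lemma op_star_self x (f : hom T one x) :
  inner (vac H) (op H (star f \oc f) (vac H)) = inner (op H f (vac H)) (op H f (vac H)).
Proof.
rewrite op_comp inner_conj op_star [in RHS]inner_norm inner_norm.
by rewrite conj_Creal // realE exprn_ge0.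
Qed.

Section Ket.
Variables (x : obj T) (psi : hil H x).
(** The rank-one operator sending the vacuum to [psi]; by fullness it comes from an arrow once it is
    known to be continuous. *)
Definition ket (v : hil H one) : hil H x := inner (vac H) v *: psi.

Lemma ket_linear : linear ket.
Proof. by move=> a u v; rewrite /ket inner_linr scalerDl scalerA. Qed.

HB.instance Definition _ := GRing.isLinear.Build C (hil H one) (hil H x) _ ket ket_linear.

Lemma ket_norm v : `|ket v| = `|v| * `|psi|.
Proof.
rewrite /ket normrZ; congr (_ * _).
have [c ->] := vac_span v; rewrite innerZ vac_norm mulr1 normrZ.
suff -> : `|vac H| = 1 by rewrite mulr1.
apply/eqP; rewrite -(@eqrXn2 _ 2) ?normr_ge0 ?ler01 //.
by rewrite -inner_norm vac_norm expr1n.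
Qed.

Lemma ket_continuous : continuous ket.
Proof.
move=> v; apply/cvgrPdist_le => eps eps0.
have n0 : 0 < 1 + `|psi| by rewrite ltr_pwDl.
near=> u; rewrite -[ket v - ket u](linearB ket) ket_norm.
apply: (@le_trans _ _ (eps / (1 + `|psi|) * (1 + `|psi|))); last by rewrite divfK ?gt_eqF.
apply: ler_pM => //; last by rewrite lerDr.
near: u; apply: (@cvgr_dist_le _ _ _ (nbhs v) _ id v) => //; exact: divr_gt0.
Unshelve. all: by end_near. Qed.

Lemma ket_arrow : exists f : hom T one x, op H f (vac H) = psi.
Proof.
have [f fE] := op_surj (h := H) (A := ket) ket_continuous.
by exists f; rewrite fE /= /ket vac_norm scale1r.
Qed.
End Ket.

Lemma hilb_pointed : pointed T.
Proof.
have vac0 : vac H != 0.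
  by apply/eqP => v0; have := vac_norm H; rewrite v0 inner0 => /esym/eqP; rewrite oner_eq0.
have scal (f : hom T one one) : exists c, f = c *: idc one.
  have [c fc] := vac_span (op H f (vac H)); exists c.
  by apply: op_vac; rewrite opZ op_id.
split=> //.
- by apply/eqP => e; move/eqP: vac0; apply; rewrite -(op_id (vac H)) e op0.
- move=> x f c fc; have := op_star_self f; rewrite fc opZ op_id innerZ vac_norm mulr1 => ->.
  by rewrite inner_norm exprn_ge0.
- move=> x f f0; apply: op_vac; rewrite op0; apply: inner_eq0.
  by rewrite -op_star_self f0 op0 inner0.
- move=> x y f f0; apply: (op_inj (h := H)) => psi; rewrite op0.
  have [g <-] := ket_arrow psi.
  by rewrite -op_comp f0 op0.
(* The symmetry of the unit with itself is a scalar, which equals 1 because the flip fixes the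
   tensor square of the vacuum. *)
have [c sc] := scal (acast (hom := hom T) (ot1x one) (ot1x one) (sy one one)).
have sE : sy one one = c *: idc (one \oto one).
  apply: hom_eq; apply: aeq_trans (aeq_acast (hom := hom T) (ot1x one) (ot1x one) _) _.
  by rewrite sc; apply: aeq_scale; apply: aeq_id; rewrite ot1x.
have := op_sy (vac H) (vac H); rewrite sE opZ op_id => e.
have := congr1 (inner (pt (vac H) (vac H))) e.
by rewrite innerZ pt_inner vac_norm !mulr1 => ->; rewrite scale1r.
Qed.

End HilbertPoints.

Section EvPoints.
Variables (R : realType) (disp : Order.disp_t) (K : porderType disp).
Variables (P : stpresheaf R K) (PH : hilbert_presheaf P) (a : K).

Lemma evcat_pointed : pointed (evcat P a).
Proof.
have [p1 p2 p3 p4 p5 p6] := hilb_pointed (hp_hilb PH a).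
split.
- exact: p1.
- exact: p2.
- by move=> x f c; apply: (@p3 (x a) f c).
- by move=> x f; apply: (@p4 (x a) f).
- by move=> x y f H; apply: (@p5 (x a) (y a) f) => g; apply: H.
exact: p6.
Qed.

End EvPoints.

(** * The holonomy and the embedding *)

Section CastLemmas.
Variables (R : realType) (E : stcat R).

Lemma acast_lin x y x' y' (ex : x = x') (ey : y = y') a (f g : hom E x y) :
  acast (hom := hom E) ex ey (a *: f + g) =
  a *: acast (hom := hom E) ex ey f + acast (hom := hom E) ex ey g.
Proof. by subst. Qed.

Lemma acast_comp x y z x' y' z' (ex : x = x') (ey : y = y') (ez : z = z')
    (g : hom E y z) (f : hom E x y) :
  acast (hom := hom E) ex ez (g \oc f) =
  acast (hom := hom E) ey ez g \oc acast (hom := hom E) ex ey f.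
Proof. by subst. Qed.

Lemma acast_idc x x' (ex : x = x') : acast (hom := hom E) ex ex (idc x) = idc x'.
Proof. by subst. Qed.

Lemma acast_star x y x' y' (ex : x = x') (ey : y = y') (f : hom E x y) :
  acast (hom := hom E) ey ex (star f) = star (acast (hom := hom E) ex ey f).
Proof. by subst. Qed.

Lemma acast_eq0 x y x' y' (ex : x = x') (ey : y = y') (f : hom E x y) :
  acast (hom := hom E) ex ey f = 0 -> f = 0.
Proof. by subst. Qed.

End CastLemmas.

Section SwapArrow.
Variables (R : realType) (E : stcat R) (Pt : pointed E) (X : obj E) (h : nat).
Variable e : 'I_h -> hom E (ou E) X.

Lemma swap_epow a b (S : hom E (opow X (a + (1 + 1 + b))) (opow X (a + (1 + 1 + b)))) i :
  S === idc (opow X a) \ota (sy (opow X 1) (opow X 1) \ota idc (opow X b)) ->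
  S \oc epow e i = epow e (swapidx i).
Proof.
move=> SE; apply: hom_eq.
have iE : epow e i === pta (epow e (lpart i)) (pta
    (pta (epow e (lpart (lpart (rpart i)))) (epow e (rpart (lpart (rpart i)))))
    (epow e (rpart (rpart i)))).
  apply: aeq_trans (epow_cat _ _) _; apply: aeq_pta (aeq_rfl _) _.
  apply: aeq_trans (epow_cat _ _) _; apply: aeq_pta _ (aeq_rfl _).
  exact: epow_cat.
apply: aeq_trans (aeq_comp SE iE) _.
rewrite !pta_comp !comp1f pta_sy // /swapidx.
apply/aeq_sym.
apply: aeq_trans (epow_mjoin _ _ _) _; apply: aeq_pta (aeq_rfl _) _.
apply: aeq_trans (epow_mjoin _ _ _) _; apply: aeq_pta _ (aeq_rfl _).
exact: epow_mjoin.
Qed.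
End SwapArrow.

(** Additivity gives f r = r f(1), and surjectivity forces f(1) = 1. Applied to the object map of
    [hol_iso], this matches the r-th powers on both sides. *)
Lemma additive_bijective_id (f : nat -> nat) :
  f 0%N = 0%N -> (forall r s, f (r + s)%N = (f r + f s)%N) -> bijective f -> forall r, f r = r.
Proof.
move=> f0 fD [g gK fK].
have fM r : f r = (r * f 1%N)%N.
  by elim: r => // r IH; rewrite -addn1 fD IH mulnDl mul1n.
have f1 : f 1%N = 1%N.
  have := fK 1%N; rewrite fM => /eqP; rewrite muln_eq1 => /andP[_ /eqP].
  by [].
by move=> r; rewrite fM f1 muln1.
Qed.

Section EvArrows.
Variables (R : realType) (disp : Order.disp_t) (K : porderType disp) (P : stpresheaf R K) (a : K).

Lemma ev_aeq (x y x' y' : section P) (f : hom (evcat P a) x y) (g : hom (evcat P a) x' y') :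
  f === g -> aeq (hom := hom (P a)) (f : hom (P a) (x a) (y a)) (g : hom (P a) (x' a) (y' a)).
Proof. exact: (@aeq_pull R (P a) (section P) (fun y => y a) x y x' y' f g). Qed.

(** The equalities of sections are premises because different sections may have the same value at
    [a]. *)
Lemma aeq_ev (x y x' y' : section P) (f : hom (evcat P a) x y) (g : hom (evcat P a) x' y') :
  x = x' -> y = y' ->
  aeq (hom := hom (P a)) (f : hom (P a) (x a) (y a)) (g : hom (P a) (x' a) (y' a)) ->
  f === g.
Proof. exact: (@pull_aeq R (P a) (section P) (fun y => y a) x y x' y' f g). Qed.

Lemma beta_aeq (x y x' y' : section P) (f : hom (betacat P a) x y) (g : hom (betacat P a) x' y') :
  f === g -> aeq (hom := hom (P a)) (wval f : hom (P a) (x a) (y a)) (wval g : hom (P a) (x' a) (y' a)).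
Proof.
by move=> fg; apply/ev_aeq/(@aeq_wide R (evcat P a) (extendable_wide P a) x y x' y' f g).
Qed.

End EvArrows.

(** * The two realizations of the arrows of the fibre *)

Section Comparison.
Variables (R : realType) (disp : Order.disp_t) (K : porderType disp).
Variables (T P : stpresheaf R K) (PH : hilbert_presheaf P) (I : embedding T P).

Program Definition Isec (x : section T) : section P := @Section_ _ _ _ P (fun o => I o (x o)) _.
Next Obligation. by move=> x o o' l /=; rewrite -emb_obj secP. Qed.

Lemma Isec_ou : Isec (sec_ou T) = sec_ou P.
Proof. by apply: section_eq => o; apply: fo_ou. Qed.

Lemma Isec_ot x y : Isec (sec_ot x y) = sec_ot (Isec x) (Isec y).
Proof. by apply: section_eq => o; apply: fo_ot. Qed.

Variables (x : section T) (a : K).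
Local Notation B := (betahat x a).
Local Notation E := (evcat P a).
Local Notation X := (Isec x : obj E).

Lemma Isec_opow r : Isec (opow (x : obj (betacat T a)) r) = opow X r.
Proof. by elim: r => [|r IH] /=; [exact: Isec_ou | rewrite -IH; exact: Isec_ot]. Qed.

Definition warr r s (t : hom B r s) :
    hom (T a) ((opow (x : obj (betacat T a)) r : section T) a)
              ((opow (x : obj (betacat T a)) s : section T) a) := wval t.

Definition Phi0 r s (t : hom B r s) : hom E (Isec (opow (x : obj (betacat T a)) r))
    (Isec (opow (x : obj (betacat T a)) s)) := fa (I a) (warr t).

(** The embedding on arrows between tensor powers; the cast accounts for [Isec] preserving powers
    only up to a propositional equality. *)
Definition Phi r s (t : hom B r s) : hom E (opow X r) (opow X s) :=
  acast (hom := hom E) (Isec_opow r) (Isec_opow s) (Phi0 t).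

Lemma PhiE r s (t : hom B r s) : aeq (hom := hom (P a)) (Phi t) (fa (I a) (warr t)).
Proof.
exact: (@ev_aeq _ _ _ P a _ _ _ _ (Phi t) (Phi0 t) (acast_aeq (hom := hom E) _ _ _)).
Qed.

Lemma Phi_lin r s c (t t' : hom B r s) : Phi (c *: t + t') = c *: Phi t + Phi t'.
Proof. by rewrite /Phi -acast_lin -[RHS]/(acast _ _ _); congr acast; apply: fa_lin. Qed.

Lemma Phi_comp r s q (t : hom B s q) (t' : hom B r s) : Phi (t \oc t') = Phi t \oc Phi t'.
Proof. by rewrite /Phi -acast_comp; congr acast; apply: fa_comp. Qed.

Lemma Phi_id r : Phi (idc (r : obj B)) = idc (opow X r).
Proof. by rewrite /Phi -[RHS](acast_idc (E := E) (Isec_opow r)); congr acast; apply: fa_id. Qed.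

Lemma Phi_star r s (t : hom B r s) : Phi (star t) = star (Phi t).
Proof. by rewrite /Phi -acast_star; congr acast; apply: fa_star. Qed.

Lemma warr_ta r s r' s' (t : hom B r s) (t' : hom B r' s') :
  aeq (hom := hom (T a)) (warr (t \ota t' : hom B (r + r') (s + s'))) (warr t \ota warr t').
Proof.
have := pull_taE (opowD (x : obj (betacat T a))) t t'.
exact: beta_aeq.
Qed.

Lemma warr_sy r s :
  aeq (hom := hom (T a)) (warr (sy (r : obj B) (s : obj B) : hom B (r + s) (s + r)))
    (sy ((opow (x : obj (betacat T a)) r : section T) a)
        ((opow (x : obj (betacat T a)) s : section T) a)).
Proof.
have := pull_syE (opowD (x : obj (betacat T a))) r s.
exact: beta_aeq.
Qed.

Lemma Phi_ta r s r' s' (t : hom B r s) (t' : hom B r' s') :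
  Phi (t \ota t' : hom B (r + r') (s + s')) === Phi t \ota Phi t'.
Proof.
apply: aeq_ev; [exact/esym/(opowD X)|exact/esym/(opowD X)|].
apply: aeq_trans (PhiE _) _; apply: aeq_trans (aeq_fa (I a) (warr_ta t t')) _.
apply: aeq_trans (fa_ta _ _ _) _; apply: (@aeq_ta _ (P a)); exact/aeq_sym/PhiE.
Qed.

Lemma Phi_sy r s :
  Phi (sy (r : obj B) (s : obj B) : hom B (r + s) (s + r)) === sy (opow X r) (opow X s).
Proof.
apply: aeq_ev; [exact/esym/(opowD X)|exact/esym/(opowD X)|].
apply: aeq_trans (PhiE _) _; apply: aeq_trans (aeq_fa (I a) (warr_sy r s)) _.
apply: aeq_trans (fa_sy _ _ _) _; apply: (@aeq_sy _ (P a)).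
  by rewrite -(Isec_opow r).
by rewrite -(Isec_opow s).
Qed.

Lemma Phi_eq0 r s (t : hom B r s) : Phi t = 0 -> t = 0.
Proof.
move=> /acast_eq0 t0; apply: wval_inj; apply: (@emb_faithful _ _ _ _ _ I a).
by rewrite [RHS]fa0.
Qed.

Variable hol : holonomy x a.
Local Notation d := (hol_dim hol).
Local Notation G := (hol_grp hol).
Local Notation Theta := (hol_iso hol).

Lemma hol_fo r : Theta r = r :> nat.
Proof.
have [[g gK fK] _] := hol_isoP hol.
apply: (@additive_bijective_id Theta) => {r}.
- exact: (fo_ou Theta).
- by move=> r s; apply: (fo_ot Theta).
by exists g.
Qed.

Definition theta r s (t : hom B r s) : tens R d r s :=
  acast (hom := tens R d) (hol_fo r) (hol_fo s) (wval (fa Theta t)).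

Lemma thetaE r s (t : hom B r s) : aeq (hom := tens R d) (theta t) (wval (fa Theta t)).
Proof. exact: acast_aeq. Qed.

Lemma tens_eq n r s (f g : tens R n r s) : aeq (hom := tens R n) f g -> f = g.
Proof. exact: aeq_eq. Qed.

Lemma theta_lin r s c (t t' : hom B r s) : theta (c *: t + t') = c *: theta t + theta t'.
Proof.
apply: tens_eq; apply: aeq_trans (thetaE _) _; rewrite fa_lin wval_lin.
by apply: (@aeq_lin _ (tenscat R d)); apply/aeq_sym/thetaE.
Qed.

Lemma theta_comp r s q (t : hom B s q) (t' : hom B r s) :
  theta (t \oc t') = tcomp (theta t) (theta t').
Proof.
apply: tens_eq; apply: aeq_trans (thetaE _) _; rewrite fa_comp.
by apply: (@aeq_comp _ (tenscat R d)); apply/aeq_sym/thetaE.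
Qed.

Lemma theta_id r : theta (idc (r : obj B)) = tid R d r.
Proof.
apply: tens_eq; apply: aeq_trans (thetaE _) _; rewrite fa_id.
by apply: (@aeq_id _ (tenscat R d)); apply: hol_fo.
Qed.

Lemma theta_star r s (t : hom B r s) : theta (star t) = tstar (theta t).
Proof.
apply: tens_eq; apply: aeq_trans (thetaE _) _; rewrite fa_star.
by apply: (@aeq_star _ (tenscat R d)); apply/aeq_sym/thetaE.
Qed.

Lemma pihat_aeq (r s r' s' : nat) (f : hom (pihat G) r s) (g : hom (pihat G) r' s') :
  f === g -> aeq (hom := tens R d) (wval f) (wval g).
Proof. exact: (@aeq_wide R (tenscat R d) (intertwiner_wide G) r s r' s' f g). Qed.

Lemma theta_ta r s r' s' (t : hom B r s) (t' : hom B r' s') :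
  theta (t \ota t' : hom B (r + r') (s + s')) = ttens (theta t) (theta t').
Proof.
apply: tens_eq; apply: aeq_trans (thetaE _) _.
apply: aeq_trans (pihat_aeq (fa_ta Theta t t')) _.
by apply: (@aeq_ta _ (tenscat R d)); apply/aeq_sym/thetaE.
Qed.

Lemma theta_sy r s :
  theta (sy (r : obj B) (s : obj B) : hom B (r + s) (s + r)) = tflip R d r s.
Proof.
apply: tens_eq; apply: aeq_trans (thetaE _) _.
apply: aeq_trans (pihat_aeq (fa_sy Theta r s)) _.
by apply: (@aeq_sy _ (tenscat R d)); apply: hol_fo.
Qed.

Lemma theta_eq0 r s (t : hom B r s) : theta t = 0 -> t = 0.
Proof.
move=> /(@acast_eq0 _ (tenscat R d)) t0; have [_ /(_ r s)[g gK _]] := hol_isoP hol.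
apply: (can_inj gK); apply: wval_inj; rewrite t0.
by rewrite (fa0 Theta).
Qed.

Lemma acast_intertwiner r s r' s' (er : r = r') (es : s = s') (f : tens R d r s) :
  intertwiner G f -> intertwiner G (acast (hom := tens R d) er es f).
Proof. by case: r' / er; case: s' / es. Qed.

Lemma theta_int r s (t : hom B r s) : intertwiner G (theta t).
Proof. exact/acast_intertwiner/(whomP (fa Theta t)). Qed.

Lemma theta_ex r s (p : tens R d r s) : intertwiner G p -> exists t : hom B r s, theta t = p.
Proof.
move=> pG; have [_ /(_ r s)[g _ fK]] := hol_isoP hol.
pose p' : tens R d (Theta r) (Theta s) := acast (hom := tens R d) (esym (hol_fo r)) (esym (hol_fo s)) p.
have p'G : intertwiner G p' by apply: acast_intertwiner.
exists (g (whom_of (P := intertwiner_wide G) p'G)).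
apply: tens_eq; apply: aeq_trans (thetaE _) _; rewrite fK /=.
exact: acast_aeq.
Qed.

Section Corr.
Variables (h : nat) (e : 'I_h -> hom E (ou E) X).
Local Notation Pt := (evcat_pointed PH a).
Hypothesis eo : orthonormal Pt e.

Definition hRel r s (p : tens R d r s) (q : tens R h r s) :=
  exists2 t : hom B r s, theta t = p & mat Pt e (Phi t) = q.

Definition swapB c b : hom B (c + (1 + 1 + b)) (c + (1 + 1 + b)) :=
  idc (c : obj B) \ota (sy (1%N : obj B) (1%N : obj B) \ota idc (b : obj B)).

Lemma theta_swap c b : theta (swapB c b) = tswap R d c b.
Proof. by rewrite /swapB !theta_ta theta_sy !theta_id. Qed.

Lemma Phi_swap c b : Phi (swapB c b) ===
  idc (opow X c) \ota (sy (opow X 1) (opow X 1) \ota idc (opow X b)).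
Proof.
apply: aeq_trans (Phi_ta _ _) _; rewrite Phi_id; apply: aeq_ta (aeq_rfl _) _.
apply: aeq_trans (Phi_ta _ _) _; rewrite Phi_id; apply: aeq_ta _ (aeq_rfl _).
exact: Phi_sy.
Qed.

Lemma star_swapB c b : star (swapB c b) = swapB c b.
Proof.
have es : star (sy (1%N : obj B) (1%N : obj B)) = sy (1%N : obj B) (1%N : obj B).
  exact: sy_star.
have e2 := ta_star (T := B) (sy (1%N : obj B) (1%N : obj B)) (idc (b : obj B)).
rewrite es star_id in e2.
have e1 := ta_star (T := B) (idc (c : obj B))
  (sy (1%N : obj B) (1%N : obj B) \ota idc (b : obj B)).
rewrite e2 star_id in e1; exact: e1.
Qed.

Lemma mat_swap c b : mat Pt e (Phi (swapB c b)) = tswap R h c b.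
Proof.
rewrite (mat_ta Pt e (Phi_ta _ _)) (mat_ta Pt e (Phi_ta _ _)) !Phi_id !mat_id //.
by rewrite (mat_sy eo (Phi_sy _ _)).
Qed.

(** The family [e] is orthonormal but possibly incomplete. Composition is needed only with
    transpositions of factors, and these permute the basis vectors. *)
Lemma hRel_corr : corr G hRel.
Proof.
split.
- move=> r s c p p' q q' [t <- <-] [t' <- <-]; exists (c *: t + t').
    exact: theta_lin.
  by rewrite Phi_lin mat_lin.
- by move=> r s p /theta_ex[t tp]; exists (mat Pt e (Phi t)), t.
- by move=> r s p q [t <- _]; apply: theta_int.
- move=> r s q [t /theta_eq0-> <-].
  have := Phi_lin (-1) (0 : hom B r s) 0.
  rewrite scaler0 addr0 scaleN1r addNr => ->.
  by apply: tensP => j i; rewrite matE comp0f compf0 sc0 [RHS]ffunE.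
- exists (idc (0%N : obj B)); first exact: theta_id.
  by rewrite Phi_id mat_id.
- move=> r s p q [t <- <-]; exists (idc (1%N : obj B) \ota t : hom B (1 + r) (1 + s)).
    by have := theta_ta (idc (1%N : obj B)) t; rewrite theta_id.
  by have := mat_ta Pt e (Phi_ta (idc (1%N : obj B)) t); rewrite Phi_id mat_id.
- move=> r c b p q [t <- <-]; exists (swapB c b \oc t).
    by rewrite theta_comp theta_swap.
  rewrite Phi_comp (@mat_compl _ _ Pt _ _ _ eo _ _ _ _ _ (@swapidx h c b)) ?mat_swap // => i.
  by rewrite -Phi_star star_swapB; exact: (swap_epow Pt e i (Phi_swap c b)).
- move=> s c b p q [t <- <-]; exists (t \oc swapB c b).
    by rewrite theta_comp theta_swap.
  rewrite Phi_comp (@mat_compr _ _ Pt _ _ _ eo _ _ _ _ _ (@swapidx h c b)) ?mat_swap // => i.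
  exact: (swap_epow Pt e i (Phi_swap c b)).
Qed.

End Corr.

End Comparison.

(** * Automorphisms fixing the objects, and their unitary matrices *)

Section Automorphisms.
Variables (R : realType) (E : stcat R) (Pt : pointed E).
Local Notation C := R[i].
Local Notation one := (ou E).

Record autf (F : forall y z : obj E, hom E y z -> hom E y z) : Prop := Autf {
  autf_lin : forall y z a (f g : hom E y z), F y z (a *: f + g) = a *: F y z f + F y z g;
  autf_comp : forall y z w (g : hom E z w) (f : hom E y z),
    F y w (g \oc f) = F z w g \oc F y z f;
  autf_id : forall y, F y y (idc y) = idc y;
  autf_star : forall y z (f : hom E y z), F z y (star f) = star (F y z f);
  autf_ta : forall y z y' z' (f : hom E y z) (g : hom E y' z'),
    F _ _ (f \ota g) = F y z f \ota F y' z' g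
}.

Section Aut.
Variables (F : forall y z : obj E, hom E y z -> hom E y z) (FP : autf F).
Arguments F {y z}.

Lemma autf0 y z : F (0 : hom E y z) = 0.
Proof. by have := autf_lin FP (-1) (0 : hom E y z) 0; rewrite scaler0 addr0 scaleN1r addNr. Qed.

Lemma autfZ y z a (f : hom E y z) : F (a *: f) = a *: F f.
Proof. by rewrite -[a *: f]addr0 (autf_lin FP) autf0 addr0. Qed.

Lemma autf_sum y z (I : Type) (s : seq I) (f : I -> hom E y z) :
  F (\sum_(i <- s) f i) = \sum_(i <- s) F (f i).
Proof.
elim: s => [|i s IH]; rewrite ?big_nil ?autf0 // !big_cons -IH.
by have := autf_lin FP 1 (f i) (\sum_(j <- s) f j); rewrite !scale1r.
Qed.

Lemma autf_sc (f : hom E one one) : sc Pt (F f) = sc Pt f.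
Proof. by rewrite {1}(scE Pt f) autfZ (autf_id FP) scZ. Qed.

Lemma autf_acast y z y' z' (ey : y = y') (ez : z = z') (f : hom E y z) :
  F (acast (hom := hom E) ey ez f) = acast (hom := hom E) ey ez (F f).
Proof. by subst. Qed.

Lemma autf_pta y z (f : hom E one y) (g : hom E one z) : F (pta f g) = pta (F f) (F g).
Proof. by rewrite /pta autf_acast (autf_ta FP). Qed.

Variables (X : obj E) (h : nat) (e : 'I_h -> hom E one X).
Hypothesis eo : orthonormal Pt e.
Hypothesis ef : \sum_i e i \oc star (e i) = idc X.

Definition autm : 'M[C]_h := \matrix_(j, i) sc Pt (star (e j) \oc F (e i)).

Lemma autm_wpow r (j i : midx h r) :
  sc Pt (star (epow e j) \oc F (epow e i)) = wpow autm j i.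
Proof.
elim: r j i => [|r IH] j i /=.
  by rewrite star_id comp1f (autf_id FP) sc_id /wpow big_ord0.
rewrite autf_pta sc_pta IH /wpow big_ord_recl mxE; congr (_ * _).
apply: eq_bigr => k _; rewrite !ffunE; congr (autm (j _) (i _)); exact: val_inj.
Qed.

Lemma autf_epow r (i : midx h r) : F (epow e i) = \sum_j wpow autm j i *: epow e j.
Proof.
rewrite (epow_span Pt ef (F (epow e i))); apply: eq_bigr => j _.
by rewrite autm_wpow.
Qed.

(** F(f o e_i) is computed both as F(f) o F(e_i) and by expanding f o e_i in the basis. Hence F acts
    on matrices as conjugation by tensor powers of [autm]. *)
Lemma autf_mat r s (f : hom E (opow X r) (opow X s)) :
  tcomp (mat Pt e (F f)) (mpow autm r) = tcomp (mpow autm s) (mat Pt e f).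
Proof.
apply: tensP => j i; rewrite !ffunE /=.
transitivity (sc Pt (star (epow e j) \oc F (f \oc epow e i))).
  rewrite (autf_comp FP) autf_epow comp_sumr comp_sumr sc_sum.
  apply: eq_bigr => k _; rewrite matE ffunE !compZr sc_scale mulrC.
  by [].
rewrite (epow_span Pt ef (f \oc epow e i)) autf_sum comp_sumr sc_sum.
apply: eq_bigr => k _; rewrite autfZ compZr sc_scale autm_wpow matE ffunE /= mulrC.
by [].
Qed.

Lemma autf_e i : F (e i) = \sum_k autm k i *: e k.
Proof.
rewrite -[LHS]comp1f -ef comp_suml; apply: eq_bigr => k _.
by rewrite -compA [star _ \oc _](scE Pt) compZr compf1 mxE.
Qed.

(** F fixes the scalars, in particular the inner products of the e_i. *)
Lemma autm_unitary : autm \is unitarymx.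
Proof.
apply/unitarymxP/mulmx1C/matrixP => i j; rewrite !mxE.
have := autf_sc (star (e i) \oc e j).
rewrite eo (autf_comp FP) (autf_star FP) => <-.
rewrite [F (e j)]autf_e comp_sumr sc_sum; apply: eq_bigr => k _.
rewrite compZr sc_scale mulrC; congr (_ * _).
by rewrite !mxE -sc_star star_comp starK.
Qed.

End Aut.

Lemma autm_comp (F F' : forall y z : obj E, hom E y z -> hom E y z) X h (e : 'I_h -> hom E one X) :
  autf F -> \sum_i e i \oc star (e i) = idc X ->
  autm (fun y z f => F y z (F' y z f)) e = autm F e *m autm F' e.
Proof.
move=> FP ef; apply/matrixP => j i; rewrite !mxE (autf_e F' ef) (autf_sum FP).
rewrite comp_sumr sc_sum; apply: eq_bigr => k _.
by rewrite (autfZ FP) compZr sc_scale !mxE mulrC.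
Qed.

End Automorphisms.

(** * Transport along paths in the Hilbert presheaf *)

Section FlatTransport.
Variables (R : realType) (disp : Order.disp_t) (K : porderType disp).
Variables (P : stpresheaf R K) (PH : hilbert_presheaf P).
Local Notation EV := (evcat P).

Record evf (b c : K) (F : forall y z : section P, hom (EV b) y z -> hom (EV c) y z) : Prop := Evf {
  evf_lin : forall y z a (f g : hom (EV b) y z), F y z (a *: f + g) = a *: F y z f + F y z g;
  evf_comp : forall y z w (g : hom (EV b) z w) (f : hom (EV b) y z),
    F y w (g \oc f) = F z w g \oc F y z f;
  evf_id : forall y, F y y (idc (y : obj (EV b))) = idc (y : obj (EV c));
  evf_star : forall y z (f : hom (EV b) y z), F z y (star f) = star (F y z f);
  evf_ta : forall y z y' z' (f : hom (EV b) y z) (g : hom (EV b) y' z'),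
    F (sec_ot y y') (sec_ot z z') (f \ota g) = F y z f \ota F y' z' g;
  evf_inj : forall y z, injective (F y z);
  evf_surj : forall y z g, exists f, F y z f = g
}.

Definition evinv b c F (FP : @evf b c F) (y z : section P) (g : hom (EV c) y z) : hom (EV b) y z :=
  projT1 (cid (evf_surj FP g)).

Lemma evinvK b c F (FP : @evf b c F) y z g : F y z (evinv FP g) = g.
Proof. by rewrite /evinv; case: cid. Qed.

Lemma evinvKV b c F (FP : @evf b c F) y z f : evinv FP (F y z f) = f.
Proof. by apply: (evf_inj FP); apply: evinvK. Qed.

Lemma evf_evinv b c F (FP : @evf b c F) : evf (evinv FP).
Proof.
split=> [y z a f g|y z w g f|y|y z f|y z y' z' f g|y z f g fg|y z g].
- by apply: (evf_inj FP); rewrite (evf_lin FP) !evinvK.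
- by apply: (evf_inj FP); rewrite (evf_comp FP) !evinvK.
- by apply: (evf_inj FP); rewrite (evf_id FP) !evinvK.
- by apply: (evf_inj FP); rewrite (evf_star FP) !evinvK.
- by apply: (evf_inj FP); rewrite (evf_ta FP) !evinvK.
- by rewrite -(evinvK FP f) fg evinvK.
by exists (F y z g); rewrite evinvKV.
Qed.

Lemma evf_cat b c d F F' : @evf b c F -> @evf c d F' -> evf (fun y z f => F' y z (F y z f)).
Proof.
move=> FP FP'; split=> [y z a f g|y z w g f|y|y z f|y z y' z' f g|y z f g|y z g].
- by rewrite (evf_lin FP) (evf_lin FP').
- by rewrite (evf_comp FP) (evf_comp FP').
- by rewrite (evf_id FP) (evf_id FP').
- by rewrite (evf_star FP) (evf_star FP').
- by rewrite (evf_ta FP) (evf_ta FP').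
- by move=> /(evf_inj FP')/(evf_inj FP).
by exists (evinv FP (evinv FP' g)); rewrite !evinvK.
Qed.

Lemma evf_autf b F : @evf b b F -> autf (E := EV b) F.
Proof.
move=> FP; split.
- exact: (evf_lin FP).
- exact: (evf_comp FP).
- exact: (evf_id FP).
- exact: (evf_star FP).
exact: (evf_ta FP).
Qed.

Definition resE o o' (l : (o <= o')%O) (y z : section P) (f : hom (EV o') y z) : hom (EV o) y z :=
  acast (hom := hom (P o)) (secP y l) (secP z l)
    (fa (res P l) (f : hom (P o') (y o') (z o'))).

Lemma resE_aeq o o' (l : (o <= o')%O) (y z : section P) (f : hom (EV o') y z) :
  aeq (hom := hom (P o)) (resE l f) (fa (res P l) (f : hom (P o') (y o') (z o'))).
Proof. exact: acast_aeq. Qed.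

(** Surjectivity is where fullness of the restrictions enters; it allows arrows between sections to
    be lifted against the order. *)
Lemma resE_evf o o' (l : (o <= o')%O) : evf (resE l).
Proof.
split=> [y z a f g|y z w g f|y|y z f|y z y' z' f g|y z f g|y z g].
- by rewrite /resE -(acast_lin (E := P o)) -fa_lin.
- transitivity (acast (hom := hom (P o)) (secP y l) (secP w l)
      (fa (res P l) (g : hom (P o') (z o') (w o')) \oc
       fa (res P l) (f : hom (P o') (y o') (z o')))).
    by congr acast; apply: fa_comp.
  exact: (@acast_comp _ (P o) _ _ _ _ _ _ (secP y l) (secP z l) (secP w l)).
- transitivity (acast (hom := hom (P o)) (secP y l) (secP y l) (idc (res P l (y o')))).
    by congr acast; apply: fa_id.
  exact: (@acast_idc _ (P o) _ _ (secP y l)).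
- transitivity (acast (hom := hom (P o)) (secP z l) (secP y l)
      (star (fa (res P l) (f : hom (P o') (y o') (z o'))))).
    by congr acast; apply: fa_star.
  exact: (@acast_star _ (P o) _ _ _ _ (secP y l) (secP z l)).
- apply: (@hom_eq _ (P o)); apply: aeq_trans (resE_aeq _ _) _.
  apply: aeq_trans (fa_ta _ _ _) _.
  by apply: (@aeq_ta _ (P o)); apply/aeq_sym/resE_aeq.
- move=> fg; apply: (@res_faithful _ _ _ P _ _ l); apply: (@hom_eq _ (P o)).
  apply: aeq_trans (aeq_sym (resE_aeq l f)) _; rewrite fg; exact: resE_aeq.
have [f fE] := @hp_full _ _ _ P PH o o' l _ _ (acast (hom := hom (P o)) (esym (secP y l)) (esym (secP z l)) g).
exists f; apply: (@hom_eq _ (P o)); apply: aeq_trans (resE_aeq l f) _.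
by rewrite fE; apply: acast_aeq.
Qed.

Lemma resE_trans o o' o'' (l : (o <= o')%O) (l' : (o' <= o'')%O) (l'' : (o <= o'')%O)
    (y z : section P) (f : hom (EV o'') y z) : resE l (resE l' f) = resE l'' f.
Proof.
apply: (@hom_eq _ (P o)); apply: aeq_trans (resE_aeq _ _) _.
apply: aeq_trans (aeq_fa (res P l) (resE_aeq l' f)) _.
apply: aeq_trans (res_hom l l' l'' _) _; exact/aeq_sym/resE_aeq.
Qed.

Definition flat1 o o' (b : simp1 o o') (y z : section P) (f : hom (EV o) y z) : hom (EV o') y z :=
  resE (simp1_tgt b) (evinv (resE_evf (simp1_src b)) f).

Fixpoint flat o o' (p : spath o o') (y z : section P) : hom (EV o) y z -> hom (EV o') y z :=
  match p in spath o o' return hom (EV o) y z -> hom (EV o') y z with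
  | sp_one _ _ b => @flat1 _ _ b y z
  | sp_snoc _ _ _ b p' => fun f => flat1 b (@flat _ _ p' y z f)
  end.

Lemma flat1_evf o o' (b : simp1 o o') : evf (flat1 b).
Proof. exact: evf_cat (evf_evinv _) (resE_evf _). Qed.

Lemma flat_evf o o' (p : spath o o') : evf (@flat o o' p).
Proof.
elim: p => {o o'} [u v b|u v w b p IH]; first exact: flat1_evf.
exact: evf_cat IH (flat1_evf b).
Qed.

Lemma flat_comp x y z (q : spath y z) (p : spath x y) (s t : section P) (f : hom (EV x) s t) :
  flat (sp_comp q p) f = flat q (flat p f).
Proof. by elim: q p f => {y z} [y z b|y z w b q IH] p f //=; rewrite IH. Qed.

(* Both sides can be computed from any upper bound of the support. *)
Lemma flat1_res o o' c (b : simp1 o o') (lb : (supp1 b <= c)%O) (l : (o <= c)%O) (l' : (o' <= c)%O)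
    (y z : section P) (f : hom (EV c) y z) : flat1 b (resE l f) = resE l' f.
Proof.
rewrite -(resE_trans (simp1_src b) lb l) /flat1 evinvKV.
exact: resE_trans.
Qed.

(** For a 2-simplex, the arrow is lifted to an element c above the three supports; transport along
    either side is then restriction from c. *)
Lemma flat_homotopic o o' (p q : spath o o') : homotopic p q ->
  forall (y z : section P) (f : hom (EV o) y z), flat p f = flat q f.
Proof.
elim=> {o o' p q} [u v p|u v p q _ IH|u v p q r _ IH1 _ IH2
  |x y w f g k [c [lf lg lk]]|x y w p p' q q' _ IH1 _ IH2] s t f0 //.
- by rewrite IH1.
- have lx := le_trans (simp1_src f) lf; have ly := le_trans (simp1_tgt f) lf.
  have lw := le_trans (simp1_tgt g) lg.
  rewrite /= -[f0](evinvK (resE_evf lx)).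
  by rewrite (flat1_res lk lx lw) (flat1_res lf lx ly) (flat1_res lg ly lw).
by rewrite !flat_comp IH1 IH2.
Qed.

Variables (T : stpresheaf R K) (I : embedding T P).

Definition embE o (y z : section T) (t : hom (betacat T o) y z) : hom (EV o) (Isec I y) (Isec I z) :=
  fa (I o) (wval t : hom (T o) (y o) (z o)).

Lemma embE_res o o' (l : (o <= o')%O) (y z : section T) (f : hom (betacat T o') y z)
    (t : hom (betacat T o) y z) : beta_res l f t -> resE l (embE f) = embE t.
Proof.
move=> ft; apply: (@hom_eq _ (P o)); apply: aeq_trans (resE_aeq _ _) _.
apply: aeq_trans (aeq_sym (emb_hom I l (wval f : hom (T o') (y o') (z o')))) _.
exact: aeq_fa.
Qed.

Lemma embE_transport o o' (p : spath o o') (y z : section T) (t : hom (betacat T o) y z)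
    (t' : hom (betacat T o') y z) : transport p t t' -> flat p (embE t) = embE t'.
Proof.
have step u v (b : simp1 u v) (s : hom (betacat T u) y z) (s' : hom (betacat T v) y z) :
    transport1 b s s' -> flat1 b (embE s) = embE s'.
  move=> [f fs fs']; rewrite -(embE_res fs) /flat1 evinvKV; exact: embE_res.
elim: p t t' => {o o'} [u v b|u v w b p IH] t t' /=; first exact: step.
by move=> [s /IH-> /step].
Qed.

End FlatTransport.

(** * Construction of the lift *)

Section Lift.
Variables (R : realType) (disp : Order.disp_t) (K : porderType disp).
Variables (T P : stpresheaf R K) (PH : hilbert_presheaf P) (I : embedding T P).
Variables (x : section T) (a : K) (hol : holonomy x a).
Local Notation d := (hol_dim hol).
Local Notation G := (hol_grp hol).
Local Notation B := (betahat x a).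
Local Notation E := (evcat P a).
Local Notation X := (Isec I x : obj E).
Local Notation Pt := (evcat_pointed PH a).
Local Notation hR h e r s p q := (@hRel R disp K T P PH I x a hol h e r s p q).

(** [corr_dim_le] bounds orthonormal families by d, so a complete one exists. For it [mat] is
    multiplicative and faithful, and [corr_point] and [polar_point] apply. *)
Lemma comparison_unitary : (0 < d)%N ->
  exists e : 'I_d -> hom E (ou E) X, [/\ orthonormal Pt e,
    \sum_i e i \oc star (e i) = idc X &
    exists v : unitary R d, forall r s (t : hom B r s),
      act v (theta hol t) = mat Pt e (Phi I t)].
Proof.
move=> d0.
have [h [e [eo ef]]] : exists h (e : 'I_h -> hom E (ou E) X), orthonormal Pt e /\
    \sum_i e i \oc star (e i) = idc X.
  apply: (@orthonormal_complete _ _ Pt X d) => h e eo.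
  case: (posnP h) => [->//|h0]; exact: corr_dim_le (hRel_corr hol eo) h0 d0.
(* If h = 0 the identity of X is 0; by faithfulness the identity of C^d would be 0 too, against d >
   0. *)
have h0 : (0 < h)%N.
  rewrite lt0n; apply/eqP => h0; subst h.
  have : Phi I (idc (1%N : obj B)) = 0.
    by rewrite Phi_id /= -ta_id -ef big_ord0 ta0l.
  move=> /(Phi_eq0 (t := idc (1%N : obj B))) e1.
  have := theta_id hol 1; rewrite e1.
  have -> : theta hol (0 : hom B 1%N 1%N) = 0 :> tens R d 1 1.
    have := theta_lin hol (-1) (0 : hom B 1%N 1%N) 0.
    by rewrite scaler0 addr0 scaleN1r addNr.
  move=> /ffunP/(_ ([ffun=> Ordinal d0], [ffun=> Ordinal d0])); rewrite !ffunE /= eqxx.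
  by move=> /esym/eqP; rewrite oner_eq0.
have Rc := hRel_corr hol eo.
have Rid r : hR h e _ _ (tid R d r) (tid R h r).
  by exists (idc (r : obj B)); [exact: theta_id | rewrite Phi_id mat_id].
have Rta r s r' s' p q p' q' : hR h e r s p q ->
    hR h e r' s' p' q' ->
    hR h e _ _ (ttens p p') (ttens q q').
  move=> [t <- <-] [t' <- <-]; exists (t \ota t' : hom B (r + r') (s + s')).
    exact: theta_ta.
  by rewrite (mat_ta Pt e (Phi_ta _ _ _)).
have Rcomp r s q p1 q1 p2 q2 : hR h e s q p1 q1 ->
    hR h e r s p2 q2 ->
    hR h e _ _ (tcomp p1 p2) (tcomp q1 q2).
  move=> [t <- <-] [t' <- <-]; exists (t \oc t'); first exact: theta_comp.
  by rewrite Phi_comp (mat_comp _ ef).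
have Rstar r s p q : hR h e r s p q ->
    hR h e _ _ (tstar p) (tstar q).
  move=> [t <- <-]; exists (star t); first exact: theta_star.
  by rewrite Phi_star mat_star.
have Rfaith r s p : hR h e r s p 0 -> p = 0.
  move=> [t <- /(mat_eq0 ef)/Phi_eq0->].
  have := theta_lin hol (-1) (0 : hom B r s) 0.
  by rewrite scaler0 addr0 scaleN1r addNr.
have [hd [w [y [wy wR]]]] := corr_point Rc Rcomp Rid Rta Rfaith h0 d0.
subst h; exists e; split=> //.
have [v vR] := polar_point Rstar wy wR.
by exists v => r s t; apply/act_tcomp/vR; exists t.
Qed.

Lemma Phi_flat (p : loop a) r s (t t' : hom B r s) :
  loop_transport p t t' -> Phi I t' = flat PH p (Phi I t).
Proof.
move=> tt'; have := embE_transport PH I tt'; rewrite -/(Phi0 I t) => e.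
rewrite /Phi (@autf_acast R E (fun (y z : obj E) (f : hom E y z) => flat PH p (f : hom E y z))).
by congr acast; rewrite -[Phi0 I t']e.
Qed.

Lemma theta_uhat (u : normalizer G) r s (t t' : hom B r s) :
  fa (hol_iso hol) t' = uhat u (fa (hol_iso hol) t) ->
  theta hol t' = act (nval u) (theta hol t).
Proof.
move=> e; apply: tens_eq; apply: aeq_trans (thetaE hol t') _; rewrite e /=.
have upE q q' : q = q' ->
    aeq (hom := tens R d) (upowc (nval u) q) (upowc (nval u) q').
  by move=> ->; apply: aeq_refl.
apply: (@aeq_comp _ (tenscat R d)).
  apply: (@aeq_comp _ (tenscat R d)); last exact/aeq_sym/thetaE.
  exact/upE/hol_fo.
by apply: (@aeq_star _ (tenscat R d)); apply/upE/hol_fo.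
Qed.

Section Lifting.
Variables (e : 'I_d -> hom E (ou E) X) (v : unitary R d).
Hypothesis eo : orthonormal Pt e.
Hypothesis ef : \sum_i e i \oc star (e i) = idc X.
Hypothesis vP : forall r s (t : hom B r s), act v (theta hol t) = mat Pt e (Phi I t).

Let flatP (p : loop a) := evf_autf (flat_evf PH p).

Definition flat_unitary (p : loop a) : unitary R d :=
  Unitary (autm_unitary (flatP p) eo ef).

Definition lift_unitary (p : loop a) : unitary R d := (flat_unitary p ^ v)%g.

Lemma flat_unitaryM (p q : loop a) :
  flat_unitary (sp_comp p q) = (flat_unitary p * flat_unitary q)%g.
Proof.
apply: uvalI; rewrite /= -(autm_comp Pt _ (flatP p) ef); apply/matrixP => i j.
by rewrite !mxE; congr (sc _ (_ \oc _)); apply: flat_comp.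
Qed.

Lemma flat_unitary_homotopic (p q : loop a) :
  homotopic p q -> flat_unitary p = flat_unitary q.
Proof.
move=> pq; apply/uvalI/matrixP => i j.
by rewrite !mxE; congr (sc _ (_ \oc _)); apply: flat_homotopic.
Qed.

(* Both u and the lift induce the action of p on the intertwiners of G. *)
Lemma lift_unitary_class (p : loop a) (u : normalizer G) :
  qproj (innormal G) u = hol_chi hol (pi1_class p) -> G ((nval u)^-1 * lift_unitary p)%g.
Proof.
move=> up; apply: intertwiners_determine => r s tau tauG.
apply/act_fixed; have [t <-] := theta_ex tauG.
have [t' tt' t'E] := hol_chiP up t.
(* This becomes v u theta(t) = U(p) v theta(t), all letters acting by conjugation. *)
have := vP t'; rewrite (theta_uhat t'E) (Phi_flat tt').
have /esym := autf_mat Pt (flatP p) ef (Phi I t).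
rewrite (mpow_upow (flat_unitary p) r) (mpow_upow (flat_unitary p) s) => /act_tcomp <-.
rewrite -vP => H; rewrite actM.
have -> : act (lift_unitary p) (theta hol t) = act (nval u) (theta hol t).
  by rewrite !actM -H -actM mulVg act1.
by rewrite -actM mulVg act1.
Qed.

Lemma lift_unitary_normal (p : loop a) : lift_unitary p \in normal_pred G.
Proof.
pose u := repr (hol_chi hol (pi1_class p)).
have Gg := @lift_unitary_class p u (qproj_repr _).
set g := (_ * _)%g in Gg.
have -> : lift_unitary p = (nval u * g)%g by rewrite mulgA mulgV mul1g.
clearbody g; apply/asboolP => w.
have -> : (nval u * g * w * (nval u * g)^-1)%g = (nval u * (g * w * g^-1) * (nval u)^-1)%g.
  by rewrite invgM !mulgA.
rewrite nval_conj; split=> [Gw|Gw]; first by do ?apply: cgM => //; apply: cgV.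
have -> : w = (g^-1 * (g * w * g^-1) * g)%g.
  by rewrite !mulgA mulVg mul1g -mulgA mulVg mulg1.
by do ?apply: cgM => //; apply: cgV.
Qed.

(** The loop [repr c] is an arbitrary choice; [flat_unitary_homotopic] makes the result independent
    of it. *)
Definition lift (c : pi1 a) : normalizer G := Normalizer (lift_unitary_normal (repr c)).

Lemma lift_morph : {morph lift : c c' / (c * c')%g >-> (c * c')%g}.
Proof.
move=> c c'; apply: val_inj => /=.
have -> : lift_unitary (repr (c * c')%g) = lift_unitary (sp_comp (repr c) (repr c')).
  congr (_ ^ _)%g; apply: flat_unitary_homotopic.
  by apply/pi1_classP; rewrite pi1_repr.
by rewrite /lift_unitary flat_unitaryM conjMg.
Qed.

HB.instance Definition _ := isMultiplicative.Build (pi1 a) (normalizer G) lift lift_morph.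

Lemma lift_class c : qproj (innormal G) (lift c) = hol_chi hol c.
Proof.
pose u := repr (hol_chi hol c).
rewrite -(qproj_repr (hol_chi hol c)) -/u; apply/esym/qprojP.
by apply: lift_unitary_class; rewrite pi1_repr; apply: qproj_repr.
Qed.

End Lifting.

Lemma holonomy_has_lift : has_lift hol.
Proof.
(* For d = 0 all unitaries equal 1, and the constant morphism is a lift. *)
have [d0|d0] := posnP d.
  exists (@one_fun (pi1 a) (normalizer G)) => c.
  pose u := repr (hol_chi hol c).
  rewrite -(qproj_repr (hol_chi hol c)) -/u; apply/qprojP.
  rewrite invg1 mul1g /=; suff -> : nval u = 1%g by apply: cg1.
  by apply/uvalI/matrixP => i; have := ltn_ord i; rewrite [X in (_ < X)%N]d0.
have [e [eo ef [v vP]]] := comparison_unitary d0.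
exists (lift eo ef vP) => c; exact: lift_class.
Qed.

End Lift.

Theorem theorem5p7 (R : realType) (disp : Order.disp_t) (K : porderType disp)
  (K_connected : pathwise_connected K)
  (T : stpresheaf R K) (T_DR : is_DR_presheaf T)
  (P : stpresheaf R K) (P_hilbert : hilbert_presheaf P)
  (I : embedding T P) (x : section T) :
  liftable x.
Proof. by move=> a hol; apply: (holonomy_has_lift P_hilbert I). Qed.
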